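(* Let $1<p\le2$ and $\lambda,\mu_{11},\mu_{22},\mu_{12}>0$. If $$\frac{\mu_{11}\mu_{22}-\mu_{12}^2}{\mu_{11}+\mu_{22}}>\begin{cases}\dfrac{(p-1)^2}{4}\left[\dfrac{2^p(2-p)^{2-p}}{\lambda^{2-p}}\right]^{2/(p-1)},&\text{if }1<p<2,\\[2mm] 4,&\text{if }p=2,\end{cases}$$ then system $(E)$ has only the trivial solution $(u,v)=(0,0)$ in $H$.
   Context: Let $H=H^1(\mathbb{R}^3)\times H^1(\mathbb{R}^3)$ (real-valued functions), with $\|(u,v)\|_H^2=\int_{\mathbb{R}^3}(|\nabla u|^2+\lambda u^2+|\nabla v|^2+\lambda v^2)\,dx$. For $w\in H^1(\mathbb{R}^3)$ put $\phi_w(x)=\int_{\mathbb{R}^3}\frac{w^2(y)}{|x-y|}\,dy$. System $(E)$ is $$-\Delta u+\lambda u+(\mu_{11}\phi_u-\mu_{12}\phi_v)u=\frac{1}{2\pi}\int_0^{2\pi}|u+e^{i\theta}v|^{p-1}(u+e^{i\theta}v)\,d\theta\ \text{ in }\mathbb{R}^3,$$ $$-\Delta v+\lambda v+(\mu_{22}\phi_v-\mu_{12}\phi_u)v=\frac{1}{2\pi}\int_0^{2\pi}|v+e^{i\theta}u|^{p-1}(v+e^{i\theta}u)\,d\theta\ \text{ in }\mathbb{R}^3.$$ Its solutions are exactly the critical points in $H$ of $$J(u,v)=\tfrac12\|(u,v)\|_H^2+\tfrac14\int_{\mathbb{R}^3}\left(\mu_{11}\phi_uu^2+\mu_{22}\phi_vv^2-2\mu_{12}\phi_vu^2\right)dx-\frac{1}{2\pi(p+1)}\int_{\mathbb{R}^3}\int_0^{2\pi}|u+e^{i\theta}v|^{p+1}\,d\theta\,dx.$$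 *)

(* Defs.v *)
From HB Require Import structures.
From mathcomp Require Import all_boot all_order all_algebra.
From mathcomp Require Import all_classical all_reals all_analysis.
From mathcomp Require Import complex.

Set Implicit Arguments.
Unset Strict Implicit.
Unset Printing Implicit Defensive.

Import Order.TTheory GRing.Theory Num.Theory.
Import numFieldNormedType.Exports.

Local Open Scope classical_set_scope.
Local Open Scope ring_scope.
Local Open Scope complex_scope.

(* The library norm on R * R * R is the sup norm; it only serves for the
   topology and differentiability. Distances use [dist3]. *)
Definition R3 (R : realType) : Type :=
  (measurableTypeR R * measurableTypeR R * measurableTypeR R)%type.

Definition lebesgue3 (R : realType) : {measure set (R3 R) -> \bar R} :=
  (@lebesgue_measure R \x @lebesgue_measure R \x @lebesgue_measure R)%E.

Definition dist3 (R : realType) (x y : R3 R) : R :=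
  Num.sqrt ((x.1.1 - y.1.1) ^+ 2 + (x.1.2 - y.1.2) ^+ 2 + (x.2 - y.2) ^+ 2).

Definition basis3 (R : realType) (i : 'I_3) : R * R * R :=
  ((i == 0%N :> nat)%:R, (i == 1%N :> nat)%:R, (i == 2%N :> nat)%:R).

Definition partial (R : realType) (i : 'I_3) (f : R3 R -> R) : R3 R -> R :=
  fun x => 'D_(basis3 R i) f x.

(* Smoothness: every iterated partial derivative is everywhere (Frechet)
   differentiable. *)
Definition smooth (R : realType) (f : R3 R -> R) : Prop :=
  forall (s : seq 'I_3) (x : R3 R),
    differentiable (foldr (@partial R) f s) x.

Definition test_function (R : realType) (f : R3 R -> R) : Prop :=
  smooth f /\ compact (closure [set x | f x != 0]).

Definition weak_partial (R : realType) (i : 'I_3) (u g : R3 R -> R) : Prop :=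
  forall f : R3 R -> R, test_function f ->
    \int[@lebesgue3 R]_x (u x * partial i f x)
    = - \int[@lebesgue3 R]_x (g x * f x).

(* [H1_grad u G]: u is in H^1(R^3) and G is (a representative of) its weak
   gradient, which is unique up to null sets. *)
Definition H1_grad (R : realType) (u : R3 R -> R)
    (G : 'I_3 -> R3 R -> R) : Prop :=
  u \in Lfun (@lebesgue3 R) 2%:E /\
  forall i, G i \in Lfun (@lebesgue3 R) 2%:E /\ weak_partial i u (G i).

(* For w in H^1 the integral is finite at every x. The integrand is 0 at y = x
   by the convention 0^-1 = 0, which is harmless since {x} is a null set. *)
Definition coulomb (R : realType) (w : R3 R -> R) (x : R3 R) : R :=
  \int[@lebesgue3 R]_y (w y ^+ 2 / dist3 x y).

Definition Cintegral (d : measure_display) (T : measurableType d)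
    (R : realType) (mu : {measure set T -> \bar R}) (D : set T) (f : T -> R[i]) :
    R[i] :=
  (\int[mu]_(x in D) complex.Re (f x)) +i* (\int[mu]_(x in D) complex.Im (f x)).

Definition expi (R : realType) (t : R) : R[i] := cos t +i* sin t.

Definition cnorm (R : realType) (z : R[i]) : R := complex.Re `|z|.

(* (2 pi)^-1 * int_0^{2 pi} |a + e^{it} b|^{p-1} (a + e^{it} b) dt *)
Definition phase_average (R : realType) (p a b : R) : R[i] :=
  ((2 * pi)^-1)%:C *
  Cintegral (@lebesgue_measure R) `[0, 2 * pi]
    (fun t => (cnorm (a%:C + expi t * b%:C) `^ (p - 1))%:C
              * (a%:C + expi t * b%:C)).

(* Weak form, tested against all of H^1(R^3), of
     - Laplacian u + lambda u + V u = N,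
   where u has weak gradient G. The right-hand side N is a priori complex
   valued, so the identity is between complex numbers. *)
Definition weak_equation (R : realType) (lambda : R) (V : R3 R -> R)
    (N : R3 R -> R[i]) (u : R3 R -> R)
    (G : 'I_3 -> R3 R -> R) : Prop :=
  forall (h : R3 R -> R) (Gh : 'I_3 -> R3 R -> R), H1_grad h Gh ->
    (\int[@lebesgue3 R]_x
       (\sum_(i < 3) G i x * Gh i x + lambda * u x * h x + V x * u x * h x))%:C
    = Cintegral (@lebesgue3 R) setT (fun x => N x * (h x)%:C).

Definition solution_in_H (R : realType) (p lambda mu11 mu22 mu12 : R)
    (u v : R3 R -> R) : Prop :=
  exists Gu Gv : 'I_3 -> R3 R -> R,
    [/\ H1_grad u Gu,
        H1_grad v Gv,
        weak_equation lambda
          (fun x => mu11 * coulomb u x - mu12 * coulomb v x)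
          (fun x => phase_average p (u x) (v x)) u Gu &
        weak_equation lambda
          (fun x => mu22 * coulomb v x - mu12 * coulomb u x)
          (fun x => phase_average p (v x) (u x)) v Gv].

Definition threshold (R : realType) (p lambda : R) : R :=
  if p < 2 then
    (p - 1) ^+ 2 / 4
    * ((2 `^ p * (2 - p) `^ (2 - p)) / lambda `^ (2 - p)) `^ (2 / (p - 1))
  else 4.

(* Main.v *)
Require Import Defs.
From HB Require Import structures.
From mathcomp Require Import all_boot all_order all_algebra.
From mathcomp Require Import all_classical all_reals all_analysis.
From mathcomp Require Import measurable_realfun complex.
From mathcomp Require Import ring lra.

Set Implicit Arguments.
Unset Strict Implicit.
Unset Printing Implicit Defensive.

Import Order.TTheory GRing.Theory Num.Theory.
Import numFieldNormedType.Exports.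

Local Open Scope classical_set_scope.
Local Open Scope ring_scope.

(** Let D(f, g) denote the integral of f(x) g(y) / |x - y| over pairs of points
    (below: [energy]), and put D_u = D(u^2, u^2), T_u = int |u|^3.

    Test the first equation with u and the second one with v, and add. On the
    left this gives

      int (|grad u|^2 + |grad v|^2) + lambda int (u^2 + v^2)
        + mu11 D_u + mu22 D_v - mu12 (D(u^2, v^2) + D(v^2, u^2)),

    while the right-hand side is at most int (|u| + |v|)^(p+1), because the
    phase average is bounded by (|u| + |v|)^p. A weighted arithmetic-geometric
    mean inequality bounds the latter by
    lambda int (u^2 + v^2) + A (T_u + T_v), where A^2 / 4 is exactly the
    threshold ([powR_cubic_le]); the terms in lambda cancel. The Coulomb kernel
    is positive definite ([energy_cauchy_schwarz]), so the quadratic form in the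
    energies is at least kappa (D_u + D_v) with kappa the quotient of the
    determinant by the trace of the coupling matrix. What remains is

      int (|grad u|^2 + |grad v|^2) + kappa (D_u + D_v) <= A (T_u + T_v).

    The cubic terms are absorbed by the interpolation inequality

      2 tau T_u <= int |grad u|^2 + tau^2 D_u     for every tau > 0

    ([cube_le_self_energy]). With 2 tau = A it yields
    (kappa - A^2 / 4) (D_u + D_v) <= 0, hence D_u = D_v = 0 as soon as kappa
    exceeds the threshold; letting then tau tend to infinity gives T_u = T_v = 0.

    The interpolation inequality is usually read off from the Poisson equation
    - Laplacian phi_u = 4 pi u^2. Here it is proved by real-variable means, with
    a worse constant that is still good enough. Let V be the potential of
    |grad u| with kernel |x - z|^(-2). Differentiating a mollification of u in
    its scale, and using the definition of the weak gradient with product test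
    functions only, gives |u| <= const * V almost everywhere
    ([moll_le], [moll_ae_bound]). For 0 <= w <= |u| Tonelli turns
    int w^2 V into int |grad u| (w^2 convolved with |x|^(-2)), and

      int dz / (|x - z|^2 |y - z|^2) <= 4 pi^2 / |x - y|     ([riesz2_le])

    shows that the square of the second factor has integral at most
    4 pi^2 D(w^2, w^2). The mollifier is nearly Gaussian because
    this makes the constant in front of V small: the product of all constants
    stays below one ([bump_constant_le]).

    Neither T_u nor D_u is known to be finite at the outset. This comes from
    the interpolation inequality for w = min(|u|, n) together with
    D(w^2, w^2) <= |w|_2^4 + C T_w ([energy_sqr_le]): for small tau the
    cubic integral on the right is absorbed, uniformly in n. *)

(** * Gaussian integrals on the line and the half line *)

Section gauss1.
Context {R : realType}.
Notation mu := (@lebesgue_measure R).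
Implicit Types (a b c r s t w x y z : R).

Lemma integral_gauss s w : 0 < s ->
  (\int[mu]_z (expR (- (s * (z - w) ^+ 2)))%:E = (Num.sqrt pi / Num.sqrt s)%:E)%E.
Proof.
move=> s0.
pose sg := (Num.sqrt (s *+ 2))^-1.
have sg0 : 0 < sg by rewrite invr_gt0 sqrtr_gt0 mulrn_wgt0.
have sgE : sg ^+ 2 *+ 2 = s^-1.
  rewrite exprVn sqr_sqrtr ?mulrn_wge0 ?(ltW s0)//.
  by rewrite -mulr_natr -[s *+ 2]mulr_natr invfM -mulrA mulVf ?mulr1// pnatr_eq0.
have := @integral_normal_pdf R w sg.
under eq_integral do rewrite /normal_pdf gt_eqF// /normal_fun sgE invrK mulNr
  [(_ ^+ 2 * _)%R]mulrC EFinM.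
rewrite (@ge0_integralZl _ _ _ mu setT measurableT
  (fun z => (expR (- (s * (z - w) ^+ 2)))%:E)) //; last 2 first.
- apply/measurable_EFinP; apply: measurableT_comp => //=.
  apply: measurableT_comp => //=; apply: measurable_funM => //=.
  by apply: measurable_funX; apply: measurable_funB.
- by rewrite lee_fin normal_peak_ge0.
have -> : normal_peak sg = (Num.sqrt pi / Num.sqrt s)^-1.
  rewrite /normal_peak; congr (_^-1).
  have -> : sg ^+ 2 * pi *+ 2 = pi * s^-1 by rewrite -sgE; ring.
  by rewrite sqrtrM ?pi_ge0// sqrtrV// ltW.
have gt0 : 0 < Num.sqrt pi / Num.sqrt s :> R.
  by rewrite divr_gt0// sqrtr_gt0// pi_gt0.
move: (Num.sqrt pi / Num.sqrt s) gt0 => g gt0.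
case: (integral _ _ _) => [I||] //=.
- rewrite -EFinM => -[] /(congr1 (fun x => g * x)).
  by rewrite mulrA divff ?gt_eqF// mul1r mulr1 => ->.
- by rewrite gt0_muley// lte_fin invr_gt0.
- by rewrite gt0_muleNy// lte_fin invr_gt0.
Qed.

Lemma measurable_gauss s w : measurable_fun [set: measurableTypeR R]
  (fun z => expR (- (s * (z - w) ^+ 2))).
Proof.
apply: measurableT_comp => //=.
apply: measurableT_comp => //=; apply: measurable_funM => //=.
by apply: measurable_funX; apply: measurable_funB.
Qed.

Lemma integral_half_gauss a : 0 < a ->
  (\int[mu]_(q in `[0%R, +oo[) (expR (- (q ^+ 2 * a)))%:E
   = (Num.sqrt pi / Num.sqrt a / 2)%:E)%E.
Proof.
move=> a0.
have := @integral_gauss a 0 a0.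
under eq_integral do rewrite subr0 mulrC.
rewrite (@ge0_symfun_integralT _ (fun q => expR (- (q ^+ 2 * a)))) //; last 2 first.
- move=> x; apply: continuous_comp; last exact: continuous_expR.
  by apply: cvgN; apply: cvgM; [exact: sqr_continuous|exact: cvg_cst].
- by move=> x /=; rewrite sqrrN.
have -> : [set x : R | 0 <= x] = `[0, +oo[%classic.
  by apply/seteqP; split=> x /=; rewrite in_itv/= andbT.
case: (integral _ _ _) => [I||] //=.
  rewrite -EFinM => -[<-].
  by rewrite [2 * _]mulrC mulfK// pnatr_eq0.
- by rewrite gt0_muley// lte_fin.
- by rewrite gt0_muleNy// lte_fin.
Qed.

Lemma is_derive_split (F : R -> R) x d :
  is_derive x 1 F d -> derivable F x 1 /\ 'D_1 F x = d.
Proof. by move=> [? ?]; split. Qed.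

(** The primitive vanishes at infinity, so only its value at 0 is left. *)
Lemma integral_half_line (f F : R -> R) :
  (forall x, 0 <= x -> 0 <= f x) -> {within `[0, +oo[, continuous f} ->
  (forall x, 0 <= x -> derivable F x 1 /\ 'D_1 F x = f x) -> F x @[x --> +oo] --> (0 : R) ->
  (\int[mu]_(x in `[0%R, +oo[) (f x)%:E = (- F 0)%:E)%E.
Proof.
move=> f0 cf dF F0.
rewrite (@ge0_continuous_FTC2y _ f F 0 0)//.
- by rewrite -EFinB sub0r.
- by move=> x /ltW /dF [].
- have /dF[/derivable1_diffP /differentiable_continuous cF _] := lexx (0 : R).
  exact: cvg_at_right_filter.
- by move=> x; rewrite in_itv/= andbT => /ltW /dF[_ <-]; rewrite derive1E.
Qed.

Lemma cvgr_expRN_lin a : 0 < a -> expR (- (x * a)) @[x --> +oo] --> (0 : R).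
Proof.
move=> a0; apply: (cvg_comp _ _ _ (@cvgr_expR R)).
by apply: gt0_cvgMly.
Qed.

Lemma cvgr_expRN_sqr a : 0 < a -> expR (- (x ^+ 2 * a)) @[x --> +oo] --> (0 : R).
Proof.
move=> a0; apply: (cvg_comp _ _ _ (@cvgr_expR R)).
apply: gt0_cvgMly => //.
apply/cvgryPge => A; near=> x.
have x1 : 1 <= x by near: x; exact: nbhs_pinfty_ge.
apply: (@le_trans _ _ x); first by near: x; exact: nbhs_pinfty_ge.
by rewrite expr2 ler_peMl// (le_trans _ x1).
Unshelve. all: by end_near. Qed.

Lemma integral_half_exp a : 0 < a ->
  (\int[mu]_(t in `[0%R, +oo[) (expR (- (t * a)))%:E = (a^-1)%:E)%E.
Proof.
move=> a0.
rewrite (@integral_half_line (fun t => expR (- (t * a)))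
  (fun t => - (expR (- (t * a)) * a^-1))).
- by rewrite mul0r oppr0 expR0 mul1r opprK.
- by move=> x _; exact: expR_ge0.
- apply: continuous_subspaceT => x; apply: continuous_comp; last exact: continuous_expR.
  by apply: cvgN; apply: cvgM; [exact: cvg_id|exact: cvg_cst].
- move=> x _; have a1 : a != 0 by rewrite gt_eqF.
  apply: is_derive_split; apply: is_derive_eq.
  rewrite /GRing.scale /=; field.
  by [].
- rewrite [X in _ --> X](_ : 0 = - (0 * a^-1)); last by rewrite mul0r oppr0.
  apply: cvgN; apply: cvgM; last exact: cvg_cst.
  exact: cvgr_expRN_lin.
Qed.

Lemma integral_half_sqrexp a : 0 < a ->
  (\int[mu]_(q in `[0%R, +oo[) (2 * q * expR (- (q ^+ 2 * a)))%:E = (a^-1)%:E)%E.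
Proof.
move=> a0.
rewrite (@integral_half_line (fun q => 2 * q * expR (- (q ^+ 2 * a)))
  (fun t => - (expR (- (t ^+ 2 * a)) * a^-1))).
- by rewrite expr0n mul0r oppr0 expR0 mul1r opprK.
- by move=> x x0; rewrite !mulr_ge0// expR_ge0.
- apply: continuous_subspaceT => x; apply: cvgM.
    by apply: cvgM; [exact: cvg_cst|exact: cvg_id].
  apply: continuous_comp; last exact: continuous_expR.
  by apply: cvgN; apply: cvgM; [exact: sqr_continuous|exact: cvg_cst].
- move=> x _; have a1 : a != 0 by rewrite gt_eqF.
  apply: is_derive_split; apply: is_derive_eq.
  rewrite /GRing.scale /=; field.
  by [].
- rewrite [X in _ --> X](_ : 0 = - (0 * a^-1)); last by rewrite mul0r oppr0.
  apply: cvgN; apply: cvgM; last exact: cvg_cst.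
  exact: cvgr_expRN_sqr.
Qed.

(** This integral over the scale t is what remains after integrating a product
    of two Gaussians of precisions s and c over space. *)
Lemma integral_half_invsqrt3 c : 0 < c ->
  (\int[mu]_(s in `[0%R, +oo[) ((Num.sqrt (s + c))^-1 ^+ 3)%:E =
   (2 / Num.sqrt c)%:E)%E.
Proof.
move=> c0.
have pos x : 0 <= x -> 0 < x + c by move=> x0; rewrite ltr_wpDl.
have dsq x : 0 <= x -> is_derive x 1 (fun t => Num.sqrt (t + c))
    ((2 * Num.sqrt (x + c))^-1).
  move=> x0.
  have := @is_derive1_comp _ Num.sqrt (fun t => t + c) x _ _ (is_derive1_sqrt (pos _ x0)).
  by move=> /(_ 1 _)-/(_ _)/= h; rewrite -[X in is_derive _ _ _ X]mulr1; apply: h;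
     apply: is_derive_eq; rewrite addr0.
rewrite (@integral_half_line (fun s => (Num.sqrt (s + c))^-1 ^+ 3)
  (fun t => - (2 * (Num.sqrt (t + c))^-1))).
- by rewrite add0r opprK.
- by move=> x _; rewrite exprn_ge0// invr_ge0.
- apply: continuous_in_subspaceT => x; rewrite inE/= in_itv/= andbT => x0.
  have h : Num.sqrt (x + c) != 0 by rewrite gt_eqF// sqrtr_gt0 pos.
  apply: (@continuous_comp _ _ _ (fun t => (Num.sqrt (t + c))^-1) (fun t => t ^+ 3));
    last exact: exprn_continuous.
  apply: cvgV => //.
  by have [/derivable1_diffP /differentiable_continuous] := dsq x x0.
- move=> x x0; have h : Num.sqrt (x + c) != 0 by rewrite gt_eqF// sqrtr_gt0 pos.
  have := dsq x x0 => hd.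
  apply: is_derive_split; apply: is_derive_eq.
  rewrite /GRing.scale /=; field.
  by [].
- rewrite [X in _ --> X](_ : 0 = - (2 * 0)); last by rewrite mulr0 oppr0.
  apply: cvgN; apply: cvgM; first exact: cvg_cst.
  have hp : \forall t \near +oo, 0 < Num.sqrt (t + c).
    by near=> t; rewrite sqrtr_gt0 pos//; near: t; exact: nbhs_pinfty_ge.
  apply/(gtr0_cvgV0 hp)/cvgryPge => A; near=> t.
  have [A0|A0] := leP A 0; first by rewrite (le_trans A0)// sqrtr_ge0.
  rewrite -[leLHS]ger0_norm ?(ltW A0)// -sqrtr_sqr ler_wsqrtr//.
  apply: (@le_trans _ _ t); first by near: t; apply: nbhs_pinfty_ge; exact: num_real.
  by rewrite lerDl ltW.
Unshelve. all: by end_near. Qed.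

End gauss1.

(** * Measurability and iterated integrals over R^3 *)

Section measurability.
Context d (T : measurableType d) {R : realType}.
Implicit Types f g : T -> R.

(** The inverse is x (x^2)^(-1), also at 0, which reduces the claim to the
    measurability of real powers. *)
Lemma measurable_invr : measurable_fun setT (@GRing.inv R).
Proof.
have -> : @GRing.inv R = (fun x => x * powR (x ^+ 2) (-1)).
  apply/funext => x; have [->|x0] := eqVneq x 0; first by rewrite invr0 mul0r.
  by rewrite powRN powRr1 ?sqr_ge0// expr2 invfM mulrA divff// mul1r.
apply: measurable_funM => //.
apply: (@measurableT_comp _ _ _ _ _ _ (fun y => powR y (-1))).
  exact: measurable_powR.
exact: measurable_funX.
Qed.

Lemma measurable_funV D f : measurable_fun D f -> measurable_fun D (fun x => (f x)^-1).
Proof. by move=> mf; apply: measurableT_comp => //; exact: measurable_invr. Qed.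

Lemma measurable_fun_sqrt D f : measurable_fun D f ->
  measurable_fun D (fun x => Num.sqrt (f x)).
Proof.
move=> mf; apply: measurableT_comp => //; apply: continuous_measurable_fun.
exact: sqrt_continuous.
Qed.

Lemma measurable_fun_expR D f : measurable_fun D f ->
  measurable_fun D (fun x => expR (f x)).
Proof. by move=> mf; exact: measurableT_comp. Qed.

Lemma measurable_fun_norm D f : measurable_fun D f ->
  measurable_fun D (fun x => `|f x|).
Proof. by move=> mf; exact: measurableT_comp. Qed.

Lemma measurable_fun_EFin D f : measurable_fun D f ->
  measurable_fun D (fun x => (f x)%:E).
Proof. by move=> mf; apply/measurable_EFinP. Qed.

Lemma measurable_fun_mule D (f g : T -> \bar R) : measurable_fun D f ->
  measurable_fun D g -> measurable_fun D (fun x => f x * g x)%E.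
Proof. by move=> mf mg; exact: emeasurable_funM. Qed.

End measurability.

Section R3coord.
Context d (T : measurableType d) {R : realType}.
Implicit Types f : T -> R3 R.

Lemma measurable_fun_coord1 f : measurable_fun setT f ->
  measurable_fun setT (fun x => ((f x).1.1 : R)).
Proof.
move=> mf.
apply: (measurableT_comp (f := fun z : R3 R => z.1.1)) => //.
by apply: measurableT_comp; exact: measurable_fst.
Qed.

Lemma measurable_fun_coord2 f : measurable_fun setT f ->
  measurable_fun setT (fun x => ((f x).1.2 : R)).
Proof.
move=> mf.
apply: (measurableT_comp (f := fun z : R3 R => z.1.2)) => //.
by apply: measurableT_comp; [exact: measurable_snd|exact: measurable_fst].
Qed.

Lemma measurable_fun_coord3 f : measurable_fun setT f ->
  measurable_fun setT (fun x => ((f x).2 : R)).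
Proof.
move=> mf.
apply: (measurableT_comp (f := fun z : R3 R => z.2)) => //.
exact: measurable_snd.
Qed.

End R3coord.

Ltac meas_step := first
  [ done | assumption
  | apply: measurable_fun_EFin
  | apply: measurable_fun_expR
  | apply: measurable_fun_sqrt
  | apply: measurable_fun_norm
  | apply: measurable_funV
  | apply: measurable_funN
  | apply: measurable_funX
  | apply: measurable_funM
  | apply: measurable_funB
  | apply: measurable_funD
  | apply: measurable_fun_mule
  | apply: measurable_fun_coord1
  | apply: measurable_fun_coord2
  | apply: measurable_fun_coord3
  | exact: measurable_fst | exact: measurable_snd
  | (apply: measurableT_comp; [assumption|])
  | (apply: measurableT_comp; [exact: measurable_fst|])
  | (apply: measurableT_comp; [exact: measurable_snd|]) ].
Ltac meas := repeat meas_step.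

Section sigma_finite_product.
Local Open Scope ereal_scope.
Context d1 d2 (T1 : measurableType d1) (T2 : measurableType d2) {R : realType}.
Variables (m1 : {sigma_finite_measure set T1 -> \bar R})
          (m2 : {sigma_finite_measure set T2 -> \bar R}).

(** The product measure under a name of its own, on which its sigma-finiteness
    can be recorded; iterating it gives Lebesgue measure in dimension 3. *)
Definition sfprod : set (T1 * T2) -> \bar R := m1 \x m2.

HB.instance Definition _ := Measure.on sfprod.

Lemma sfprod_sigma_finite : sigma_finite setT sfprod.
Proof.
have [F FT Foo] := sigma_finiteT m1.
have [G GT Goo] := sigma_finiteT m2.
exists (fun n => if unpickle n is Some ij then F ij.1 `*` G ij.2 else set0).
  apply/seteqP; split=> [[x y] _|//].
  have [i _ Fx] : (\bigcup_i F i) x by rewrite -FT.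
  have [j _ Gy] : (\bigcup_j G j) y by rewrite -GT.
  by exists (pickle (i, j)) => //; rewrite pickleK.
move=> n; case: (unpickle n) => [[i j]|] /=.
- have [[mF Fi] [mG Gj]] := (Foo i, Goo j); split; first exact: measurableX.
  by rewrite [X in X < _]product_measure1E// lte_mul_pinfty// ge0_fin_numE.
- by split => //; rewrite measure0.
Qed.

HB.instance Definition _ := Measure_isSigmaFinite.Build _ _ _ sfprod
  sfprod_sigma_finite.

End sigma_finite_product.

Section R3.
Context {R : realType}.
Notation mu := (@lebesgue_measure R).

Definition vol2 : {sigma_finite_measure
    set (measurableTypeR R * measurableTypeR R)%type -> \bar R} := sfprod mu mu.

Definition vol3 : {sigma_finite_measure set (R3 R) -> \bar R} := sfprod vol2 mu.

Definition dsq (x y : R3 R) : R :=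
  (x.1.1 - y.1.1) ^+ 2 + (x.1.2 - y.1.2) ^+ 2 + (x.2 - y.2) ^+ 2.

Lemma dist3E x y : dist3 x y = Num.sqrt (dsq x y). Proof. by []. Qed.

Lemma dsq_ge0 x y : 0 <= dsq x y.
Proof. by rewrite !addr_ge0// sqr_ge0. Qed.

Lemma dsqC x y : dsq x y = dsq y x.
Proof. by rewrite /dsq; ring. Qed.

Lemma dsq_eq0 x y : (dsq x y == 0) = (x == y).
Proof.
rewrite /dsq !paddr_eq0 ?addr_ge0 ?sqr_ge0// !sqrf_eq0 !subr_eq0.
by case: x y => [[a b] c] [[a' b'] c'] /=; rewrite !xpair_eqE.
Qed.

Lemma dsq_gt0 x y : x != y -> 0 < dsq x y.
Proof. by move=> xy; rewrite lt_neqAle dsq_ge0 eq_sym dsq_eq0 xy. Qed.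

Lemma measurable_fun_dsq d (T : measurableType d) (f g : T -> R3 R) :
  measurable_fun setT f -> measurable_fun setT g ->
  measurable_fun setT (fun w => dsq (f w) (g w)).
Proof. by move=> mf mg; rewrite /dsq; meas. Qed.

Lemma measurable_fun_dist3 d (T : measurableType d) (f g : T -> R3 R) :
  measurable_fun setT f -> measurable_fun setT g ->
  measurable_fun setT (fun w => dist3 (f w) (g w)).
Proof.
move=> mf mg; apply: (measurable_fun_sqrt (f := fun w => dsq (f w) (g w))).
exact: measurable_fun_dsq.
Qed.

Lemma integral_prod3 (A B C : R -> R) :
  measurable_fun setT A -> measurable_fun setT B -> measurable_fun setT C ->
  (forall x, 0 <= A x) -> (forall x, 0 <= B x) -> (forall x, 0 <= C x) ->
  (\int[vol3]_z (A z.1.1 * B z.1.2 * C z.2)%:E =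
   (\int[mu]_x (A x)%:E) * (\int[mu]_x (B x)%:E) * (\int[mu]_x (C x)%:E))%E.
Proof.
move=> mA mB mC A0 B0 C0.
rewrite (fubini_tonelli1 (fun z : R3 R => (A z.1.1 * B z.1.2 * C z.2)%:E)) //=; last 2 first.
- by meas.
- by move=> x; rewrite lee_fin !mulr_ge0.
under eq_integral => x _ do (rewrite /fubini_F /=; under eq_integral do rewrite EFinM;
  rewrite ge0_integralZl ?lee_fin ?mulr_ge0//; [|by meas|by move=> *; rewrite lee_fin]).
rewrite ge0_integralZr//; last 3 first.
- by meas.
- by move=> x _; rewrite lee_fin mulr_ge0.
- by apply: integral_ge0 => x _; rewrite lee_fin.
congr (_ * _)%E.
rewrite (fubini_tonelli1
  (fun z : measurableTypeR R * measurableTypeR R => (A z.1 * B z.2)%:E)) //=; last 2 first.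
- by meas.
- by move=> x; rewrite lee_fin !mulr_ge0.
under eq_integral => x _ do (rewrite /fubini_F /=; under eq_integral do rewrite EFinM;
  rewrite ge0_integralZl ?lee_fin ?mulr_ge0//; [|by meas|by move=> *; rewrite lee_fin]).
rewrite ge0_integralZr//.
- by meas.
- by move=> x _; rewrite lee_fin.
- by apply: integral_ge0 => x _; rewrite lee_fin.
Qed.

End R3.

Notation integrable3 f := (vol3.-integrable setT (EFin \o f)).

Ltac meas_leaf := first
  [ assumption | exact: measurable_id | exact: measurable_fst | exact: measurable_snd
  | exact: (measurableT_comp _ measurable_fst)
  | exact: (measurableT_comp _ measurable_snd) ].
(* The head symbol of the function decides which lemma is applied. *)
Ltac meas_step ::= lazymatch goal with
  | |- measurable_fun _ (fun _ => ?c) => exact: measurable_cst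
  | |- measurable_fun _ (fun x => EFin (@?f x)) => apply: (measurable_fun_EFin (f := f))
  | |- measurable_fun _ (fun x => expR (@?f x)) => apply: (measurable_fun_expR (f := f))
  | |- measurable_fun _ (fun x => Num.sqrt (@?f x)) => apply: (measurable_fun_sqrt (f := f))
  | |- measurable_fun _ (fun x => Num.norm (@?f x)) => apply: (measurable_fun_norm (f := f))
  | |- measurable_fun _ (fun x => GRing.inv (@?f x)) => apply: (measurable_funV (f := f))
  | |- measurable_fun _ (fun x => dsq (@?f x) (@?g x)) =>
      apply: (measurable_fun_dsq (f := f) (g := g))
  | |- measurable_fun _ (fun x => dist3 (@?f x) (@?g x)) =>
      apply: (measurable_fun_dist3 (f := f) (g := g))
  | |- measurable_fun _ (fun x => GRing.opp (@?f x)) => apply: (measurable_funN (f := f))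
  | |- measurable_fun _ (fun x => GRing.exp (@?f x) _) => apply: (measurable_funX (f := f))
  | |- measurable_fun _ (fun x => GRing.mul (@?f x) (@?g x)) =>
      apply: (measurable_funM (f := f) (g := g))
  | |- measurable_fun _ (fun x => GRing.add (@?f x) (@?g x)) =>
      apply: (measurable_funD (f := f) (g := g))
  | |- measurable_fun _ (fun x => mule (@?f x) (@?g x)) =>
      apply: (measurable_fun_mule (f := f) (g := g))
  | |- measurable_fun _ (fun x => fst (fst (@?f x))) => first
      [ apply: (measurable_fun_coord1 (f := f)) | apply: (measurableT_comp measurable_fst) ]
  | |- measurable_fun _ (fun x => snd (fst (@?f x))) => first
      [ apply: (measurable_fun_coord2 (f := f)) | apply: (measurableT_comp measurable_snd) ]
  | |- measurable_fun _ (fun x => snd (@?f x)) => first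
      [ meas_leaf | apply: (measurable_fun_coord3 (f := f)) | apply: (measurableT_comp measurable_snd)]
  | |- measurable_fun _ (fun x => fst (@?f x)) => first
      [ meas_leaf | apply: (measurableT_comp measurable_fst)]
  | |- measurable_fun _ _ => first [meas_leaf | apply: measurableT_comp; [assumption|] ]
  end.

Section tonelli_on.
Local Open Scope ereal_scope.
Context d1 d2 (T1 : measurableType d1) (T2 : measurableType d2) {R : realType}.
Variables (m1 : {sigma_finite_measure set T1 -> \bar R})
          (m2 : {sigma_finite_measure set T2 -> \bar R}).

(** The set D enters as an indicator, which reduces the claim to Tonelli's
    theorem on the whole product. *)
Lemma tonelli_on (D : set T2) (f : T1 -> T2 -> \bar R) : measurable D ->
  measurable_fun setT (fun w => f w.1 w.2) -> (forall x y, 0 <= f x y) ->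
  \int[m1]_x \int[m2]_(y in D) f x y = \int[m2]_(y in D) \int[m1]_x f x y.
Proof.
move=> mD mf f0.
pose g (w : T1 * T2) := f w.1 w.2 * (\1_D w.2)%:E.
have mg : measurable_fun setT g.
  apply: measurable_fun_mule => //; apply/measurable_fun_EFin.
  by apply: measurableT_comp => //; exact: measurable_indic.
have g0 w : 0 <= g w by rewrite mule_ge0// lee_fin.
have gE x y : g (x, y) = ((f x) \_ D) y.
  rewrite /g /= patchE indicE; case: ifPn => yD; first by rewrite mule1.
  by rewrite mule0.
transitivity (\int[m1]_x \int[m2]_y g (x, y)).
  apply: eq_integral => x _; rewrite integral_mkcond.
  by apply: eq_integral => y _; rewrite gE.
rewrite (fubini_tonelli g)// [RHS]integral_mkcond.
apply: eq_integral => y _; rewrite patchE; case: ifPn => yD.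
  by apply: eq_integral => x _; rewrite gE patchE yD.
by rewrite integral0_eq// => x _; rewrite gE patchE (negbTE yD).
Qed.

Lemma integral_sfprod (f : T1 * T2 -> \bar R) : measurable_fun setT f ->
  (forall z, 0 <= f z) ->
  \int[sfprod m1 m2]_z f z = \int[m1]_x \int[m2]_y f (x, y).
Proof. exact: fubini_tonelli1. Qed.

Lemma measurable_integral_on (D : set T2) (f : T1 -> T2 -> \bar R) : measurable D ->
  measurable_fun setT (fun w => f w.1 w.2) -> (forall x y, 0 <= f x y) ->
  measurable_fun setT (fun x => \int[m2]_(y in D) f x y).
Proof.
move=> mD mf f0.
pose g (w : T1 * T2) := f w.1 w.2 * (\1_D w.2)%:E.
have mg : measurable_fun setT g.
  apply: measurable_fun_mule => //; apply/measurable_fun_EFin.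
  by apply: measurableT_comp => //; exact: measurable_indic.
have g0 w : 0 <= g w by rewrite mule_ge0// lee_fin.
have -> : (fun x => \int[m2]_(y in D) f x y) = (fun x => \int[m2]_y g (x, y)).
  apply/funext => x; rewrite integral_mkcond; apply: eq_integral => y _.
  rewrite /g /= patchE indicE; case: ifPn => yD; first by rewrite mule1.
  by rewrite mule0.
exact: (measurable_fun_fubini_tonelli_F g).
Qed.

End tonelli_on.

Section integral_monotone.
Local Open Scope ereal_scope.
Context d (T : measurableType d) {R : realType} (m : {measure set T -> \bar R}).

(** Each side is a supremum over the simple functions below its integrand, and
    those below f lie below g. *)
Lemma le_integral_ge0 (D : set T) (f g : T -> \bar R) :
  (forall x, D x -> 0 <= f x) -> (forall x, D x -> f x <= g x) ->
  \int[m]_(x in D) f x <= \int[m]_(x in D) g x.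
Proof.
move=> f0 fg; rewrite !ge0_integralE//; last by move=> x Dx; exact: le_trans (f0 _ Dx) (fg _ Dx).
apply: ereal_sup_le => _ [h /= hf <-]; exists h => // x.
apply: (le_trans (hf x)); rewrite !patchE; case: ifPn => //; rewrite inE => /fg.
by [].
Qed.

End integral_monotone.


Ltac pos_step := lazymatch goal with
  | |- is_true (_ <= EFin _)%E => rewrite lee_fin
  | |- is_true (0 <= expR _) => exact: expR_ge0
  | |- is_true (0 <= Num.sqrt _) => exact: sqrtr_ge0
  | |- is_true (0 <= dsq _ _) => exact: dsq_ge0
  | |- is_true (0 <= dist3 _ _) => exact: sqrtr_ge0
  | |- is_true (0 <= Num.norm _) => exact: normr_ge0
  | |- is_true (0 <= pi) => exact: pi_ge0
  | |- is_true (0 <= GRing.inv _) => rewrite invr_ge0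
  | |- is_true (0 <= GRing.exp _ _) => first [exact: sqr_ge0 | apply: exprn_ge0]
  | |- is_true (0 <= GRing.mul _ _) => apply: mulr_ge0
  | |- is_true (0 <= GRing.add _ _) => apply: addr_ge0
  | |- _ => first [assumption | by [] | apply: ltW; assumption]
  end.
Ltac pos := repeat pos_step.
Ltac side := first
  [ done | solve [meas] | solve [apply: measurable_funTS; meas]
  | solve [pos] | solve [move=> *; pos] | idtac].

(** * The kernel |x|^(-2) composed with itself *)

Section gauss3.
Context {R : realType}.
Notation mu := (@lebesgue_measure R).
Implicit Types (c s t : R) (x y z m : R3 R).

Definition mid x y : R3 R :=
  ((((x.1.1 + y.1.1) / 2, (x.1.2 + y.1.2) / 2), (x.2 + y.2) / 2)).

(** The parallelogram law: a product of Gaussians centred at x and y is a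
    Gaussian centred at their midpoint, times a factor that depends only on
    their distance. *)
Lemma dsq_parallelogram x y z :
  dsq x z + dsq y z = 2 * dsq (mid x y) z + dsq x y / 2.
Proof. by rewrite /dsq /mid /=; field. Qed.

Lemma integral_gauss3 s m : 0 < s ->
  (\int[vol3]_z (expR (- (s * dsq m z)))%:E
   = ((Num.sqrt pi / Num.sqrt s) ^+ 3)%:E)%E.
Proof.
move=> s0.
pose G (a z : R) := expR (- (s * (z - a) ^+ 2)).
have GE z : expR (- (s * dsq m z)) = G m.1.1 z.1.1 * G m.1.2 z.1.2 * G m.2 z.2.
  by rewrite /G -!expRD; congr expR; rewrite /dsq; ring.
under eq_integral do rewrite GE.
rewrite integral_prod3; try (by move=> *; exact: expR_ge0);
  try (exact: measurable_gauss).
by rewrite !integral_gauss// -!EFinM; congr (_%:E); ring.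
Qed.

Lemma integral_gauss3_pair s x y : 0 < s ->
  (\int[vol3]_z (expR (- (s * dsq x z)) * expR (- (s * dsq y z)))%:E
   = ((Num.sqrt pi / Num.sqrt (2 * s)) ^+ 3 * expR (- (s / 2 * dsq x y)))%:E)%E.
Proof.
move=> s0.
under eq_integral => z _ do rewrite -expRD -opprD -mulrDr dsq_parallelogram
  mulrDr opprD expRD mulrCA [s * (dsq (mid x y) z)]mulrC [2 * _]mulrC -mulrA
  [dsq _ _ * (_ * _)]mulrC [s * 2]mulrC EFinM.
rewrite ge0_integralZr //; last by meas.
rewrite integral_gauss3 ?mulr_gt0// -EFinM; congr (_%:E); congr (_ * expR _).
by field.
Qed.

(** The product is largest when the two centres coincide; in general the
    exponent is minorized by a square around the weighted mean of the centres.
    *)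
Lemma gauss3_prod_le c t m x : 0 < c -> 0 <= t ->
  (\int[vol3]_z (expR (- (c * dsq m z)) * expR (- (t * dsq x z)))%:E
   <= ((Num.sqrt pi / Num.sqrt (t + c)) ^+ 3)%:E)%E.
Proof.
move=> c0 t0; have ct : 0 < t + c by rewrite ltr_wpDl.
pose w a b := (c * a + t * b) / (t + c).
pose p : R3 R := ((w m.1.1 x.1.1, w m.1.2 x.1.2), w m.2 x.2).
rewrite -(@integral_gauss3 _ p)//; apply: le_integral_ge0.
  by move=> z _; rewrite lee_fin mulr_ge0// expR_ge0.
move=> z _; rewrite lee_fin -expRD ler_expR -opprD lerN2.
have key a b (u : R) : (t + c) * (w a b - u) ^+ 2 <= c * (a - u) ^+ 2 + t * (b - u) ^+ 2.
  rewrite -subr_ge0.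
  have -> : c * (a - u) ^+ 2 + t * (b - u) ^+ 2 - (t + c) * (w a b - u) ^+ 2
     = c * t / (t + c) * (a - b) ^+ 2.
    by rewrite /w; field; rewrite gt_eqF.
  by rewrite mulr_ge0 ?sqr_ge0// divr_ge0 ?(ltW ct)// mulr_ge0// ltW.
rewrite /dsq !mulrDr /=.
apply: (le_trans (lerD (lerD (key _ _ _) (key _ _ _)) (key _ _ _))).
by rewrite le_eqVlt; apply/orP; left; apply/eqP; ring.
Qed.

(** Only an inequality, because 0^-1 = 0 whereas the integral is infinite at a
    = 0. *)
Lemma invr_le_integral_exp (a : R) : 0 <= a ->
  ((a^-1)%:E <= \int[mu]_(t in `[0%R, +oo[) (expR (- (t * a)))%:E)%E.
Proof.
rewrite le_eqVlt => /predU1P[<-|a0]; last by rewrite integral_half_exp.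
by rewrite invr0; apply: integral_ge0 => t _; rewrite lee_fin expR_ge0.
Qed.

(** Write |x - z|^(-2) as an integral of Gaussians and exchange the integrals.
    *)
Lemma riesz2_gauss_le c m x : 0 < c ->
  (\int[vol3]_z (expR (- (c * dsq m z)) / dsq x z)%:E
   <= (2 * Num.sqrt pi ^+ 3 / Num.sqrt c)%:E)%E.
Proof.
move=> c0.
apply: (@le_trans _ _ (\int[vol3]_z \int[mu]_(t in `[0%R, +oo[)
   (expR (- (c * dsq m z)) * expR (- (t * dsq x z)))%:E)%E).
  apply: le_integral_ge0.
    by move=> z _; rewrite lee_fin divr_ge0 ?expR_ge0// dsq_ge0.
  move=> z _; under eq_integral do rewrite EFinM.
  rewrite ge0_integralZl//; last by apply: measurable_funTS; meas.
  by rewrite EFinM lee_wpmul2l ?lee_fin ?expR_ge0// invr_le_integral_exp// dsq_ge0.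
rewrite (@tonelli_on _ _ _ _ _ vol3 mu _
  (fun z t => (expR (- (c * dsq m z)) * expR (- (t * dsq x z)))%:E)) //;
  last by meas.
apply: (@le_trans _ _ (\int[mu]_(t in `[0%R, +oo[) ((Num.sqrt pi ^+ 3)%:E *
    ((Num.sqrt (t + c))^-1 ^+ 3)%:E))%E).
  apply: le_integral_ge0.
    by move=> t _; apply: integral_ge0 => z _; rewrite lee_fin mulr_ge0// expR_ge0.
  move=> t; rewrite /= in_itv/= andbT => t0.
  by rewrite -EFinM -exprMn; exact: gauss3_prod_le.
rewrite ge0_integralZl//; last by apply: measurable_funTS; meas.
rewrite integral_half_invsqrt3// -EFinM lee_fin.
by rewrite mulrCA mulrA.
Qed.

(** 1/(ab) = 1/(a(a+b)) + 1/(b(a+b)): the two singularities are separated, at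
    the price of a factor that decays. With 0^-1 = 0 equality may fail at 0. *)
Lemma invr_prod_le (a b : R) : 0 <= a -> 0 <= b ->
  a^-1 * b^-1 <= a^-1 * (a + b)^-1 + b^-1 * (b + a)^-1.
Proof.
have inv0 (u v : R) : 0 <= u -> 0 <= v -> 0 <= u^-1 * (u + v)^-1.
  by move=> u0 v0; rewrite mulr_ge0// invr_ge0// addr_ge0.
move=> a0 b0.
have [a_eq0|an0] := eqVneq a 0.
  by rewrite {1}a_eq0 invr0 mul0r addr_ge0 ?inv0.
have [b_eq0|bn0] := eqVneq b 0.
  by rewrite {1}b_eq0 invr0 mulr0 addr_ge0 ?inv0.
have a_gt0 : 0 < a by rewrite lt_neqAle eq_sym an0.
have b_gt0 : 0 < b by rewrite lt_neqAle eq_sym bn0.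
rewrite le_eqVlt; apply/orP; left; apply/eqP.
by field; rewrite an0 bn0/= [b + a]addrC gt_eqF// addr_gt0.
Qed.

(** Write the second factor as an integral over q of 2 q exp(-q^2 (|x-z|^2 +
    |y-z|^2)); by the parallelogram law the integral over z is of the form
    bounded by [riesz2_gauss_le], and the Gaussian in |x - y| that remains is
    integrated in q. *)
Lemma riesz2_half x y : x != y ->
  (\int[vol3]_z ((dsq x z)^-1 * (dsq x z + dsq y z)^-1)%:E
   <= (2 * pi ^+ 2 / Num.sqrt (dsq x y))%:E)%E.
Proof.
move=> xy; have r0 := dsq_gt0 xy; set r := dsq x y in r0 *.
have sumE z : dsq x z + dsq y z = 2 * dsq (mid x y) z + r / 2.
  exact: dsq_parallelogram.
have sum0 z : 0 < dsq x z + dsq y z.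
  by rewrite sumE ltr_wpDl ?divr_gt0// mulr_ge0// dsq_ge0.
pose F z (q : R) :=
  (dsq x z)^-1 * (2 * `|q| * expR (- (q ^+ 2 * (dsq x z + dsq y z)))).
have F0 z q : 0 <= F z q by rewrite !mulr_ge0 ?invr_ge0 ?dsq_ge0// expR_ge0.
apply: (@le_trans _ _ (\int[vol3]_z \int[mu]_(q in `[0%R, +oo[) (F z q)%:E)%E).
  apply: le_integral_ge0.
    by move=> z _; rewrite lee_fin mulr_ge0// invr_ge0 ?dsq_ge0// ltW.
  move=> z _; under eq_integral do rewrite EFinM.
  rewrite ge0_integralZl; [|side..].
  rewrite EFinM lee_wpmul2l ?lee_fin ?invr_ge0 ?dsq_ge0//.
  rewrite -integral_half_sqrexp// le_eqVlt; apply/orP; left; apply/eqP.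
  by apply: eq_integral => q; rewrite inE/= in_itv/= andbT => q0; rewrite ger0_norm.
rewrite (@tonelli_on _ _ _ _ _ vol3 mu _ (fun z q => (F z q)%:E)) //;
  last by rewrite /F; meas.
pose C := 2 * Num.sqrt pi ^+ 3 * 2 / Num.sqrt 2 : R.
have C0 : 0 <= C by rewrite divr_ge0 ?sqrtr_ge0// !mulr_ge0// exprn_ge0// sqrtr_ge0.
apply: (@le_trans _ _ (\int[mu]_(q in `[0%R, +oo[) (C%:E * (expR (- (q ^+ 2 * (r / 2))))%:E))%E).
  apply: le_integral_ge0.
    by move=> q _; apply: integral_ge0 => z _; rewrite lee_fin.
  move=> q; rewrite /= in_itv/= andbT le_eqVlt => /predU1P[<-|q0].
    rewrite integral0_eq; first by rewrite -EFinM lee_fin mulr_ge0// expR_ge0.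
    by move=> z _; rewrite /F normr0 mulr0 mul0r mulr0.
  have q2 : 0 < 2 * q ^+ 2 by rewrite mulr_gt0// exprn_gt0.
  have FE z : F z q = 2 * q * expR (- (q ^+ 2 * (r / 2))) *
      (expR (- (2 * q ^+ 2 * dsq (mid x y) z)) / dsq x z).
    rewrite /F sumE mulrDr opprD expRD ger0_norm ?(ltW q0)//.
    rewrite [q ^+ 2 * (2 * _)]mulrA [q ^+ 2 * 2]mulrC.
    move: (expR _) (expR _) => e1 e2; ring.
  under eq_integral do rewrite FE EFinM.
  rewrite ge0_integralZl; [|side..].
  apply: (le_trans (lee_wpmul2l _ (riesz2_gauss_le (mid x y) x q2))).
    by rewrite lee_fin !mulr_ge0 ?(ltW q0)// expR_ge0.
  rewrite -!EFinM lee_fin sqrtrM// sqrtr_sqr ger0_norm ?(ltW q0)//.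
  rewrite le_eqVlt; apply/orP; left; apply/eqP; rewrite /C.
  have s2 : Num.sqrt 2 != 0 :> R by rewrite gt_eqF// sqrtr_gt0.
  by field; rewrite s2 gt_eqF.
rewrite ge0_integralZl//; last by apply: measurable_funTS; meas.
rewrite integral_half_gauss ?divr_gt0// -EFinM lee_fin /C.
rewrite sqrtrM ?(ltW r0)// sqrtrV//.
have s2 : Num.sqrt 2 != 0 :> R by rewrite gt_eqF// sqrtr_gt0.
have sr : Num.sqrt r != 0 :> R by rewrite gt_eqF// sqrtr_gt0.
have pE : (pi : R) = Num.sqrt pi ^+ 2 by rewrite sqr_sqrtr// pi_ge0.
rewrite [in leRHS]pE.
by rewrite le_eqVlt; apply/orP; left; apply/eqP; field; rewrite s2 sr.
Qed.

(** The exact value is pi^3 / |x - y|; the constant 4 pi^2 suffices for the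
    interpolation inequality and avoids computing the convolution. *)
Lemma riesz2_le x y : x != y ->
  (\int[vol3]_z ((dsq x z)^-1 * (dsq y z)^-1)%:E
   <= (4 * pi ^+ 2 / Num.sqrt (dsq x y))%:E)%E.
Proof.
move=> xy.
apply: (@le_trans _ _ (\int[vol3]_z (((dsq x z)^-1 * (dsq x z + dsq y z)^-1)%:E
   + ((dsq y z)^-1 * (dsq y z + dsq x z)^-1)%:E))%E).
  apply: le_integral_ge0.
    by move=> z _; rewrite lee_fin mulr_ge0// invr_ge0 dsq_ge0.
  by move=> z _; rewrite -EFinD lee_fin invr_prod_le// dsq_ge0.
rewrite ge0_integralD; [|side..].
have -> : 4 * pi ^+ 2 / Num.sqrt (dsq x y)
   = 2 * pi ^+ 2 / Num.sqrt (dsq x y) + 2 * pi ^+ 2 / Num.sqrt (dsq x y) :> R by ring.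
rewrite EFinD leeD ?riesz2_half//.
by rewrite dsqC riesz2_half// eq_sym.
Qed.

End gauss3.

(** * Positive definite kernels and the Coulomb kernel *)

Section posdef.
Local Open Scope ereal_scope.
Context d1 d2 (T1 : measurableType d1) (T2 : measurableType d2) {R : realType}.
Variables (w : {sigma_finite_measure set T1 -> \bar R})
          (m : {sigma_finite_measure set T2 -> \bar R}).
Variable (a : T1 -> T2 -> R).
Hypothesis ma : measurable_fun setT (fun z => a z.1 z.2).
Hypothesis a0 : forall z x, (0 <= a z x)%R.

Let F (f : T2 -> R) z := \int[m]_x (f x * a z x)%:E.

Let mfa (f : T2 -> R) : measurable_fun setT f ->
  measurable_fun setT (fun z : T1 * T2 => (f z.2 * a z.1 z.2)%:E).
Proof. by move=> mf; meas. Qed.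

Let mF (f : T2 -> R) : measurable_fun setT f -> (forall x, (0 <= f x)%R) ->
  measurable_fun setT (F f).
Proof.
move=> mf f0.
apply: (@measurable_integral_on _ _ _ _ _ m setT (fun z x => (f x * a z x)%:E)) => //.
  exact: mfa.
by move=> z x; rewrite lee_fin mulr_ge0.
Qed.

Let F_ge0 (f : T2 -> R) z : (forall x, (0 <= f x)%R) -> 0 <= F f z.
Proof. by move=> f0; apply: integral_ge0 => x _; rewrite lee_fin mulr_ge0. Qed.

Let mfx (f : T2 -> R) z : measurable_fun setT f ->
  measurable_fun setT (fun x => (f x * a z x)%:E).
Proof.
move=> mf; apply/measurable_EFinP; apply: measurable_funM => //.
exact: (measurableT_comp ma (pair1_measurable z)).
Qed.

Let maz x : measurable_fun setT (fun z => a z x).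
Proof. exact: (measurableT_comp ma (pair2_measurable x)). Qed.

(** A kernel of the form K(x, y) = int a(z, x) a(z, y) dw(z) turns the double
    integral of f(x) g(y) K(x, y) into a scalar product. Both Cauchy-Schwarz
    for the Coulomb form and the bound on the potential of w^2 are instances. *)
Lemma posdef_kernelE (f g : T2 -> R) :
  measurable_fun setT f -> measurable_fun setT g ->
  (forall x, (0 <= f x)%R) -> (forall x, (0 <= g x)%R) ->
  \int[w]_z (F f z * F g z) =
  \int[m]_x \int[m]_y ((f x * g y)%:E * \int[w]_z (a z x * a z y)%:E).
Proof.
move=> mf mg f0 g0.
transitivity (\int[w]_z \int[m]_x ((f x * a z x)%:E * F g z)).
  apply: eq_integral => z _; rewrite ge0_integralZr //; first exact: mfx.
  - by move=> x _; rewrite lee_fin mulr_ge0.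
  - exact: F_ge0.
rewrite (@tonelli_on _ _ _ _ _ w m setT (fun z x => (f x * a z x)%:E * F g z))//; last 2 first.
- apply: measurable_fun_mule; first exact: mfa.
  exact: (measurableT_comp (mF mg g0) measurable_fst).
- by move=> z x; rewrite mule_ge0// ?lee_fin ?mulr_ge0// F_ge0.
apply: eq_integral => x _.
transitivity (\int[w]_z \int[m]_y ((f x * a z x)%:E * (g y * a z y)%:E)).
  apply: eq_integral => z _; rewrite ge0_integralZl //; first exact: mfx.
  - by move=> y _; rewrite lee_fin mulr_ge0.
  - by rewrite lee_fin mulr_ge0.
rewrite (@tonelli_on _ _ _ _ _ w m setT
  (fun z y => (f x * a z x)%:E * (g y * a z y)%:E))//; last 2 first.
- apply: measurable_fun_mule; last exact: mfa.
  apply/measurable_EFinP; apply: measurable_funM => //.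
  exact: (measurableT_comp (maz x) measurable_fst).
- by move=> z y; rewrite mule_ge0// ?lee_fin ?mulr_ge0.
apply: eq_integral => y _.
rewrite -ge0_integralZl //; last 3 first.
- by apply/measurable_EFinP; apply: measurable_funM; exact: maz.
- by move=> z _; rewrite lee_fin mulr_ge0.
- by rewrite lee_fin mulr_ge0.
by apply: eq_integral => z _; rewrite -!EFinM; congr (_%:E); ring.
Qed.

(** The inequality also holds for infinite values, where the right-hand side
    is infinite; this is why the parameter t is used instead of square roots. *)
Lemma amgm_ereal (t : R) (A B : \bar R) : (0 < t)%R -> 0 <= A -> 0 <= B ->
  2%:E * (A * B) <= t%:E * (A * A) + t^-1%:E * (B * B).
Proof.
move=> t0; have ti0 : (0 < t^-1)%R by rewrite invr_gt0.
case: A => [A||]//; case: B => [B||]//.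
- move=> _ _; rewrite -!EFinM -EFinD lee_fin -subr_ge0.
  have -> : (t * (A * A) + t^-1 * (B * B) - 2 * (A * B) = t * (A - B / t) ^+ 2)%R.
    by field; rewrite gt_eqF.
  by rewrite mulr_ge0 ?sqr_ge0// ltW.
- by move=> _ _; rewrite mulyy (@gt0_muley _ t^-1%:E)// -!EFinM addey ?leey.
- by move=> _ _; rewrite mulyy (@gt0_muley _ t%:E)// -!EFinM addye ?leey.
- by move=> _ _; rewrite !mulyy (@gt0_muley _ t%:E)// (@gt0_muley _ t^-1%:E)// addye ?leey.
Qed.

Lemma posdef_kernel_amgm (t : R) (f g : T2 -> R) : (0 < t)%R ->
  measurable_fun setT f -> measurable_fun setT g ->
  (forall x, (0 <= f x)%R) -> (forall x, (0 <= g x)%R) ->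
  2%:E * \int[w]_z (F f z * F g z) <=
  t%:E * \int[w]_z (F f z * F f z) + t^-1%:E * \int[w]_z (F g z * F g z).
Proof.
move=> t0 mf mg f0 g0.
have mFF (h k : T2 -> R) : measurable_fun setT h -> measurable_fun setT k ->
   (forall x, (0 <= h x)%R) -> (forall x, (0 <= k x)%R) ->
   measurable_fun setT (fun z => F h z * F k z).
  by move=> *; apply: measurable_fun_mule; exact: mF.
have FF (h k : T2 -> R) z : (forall x, (0 <= h x)%R) -> (forall x, (0 <= k x)%R) -> 0 <= F h z * F k z.
  by move=> *; rewrite mule_ge0// F_ge0.
rewrite -!ge0_integralZl//; try exact: mFF; try (by move=> *; exact: FF);
  try (by rewrite lee_fin ?invr_ge0 ltW).
rewrite -ge0_integralD//; last 4 first.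
- by move=> z _; rewrite mule_ge0 ?FF// lee_fin ltW.
- by apply: measurable_fun_mule => //; exact: mFF.
- by move=> z _; rewrite mule_ge0 ?FF// lee_fin invr_ge0 ltW.
- by apply: measurable_fun_mule => //; exact: mFF.
apply: le_integral_ge0.
  by move=> z _; rewrite mule_ge0 ?FF.
by move=> z _; apply: amgm_ereal => //; exact: F_ge0.
Qed.

End posdef.

Section point_removal.
Context {R : realType}.
Notation mu := (@lebesgue_measure R).

Lemma integral_setT_D1 (f : R -> \bar R) r :
  measurable_fun [set: measurableTypeR R] f ->
  (\int[mu]_x f x = \int[mu]_(x in setT `\ r) f x)%E.
Proof.
move=> mf; have mr : measurable (setT `\ r : set (measurableTypeR R)).
  exact: measurableD.
by rewrite integral_setD1//; exact: measurable_funTS.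
Qed.

End point_removal.

Section coulomb_energy.
Context {R : realType}.
Notation mu := (@lebesgue_measure R).
Implicit Types (f g : R3 R -> R) (x y z : R3 R).

Lemma vol3_set1 x : vol3 [set x] = 0%E.
Proof.
have -> : [set x] = ([set x.1.1] `*` [set x.1.2]) `*` [set x.2].
  apply/seteqP; split => [_ ->//|[[a b] c] /= [[-> ->] ->]].
  by case: x => [[]].
rewrite [LHS]product_measure1E//; last exact: measurableX.
rewrite -[RHS](mule0 (vol2 ([set x.1.1] `*` [set x.1.2]))); congr (_ * _)%E.
exact: lebesgue_measure_set1.
Qed.

Lemma ae_neq x : {ae @vol3 R, forall y, x != y}.
Proof.
have sE : [set x] = ([set x.1.1] `*` [set x.1.2]) `*` [set x.2].
  by case: x => [[p q] r]; apply/seteqP; split => [_ ->//|[[a b] c] /= [[-> ->] ->]].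
exists [set x]; split.
- by rewrite sE; apply: measurableX => //; exact: measurableX.
- exact: vol3_set1.
- by move=> y /= /negP; rewrite negbK => /eqP.
Qed.

Definition energy f g : \bar R :=
  (\int[vol3]_x \int[vol3]_y (f x * g y / dist3 x y)%:E)%E.

Let a (p : R * R3 R) x : R :=
  Num.sqrt (`|p.1| ^+ 3) * expR (- (2 * p.1 ^+ 2 * dsq x p.2)).

(** The Coulomb kernel is a superposition of Gaussians in |x - y|, each of
    which is a convolution square of a Gaussian. The scale q and the centre z
    are merged into one parameter p = (q, z), and the point q = 0, where the
    formula for the Gaussian integral fails, is removed. *)
Lemma coulomb_gaussE x y : x != y ->
  (\int[sfprod mu vol3]_p (a p x * a p y)%:E = (pi ^+ 2 / 8 / dist3 x y)%:E)%E.
Proof.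
move=> xy; have r0 := dsq_gt0 xy.
rewrite integral_sfprod; last 2 first.
- by rewrite /a; meas.
- by move=> p; rewrite lee_fin !mulr_ge0// ?sqrtr_ge0// expR_ge0.
rewrite (@integral_setT_D1 _ _ 0); last first.
  apply: (@measurable_integral_on _ _ _ _ _ vol3 setT
    (fun q z => (a (q, z) x * a (q, z) y)%:E)) => //.
    by rewrite /a /=; meas.
  by move=> q z; rewrite lee_fin !mulr_ge0// ?sqrtr_ge0// expR_ge0.
transitivity (\int[mu]_(q in setT `\ 0%R)
   ((Num.sqrt pi / 2) ^+ 3 * expR (- (dsq x y * (q - 0) ^+ 2)))%:E)%E.
  apply: eq_integral => q; rewrite inE /= => -[_ /eqP q0].
  have q2 : 0 < q ^+ 2 by rewrite exprn_even_gt0.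
  under eq_integral => z _.
    rewrite /a /= mulrACA -expr2 sqr_sqrtr ?exprn_ge0// EFinM.
    over.
  rewrite ge0_integralZl; [|side..].
  have q4 : 0 < 2 * q ^+ 2 by rewrite mulr_gt0.
  rewrite (integral_gauss3_pair x y q4) -EFinM; congr (_%:E).
  have -> : 2 * (2 * q ^+ 2) = (2 * `|q|) ^+ 2 by rewrite exprMn real_normK ?num_real//; ring.
  rewrite sqrtr_sqr normrM normr_id (ger0_norm (ler0n _ 2)) mulrA -exprMn; congr (_ ^+ 3 * expR _).
    by field; rewrite normr_eq0.
  by rewrite subr0; field.
rewrite -integral_setT_D1; last by meas.
under eq_integral do rewrite EFinM.
rewrite ge0_integralZl; [|side..].
rewrite integral_gauss// -EFinM; congr (_%:E).
rewrite dist3E.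
have pE : (pi : R) = Num.sqrt pi ^+ 2 by rewrite sqr_sqrtr// pi_ge0.
rewrite [in RHS]pE; field.
by rewrite gt_eqF// sqrtr_gt0.
Qed.

End coulomb_energy.

(** * The Coulomb form *)

Section energy_lemmas.
Context {R : realType}.
Notation mu := (@lebesgue_measure R).
Implicit Types (f g w : R3 R -> R) (x y z : R3 R).

Let a (p : R * R3 R) x : R :=
  Num.sqrt (`|p.1| ^+ 3) * expR (- (2 * p.1 ^+ 2 * dsq x p.2)).

Let ma : measurable_fun setT (fun z : measurableTypeR R * R3 R * R3 R => a z.1 z.2).
Proof. by rewrite /a; meas. Qed.

Let a0 p x : 0 <= a p x.
Proof. by rewrite mulr_ge0 ?sqrtr_ge0 ?expR_ge0. Qed.

Let c8 : R := pi ^+ 2 / 8.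

Let c8_gt0 : 0 < c8.
Proof. by rewrite divr_gt0// exprn_gt0// pi_gt0. Qed.

Lemma measurable_energy_kernel f g : measurable_fun setT f -> measurable_fun setT g ->
  measurable_fun setT (fun z : R3 R * R3 R => (f z.1 * g z.2 / dist3 z.1 z.2)%:E).
Proof. by move=> mf mg; meas. Qed.

Lemma measurable_energy_kernel2 f g x : measurable_fun setT f -> measurable_fun setT g ->
  measurable_fun setT (fun y : R3 R => (f x * g y / dist3 x y)%:E).
Proof. by move=> mf mg; meas. Qed.

Lemma dist3_ge0 x y : 0 <= dist3 x y. Proof. exact: sqrtr_ge0. Qed.

Lemma energy_inner_ge0 f g x : (forall x, 0 <= f x) -> (forall x, 0 <= g x) ->
  (0 <= \int[vol3]_y (f x * g y / dist3 x y)%:E)%E.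
Proof.
by move=> f0 g0; apply: integral_ge0 => y _; rewrite lee_fin divr_ge0 ?mulr_ge0 ?dist3_ge0.
Qed.

Lemma energy_ge0 f g : (forall x, 0 <= f x) -> (forall x, 0 <= g x) ->
  (0 <= energy f g)%E.
Proof. by move=> f0 g0; apply: integral_ge0 => x _; exact: energy_inner_ge0. Qed.

Lemma measurable_energy_inner f g : measurable_fun setT f -> measurable_fun setT g ->
  (forall x, 0 <= f x) -> (forall x, 0 <= g x) ->
  measurable_fun setT (fun x => \int[vol3]_y (f x * g y / dist3 x y)%:E)%E.
Proof.
move=> mf mg f0 g0.
apply: (@measurable_integral_on _ _ _ _ _ vol3 setT
  (fun x y => (f x * g y / dist3 x y)%:E)) => //.
  exact: measurable_energy_kernel.
by move=> x y; rewrite lee_fin divr_ge0 ?mulr_ge0 ?dist3_ge0.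
Qed.

(** The kernels agree off the diagonal only; for fixed x the diagonal is a
    null set. *)
Lemma energy_gaussE f g : measurable_fun setT f -> measurable_fun setT g ->
  (forall x, 0 <= f x) -> (forall x, 0 <= g x) ->
  (\int[sfprod mu vol3]_p ((\int[vol3]_x (f x * a p x)%:E) * (\int[vol3]_x (g x * a p x)%:E))
   = c8%:E * energy f g)%E.
Proof.
move=> mf mg f0 g0.
rewrite (posdef_kernelE (sfprod mu vol3) vol3 ma a0 mf mg f0 g0).
rewrite /energy -ge0_integralZl//; last 3 first.
- exact: measurable_energy_inner.
- by move=> x _; exact: energy_inner_ge0.
- by rewrite lee_fin ltW.
apply: eq_integral => x _; rewrite -ge0_integralZl//; last 3 first.
- exact: measurable_energy_kernel2.
- by move=> y _; rewrite lee_fin divr_ge0 ?mulr_ge0 ?dist3_ge0.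
- by rewrite lee_fin ltW.
apply: ae_eq_integral => //.
- apply: measurable_fun_mule; first by meas.
  apply: (@measurable_integral_on _ _ _ _ _ (sfprod mu vol3) setT
    (fun y p => (a p x * a p y)%:E)) => //.
    by rewrite /a; meas.
  by move=> y p; rewrite lee_fin mulr_ge0.
- by apply: measurable_fun_mule => //; exact: measurable_energy_kernel2.
- apply: filterS (ae_neq x) => y xy _.
  rewrite coulomb_gaussE// -!EFinM; congr (_%:E).
  by rewrite /c8; ring.
Qed.

(** By [energy_gaussE] the form is, up to a constant, an L^2 scalar product.
    The weights t and 1/t replace the square roots of energies that may be
    infinite. *)
Lemma energy_cauchy_schwarz (t : R) f g : 0 < t ->
  measurable_fun setT f -> measurable_fun setT g ->
  (forall x, 0 <= f x) -> (forall x, 0 <= g x) ->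
  (2%:E * energy f g <= t%:E * energy f f + t^-1%:E * energy g g)%E.
Proof.
move=> t0 mf mg f0 g0.
have := posdef_kernel_amgm (sfprod mu vol3) vol3 ma a0 t0 mf mg f0 g0.
rewrite !energy_gaussE//.
move: (energy f g) (energy f f) (energy_ge0 f0 f0) (energy g g) (energy_ge0 g0 g0).
move=> E F F0 G G0 H.
rewrite -(@lee_pmul2l _ c8%:E)//.
rewrite ge0_muleDr; [|by rewrite mule_ge0// lee_fin ltW
                     |by rewrite mule_ge0// lee_fin invr_ge0 ltW].
by rewrite muleCA (muleCA c8%:E) (muleCA c8%:E t^-1%:E).
Qed.

(** The kernel of the quadratic form on the left is the one bounded by
    [riesz2_le]. *)
Lemma riesz_square f : measurable_fun setT f -> (forall x, 0 <= f x) ->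
  (\int[vol3]_z ((\int[vol3]_x (f x / dsq x z)%:E) * (\int[vol3]_x (f x / dsq x z)%:E))
   <= (4 * pi ^+ 2)%:E * energy f f)%E.
Proof.
move=> mf f0.
pose b z x : R := (dsq x z)^-1.
have mb : measurable_fun setT (fun w : R3 R * R3 R => b w.1 w.2) by rewrite /b; meas.
have b0 z x : 0 <= b z x by rewrite invr_ge0 dsq_ge0.
rewrite (posdef_kernelE vol3 vol3 mb b0 mf mf f0 f0).
have p0 : 0 <= 4 * pi ^+ 2 :> R by rewrite mulr_ge0// exprn_ge0// pi_ge0.
rewrite /energy -ge0_integralZl//; last 2 first.
- exact: measurable_energy_inner.
- by move=> x _; exact: energy_inner_ge0.
apply: le_integral_ge0.
  move=> x _; apply: integral_ge0 => y _; rewrite mule_ge0 ?lee_fin ?mulr_ge0//.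
  by apply: integral_ge0 => z _; rewrite lee_fin mulr_ge0.
move=> x _; rewrite -ge0_integralZl//; last 2 first.
- exact: measurable_energy_kernel2.
- by move=> y _; rewrite lee_fin divr_ge0 ?mulr_ge0 ?dist3_ge0.
apply: ae_ge0_le_integral => //.
- move=> y _; rewrite mule_ge0 ?lee_fin ?mulr_ge0//.
  by apply: integral_ge0 => z _; rewrite lee_fin mulr_ge0.
- apply: measurable_fun_mule; first by meas.
  apply: (@measurable_integral_on _ _ _ _ _ vol3 setT
    (fun y z => (b z x * b z y)%:E)) => //.
    by rewrite /b; meas.
  by move=> y p; rewrite lee_fin mulr_ge0.
- by move=> y _; rewrite mule_ge0 ?lee_fin// divr_ge0 ?mulr_ge0 ?dist3_ge0.
- by apply: measurable_fun_mule => //; exact: measurable_energy_kernel2.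
- apply: filterS (ae_neq x) => y xy _.
  have h := riesz2_le xy.
  apply: (le_trans (lee_wpmul2l _ h)); first by rewrite lee_fin mulr_ge0.
  by rewrite -!EFinM lee_fin dist3E le_eqVlt; apply/orP; left; apply/eqP; ring.
Qed.

Let K : R := 2 * Num.sqrt pi ^+ 3 / Num.sqrt 2.

(** The Coulomb kernel is at most 1 at distance at least 1, and nearby exp(1 -
    r^2) is at least 1. *)
Lemma coulomb_split (r : R) : 0 <= r -> r^-1 <= 1 + expR 1 * expR (- r ^+ 2) / r.
Proof.
move=> r0; have [r1|r1] := leP 1 r.
  apply: (@le_trans _ _ 1); first by rewrite invf_le1// (lt_le_trans _ r1).
  by rewrite lerDl divr_ge0// mulr_ge0// expR_ge0.
apply: (@le_trans _ _ (expR 1 * expR (- r ^+ 2) / r)); last by rewrite lerDr.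
rewrite -expRD ler_peMl ?invr_ge0//.
by rewrite -[leLHS]expR0 ler_expR subr_ge0 exprn_ile1// ltW.
Qed.

(** The bounded part of the kernel gives the square of int w^2. For the
    singular part k, w(x)^2 w(y)^2 <= w(x)^3 w(y) + w(x) w(y)^3 leaves int
    w(x)^3 (int w(y) k(x, y) dy) dx, and w k <= w^2 + k^2 bounds the inner
    integral. *)
Lemma energy_sqr_le (A : R) w : measurable_fun setT w -> (forall x, 0 <= w x) ->
  (\int[vol3]_x (w x ^+ 2)%:E <= A%:E)%E ->
  (energy (fun x => w x ^+ 2)%R (fun x => w x ^+ 2)%R
   <= (A ^+ 2)%:E + (2 * (A + expR 1 ^+ 2 * K))%:E * \int[vol3]_x (w x ^+ 3)%:E)%E.
Proof.
move=> mw w0 wA.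
pose k x y : R := expR 1 * expR (- dsq x y) / dist3 x y.
have k0 x y : 0 <= k x y by rewrite divr_ge0 ?dist3_ge0// mulr_ge0 ?expR_ge0.
have kC x y : k x y = k y x by rewrite /k !dist3E dsqC.
pose G x y := w x ^+ 3 * w y * k x y.
have G0 x y : 0 <= G x y by rewrite /G; pos.
have mk : measurable_fun setT (fun z : R3 R * R3 R => k z.1 z.2).
  by rewrite /k; meas.
have mG : measurable_fun setT (fun z : R3 R * R3 R => G z.1 z.2).
  by rewrite /G; meas.
have mG' : measurable_fun setT (fun z : R3 R * R3 R => (G z.2 z.1)%:E).
  by rewrite /G /k; meas.
have A0 : 0 <= A.
  rewrite -lee_fin; apply: le_trans wA; apply: integral_ge0 => x _.
  by rewrite lee_fin exprn_ge0.
have ptw x y : w x ^+ 2 * w y ^+ 2 / dist3 x y <= w x ^+ 2 * w y ^+ 2 + (G x y + G y x).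
  apply: (@le_trans _ _ (w x ^+ 2 * w y ^+ 2 * (1 + k x y))).
    rewrite ler_wpM2l ?mulr_ge0 ?exprn_ge0//.
    rewrite /k -[dsq x y](@sqr_sqrtr _ (dsq x y)) ?dsq_ge0// -dist3E.
    by rewrite coulomb_split// dist3_ge0.
  rewrite mulrDr mulr1 lerD2l /G (kC y x) -mulrDl ler_wpM2r//.
  rewrite -subr_ge0.
  have -> : w x ^+ 3 * w y + w y ^+ 3 * w x - w x ^+ 2 * w y ^+ 2
    = w x * w y * ((w x - w y) ^+ 2 + w x * w y) by ring.
  by rewrite mulr_ge0 ?addr_ge0 ?sqr_ge0 ?mulr_ge0.
pose GI := (\int[vol3]_x \int[vol3]_y (G x y)%:E)%E.
have GIle : (GI <= (A + expR 1 ^+ 2 * K)%:E * \int[vol3]_x (w x ^+ 3)%:E)%E.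
  rewrite -ge0_integralZl//; last 3 first.
  - by meas.
  - by move=> x _; rewrite lee_fin exprn_ge0.
  - rewrite lee_fin addr_ge0// mulr_ge0 ?exprn_ge0 ?expR_ge0//.
    by rewrite divr_ge0 ?sqrtr_ge0// mulr_ge0// exprn_ge0// sqrtr_ge0.
  apply: le_integral_ge0.
    by move=> x _; apply: integral_ge0 => y _; rewrite lee_fin.
  move=> x _; rewrite muleC.
  have mkx : measurable_fun setT (k x) by exact: (measurableT_comp mk (pair1_measurable x)).
  under eq_integral do rewrite /G -mulrA EFinM.
  rewrite ge0_integralZl//; last 3 first.
  - by apply/measurable_EFinP; apply: measurable_funM.
  - by move=> y _; rewrite lee_fin mulr_ge0.
  - by rewrite lee_fin exprn_ge0.
  rewrite lee_wpmul2l ?lee_fin ?exprn_ge0//.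
  apply: (@le_trans _ _ (\int[vol3]_y ((w y ^+ 2)%:E +
     (expR 1 ^+ 2)%:E * (expR (- (2 * dsq x y)) / dsq x y)%:E))%E).
    apply: le_integral_ge0.
      by move=> y _; rewrite lee_fin mulr_ge0.
    move=> y _; rewrite -EFinM -EFinD lee_fin.
    have -> : expR 1 ^+ 2 * (expR (- (2 * dsq x y)) / dsq x y) = k x y ^+ 2.
      rewrite /k !exprMn exprVn dist3E sqr_sqrtr ?dsq_ge0// mulrA; congr (_ * _ / _).
      by rewrite -expRM_natl; congr expR; ring.
    rewrite -subr_ge0.
    have -> : w y ^+ 2 + k x y ^+ 2 - w y * k x y = (w y - k x y) ^+ 2 + w y * k x y by ring.
    by pos.
  rewrite ge0_integralD//; last 4 first.
  - by move=> y _; rewrite lee_fin exprn_ge0.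
  - by meas.
  - by move=> y _; rewrite -EFinM lee_fin mulr_ge0 ?exprn_ge0 ?expR_ge0// divr_ge0 ?expR_ge0// dsq_ge0.
  - by meas.
  rewrite EFinD leeD//.
  rewrite ge0_integralZl; [|side..].
  rewrite (EFinM (expR 1 ^+ 2) K) lee_wpmul2l ?lee_fin ?exprn_ge0 ?expR_ge0//.
  exact: riesz2_gauss_le.
clear kC mk ; clearbody G k.
have GIE : (\int[vol3]_x \int[vol3]_y (G y x)%:E = GI)%E.
  rewrite /GI.
  rewrite (@tonelli_on _ _ _ _ _ vol3 vol3 setT (fun x y => (G y x)%:E))//.
  by move=> x y; rewrite lee_fin.
apply: (@le_trans _ _ (\int[vol3]_x \int[vol3]_y ((w x ^+ 2 * w y ^+ 2)%:E
   + ((G x y)%:E + (G y x)%:E))%E)%E).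
  apply: le_integral_ge0.
    by move=> x _; apply: integral_ge0 => y _; pos.
  move=> x _; apply: le_integral_ge0.
    by move=> y _; pos.
  by move=> y _; rewrite -!EFinD lee_fin.
have mGx x : measurable_fun setT (G x) by exact: (measurableT_comp mG (pair1_measurable x)).
have mGy x : measurable_fun setT (fun y => G y x) by exact: (measurableT_comp mG (pair2_measurable x)).
have mIG : measurable_fun setT (fun x => \int[vol3]_y (G x y)%:E)%E.
  apply: (@measurable_integral_on _ _ _ _ _ vol3 setT (fun x y => (G x y)%:E)).
  - exact: measurableT.
  - by apply/measurable_EFinP.
  - by move=> x y; rewrite lee_fin.
have mIG' : measurable_fun setT (fun x => \int[vol3]_y (G y x)%:E)%E.
  apply: (@measurable_integral_on _ _ _ _ _ vol3 setT (fun x y => (G y x)%:E)).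
  - exact: measurableT.
  - exact: mG'.
  - by move=> x y; rewrite lee_fin.
have IG0 x : (0 <= \int[vol3]_y (G x y)%:E)%E.
  by apply: integral_ge0 => y _; rewrite lee_fin.
have IG0' x : (0 <= \int[vol3]_y (G y x)%:E)%E.
  by apply: integral_ge0 => y _; rewrite lee_fin.
have Iw0 : (0 <= \int[vol3]_x (w x ^+ 2)%:E)%E.
  by apply: integral_ge0 => y _; rewrite lee_fin; pos.
have innerE x : (\int[vol3]_y ((w x ^+ 2 * w y ^+ 2)%:E + ((G x y)%:E + (G y x)%:E)) =
    (w x ^+ 2)%:E * \int[vol3]_y (w y ^+ 2)%:E +
    (\int[vol3]_y (G x y)%:E + \int[vol3]_y (G y x)%:E))%E.
  rewrite ge0_integralD; last 5 first.
  - exact: measurableT.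
  - by move=> y _; pos.
  - by meas.
  - by move=> y _; rewrite -EFinD lee_fin addr_ge0.
  - by apply: emeasurable_funD; apply/measurable_EFinP.
  rewrite [in X in (_ + X)%E]ge0_integralD; last 5 first.
  - exact: measurableT.
  - by move=> y _; rewrite lee_fin.
  - by apply/measurable_EFinP.
  - by move=> y _; rewrite lee_fin.
  - by apply/measurable_EFinP.
  congr (_ + _)%E; under eq_integral do rewrite EFinM.
  by rewrite ge0_integralZl; [|side..].
under eq_integral do rewrite innerE.
rewrite ge0_integralD; last 5 first.
- exact: measurableT.
- by move=> x _; rewrite mule_ge0// lee_fin exprn_ge0.
- by apply: measurable_fun_mule; meas.
- by move=> x _; rewrite adde_ge0.
- by apply: emeasurable_funD.
apply: leeD.
  rewrite ge0_integralZr; [|exact: measurableT|by meas|by move=> x _; pos|exact: Iw0].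
  rewrite expr2 EFinM; exact: lee_pmul.
rewrite ge0_integralD; last 5 first.
- exact: measurableT.
- by move=> x _.
- exact: mIG.
- by move=> x _.
- exact: mIG'.
rewrite GIE -/GI.
apply: (le_trans (leeD GIle GIle)).
have C0 : 0 <= A + expR 1 ^+ 2 * K by rewrite /K; pos.
rewrite -ge0_muleDl ?lee_fin// -EFinD le_eqVlt; apply/orP; left; apply/eqP.
by congr (_%:E * _)%E; ring.
Qed.

End energy_lemmas.

(** * Product test functions *)

Section bump_derivative.
Context {R : realType}.
Implicit Types (k : nat) (t v : R) (w Q : {poly R}).

(** For k = 0 this is the classical function that is smooth at 0 with all
    derivatives zero; the powers of 1/v make the family stable under
    differentiation. *)
Definition flat k v : R := if 0 < v then v^-1 ^+ k * expR (- v^-1) else 0.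

Lemma flat_ge0 k v : 0 <= flat k v.
Proof.
rewrite /flat; case: ifPn => // v0.
by rewrite mulr_ge0 ?expR_ge0// exprn_ge0// invr_ge0 ltW.
Qed.

(** Domination by v^2 makes the derivative at 0 vanish. *)
Lemma flat_le k v : flat k v <= (k.+2)`!%:R * v ^+ 2.
Proof.
rewrite /flat; case: ifPn => [v0|_]; last by rewrite mulr_ge0 ?sqr_ge0.
have x0 : 0 <= v^-1 by rewrite invr_ge0 ltW.
rewrite expRN ler_pdivrMr ?expR_gt0// -mulrA.
have h := @expR_ge1Dxn _ v^-1 k.+1 x0.
have h1 : v^-1 ^+ k.+2 / (k.+2)`!%:R <= expR v^-1 by apply: le_trans h; rewrite lerDr.
have f0 : 0 < (k.+2)`!%:R :> R by rewrite ltr0n fact_gt0.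
move: h1; rewrite ler_pdivrMr// => h1.
have -> : v^-1 ^+ k = v ^+ 2 * v^-1 ^+ k.+2.
  have -> : v^-1 ^+ k.+2 = v^-1 ^+ k * v^-1 ^+ 2 by rewrite -exprD addn2.
  by rewrite mulrCA -exprMn divff ?gt_eqF// expr1n mulr1.
by rewrite [leRHS]mulrCA ler_wpM2l ?sqr_ge0// mulrC.
Qed.

Lemma is_derive_flat k v :
  is_derive v 1 (flat k) (flat k.+2 v - k%:R * flat k.+1 v).
Proof.
have [v0|v0|->] := ltgtP v 0.
- rewrite /flat ltNge (ltW v0) /= mulr0 subr0.
  apply: (@near_eq_is_derive _ _ _ (cst 0)).
  near=> u; rewrite /flat ifF//; apply/negbTE; rewrite -leNgt ltW//.
  by near: u; exact: lt_nbhsl.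
- have hnear : \forall u \near v, u^-1 ^+ k * expR (- u^-1) = flat k u.
    by near=> u; rewrite /flat ifT//; near: u; exact: lt_nbhsr.
  have vn0 : v != 0 by rewrite gt_eqF.
  have dv : is_derive v 1 (fun u : R => u^-1) (- v^-1 ^+ 2).
    have := @is_deriveV R id v 1 1 vn0 (is_derive_id _ _).
    by move/is_derive_eq; apply; rewrite /GRing.scale /= mulr1 exprVn.
  have dE : is_derive v 1 (fun u : R => u^-1 ^+ k * expR (- u^-1))
      (flat k.+2 v - k%:R * flat k.+1 v).
    have dX : is_derive v 1 (fun u : R => u^-1 ^+ k) (k%:R * v^-1 ^+ k.-1 * - v^-1 ^+ 2).
      by have := is_deriveX k dv; rewrite exprfctE.
    have dN : is_derive v 1 (fun u : R => - u^-1) (v^-1 ^+ 2).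
      by have := is_deriveN dv; rewrite opprK.
    have := is_deriveM dX (@is_derive1_comp _ expR (fun u => - u^-1) v _ _
      (is_derive_expR (- v^-1)) dN).
    move/is_derive_eq; apply.
    rewrite /flat v0 /GRing.scale /=.
    by case: k {hnear dX} => [|k] /=; rewrite ?expr0 ?exprS; ring.
  exact: (near_eq_is_derive hnear dE).
- rewrite /flat ltxx mulr0 subr0.
  have lim0 : h^-1 *: ((flat k \o shift 0) (h *: (1 : R)) - flat k 0) @[h --> (0 : R)^'] --> (0 : R).
    apply/cvgr0Pnorm_le => e e0.
    have f0 : 0 < (k.+2)`!%:R :> R by rewrite ltr0n fact_gt0.
    near=> h.
    have hn0 : h != 0 by near: h; exact: nbhs_dnbhs_neq.
    rewrite /= addr0 [h *: 1]mulr1 {2}/flat ltxx subr0.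
    rewrite normrM normfV (ger0_norm (flat_ge0 _ _)) ler_pdivrMl ?normr_gt0//.
    apply: (le_trans (flat_le _ _)).
    rewrite -[h ^+ 2]real_normK ?num_real// expr2 mulrA mulrC ler_wpM2l//.
    rewrite mulrC -ler_pdivlMr//.
    near: h; apply: dnbhs0_le; exact: divr_gt0.
  by split; [exact: (cvgP _ lim0)|exact: (cvg_lim _ lim0)].
Unshelve. all: by end_near. Qed.

(** The witness S is a class of functions stable under differentiation: this
    is the coinductive reading of infinite differentiability, and it avoids
    iterated derivatives. *)
Definition smooth1 (f : R -> R) := exists S : (R -> R) -> Prop,
  S f /\ forall g, S g -> exists g', S g' /\ forall t : R, is_derive t 1 g (g' t).

Lemma smooth1_derive f : smooth1 f ->
  exists2 f', smooth1 f' & forall t : R, is_derive t 1 f (f' t).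
Proof.
by move=> [S [Sf HS]]; have [f' [Sf' df]] := HS f Sf; exists f' => //; exists S.
Qed.

(** Sums of the functions Q(t) flat_k(w(t)), the smallest class that contains
    the bump and is stable under differentiation. *)
Inductive bump_class w : (R -> R) -> Prop :=
| BumpGen k Q : bump_class w (fun t => Q.[t] * flat k w.[t])
| BumpAdd f g of bump_class w f & bump_class w g : bump_class w (fun t => f t + g t).

Lemma smooth1_bump k Q w : smooth1 (fun t => Q.[t] * flat k w.[t]).
Proof.
exists (bump_class w); split; first exact: BumpGen.
move=> g; elim => {g} [k' P|f g _ [f' [cf df]] _ [g' [cg dg]]]; last first.
  exists (fun t => f' t + g' t); split; first exact: BumpAdd.
  by move=> t; exact: is_deriveD.
exists (fun t => (P^`()).[t] * flat k' w.[t] +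
   ((P * w^`()).[t] * flat k'.+2 w.[t] + (- k'%:R *: (P * w^`())).[t] * flat k'.+1 w.[t])).
split; first by apply: BumpAdd; [exact: BumpGen|apply: BumpAdd; exact: BumpGen].
move=> t.
have dw := is_derive1_comp (is_derive_flat k' w.[t]) (is_derive_poly w t).
have dP := is_derive_poly P t.
have := is_deriveM dP dw.
move/is_derive_eq; apply.
by rewrite /GRing.scale /= hornerZ !hornerM; ring.
Qed.

End bump_derivative.

Section product_test_functions.
Context {R : realType}.
Implicit Types (A B C : R -> R) (z : R3 R).

Definition prod3 A B C : R3 R -> R := fun z => A z.1.1 * B z.1.2 * C z.2.

Lemma differentiable_fst (U V : normedModType R) (z : U * V) :
  differentiable (fst : U * V -> U) z.
Proof. by apply: linear_differentiable => -[a b] /=; exact: cvg_fst. Qed.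

Lemma differentiable_snd (U V : normedModType R) (z : U * V) :
  differentiable (snd : U * V -> V) z.
Proof. by apply: linear_differentiable => -[a b] /=; exact: cvg_snd. Qed.

Lemma differentiable_prod3 A B C z : derivable A z.1.1 1 -> derivable B z.1.2 1 ->
  derivable C z.2 1 -> differentiable (prod3 A B C : R * R * R -> R) z.
Proof.
move=> /derivable1_diffP dA /derivable1_diffP dB /derivable1_diffP dC.
apply: differentiableM; first apply: differentiableM.
- apply: (@differentiable_comp _ _ _ _ (fun z : R * R * R => z.1.1) A) => //.
  apply: (@differentiable_comp _ _ _ _ (fun z : R * R * R => z.1) fst);
    exact: differentiable_fst.
- apply: (@differentiable_comp _ _ _ _ (fun z : R * R * R => z.1.2) B) => //.
  apply: (@differentiable_comp _ _ _ _ (fun z : R * R * R => z.1) snd).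
    exact: differentiable_fst.
  exact: differentiable_snd.
- apply: (@differentiable_comp _ _ _ _ (fun z : R * R * R => z.2) C) => //.
  exact: differentiable_snd.
Qed.

(** Along a coordinate direction only one factor varies, so the difference
    quotient is that of one function of one variable. *)
Lemma partial_prod3 (i : 'I_3) A B C z :
  derivable A z.1.1 1 -> derivable B z.1.2 1 -> derivable C z.2 1 ->
  partial i (prod3 A B C) z =
  match val i with
  | 0%N => 'D_1 A z.1.1 * B z.1.2 * C z.2
  | 1%N => A z.1.1 * 'D_1 B z.1.2 * C z.2
  | _ => A z.1.1 * B z.1.2 * 'D_1 C z.2
  end.
Proof.
move=> dA dB dC.
case: i => -[|[|[|//]]] ilt /=.
- transitivity ('D_1 ((B z.1.2 * C z.2) \o* A) z.1.1); last by rewrite deriveMr// mulrC mulrA.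
  rewrite /partial /derive; apply: (congr1 (fun F : R -> R => lim (F @ (0 : R)^'))).
  apply/funext => h /=.
  by rewrite /basis3 /prod3 /= !scaler0 !add0r /= -!mulrA.
- transitivity ('D_1 ((A z.1.1 * C z.2) \o* B) z.1.2); last by rewrite deriveMr//; ring.
  rewrite /partial /derive; apply: (congr1 (fun F : R -> R => lim (F @ (0 : R)^'))).
  apply/funext => h /=.
  rewrite /basis3 /prod3 /= !scaler0 !add0r /=; congr (_ *: (_ - _)); ring.
- transitivity ('D_1 ((A z.1.1 * B z.1.2) \o* C) z.2); last by rewrite deriveMr//; ring.
  rewrite /partial /derive; apply: (congr1 (fun F : R -> R => lim (F @ (0 : R)^'))).
  apply/funext => h /=.
  by rewrite /basis3 /prod3 /= !scaler0 !add0r /=; congr (_ *: (_ - _)); ring.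
Qed.

(** Iterated partial derivatives of a product are again products, of
    derivatives of the factors. *)
Lemma smooth_prod3 A B C : smooth1 A -> smooth1 B -> smooth1 C -> smooth (prod3 A B C).
Proof.
move=> sA sB sC s.
suff : exists A' B' C', [/\ smooth1 A', smooth1 B', smooth1 C' &
    foldr (@partial R) (prod3 A B C) s = prod3 A' B' C'].
  move=> [A' [B' [C' [sA' sB' sC' ->]]]] x.
  have [A1 _ dA] := smooth1_derive sA'.
  have [B1 _ dB] := smooth1_derive sB'.
  have [C1 _ dC] := smooth1_derive sC'.
  exact: differentiable_prod3.
elim: s => [|i s [A' [B' [C' [sA' sB' sC' /= ->]]]]]; first by exists A, B, C.
have [A1 sA1 dA] := smooth1_derive sA'.
have [B1 sB1 dB] := smooth1_derive sB'.
have [C1 sC1 dC] := smooth1_derive sC'.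
have dA' t : derivable A' t 1 by have [] := dA t.
have dB' t : derivable B' t 1 by have [] := dB t.
have dC' t : derivable C' t 1 by have [] := dC t.
have E z := partial_prod3 i (dA' z.1.1) (dB' z.1.2) (dC' z.2).
case: i E => -[|[|[|//]]] ilt /= E.
- exists A1, B', C'; split => //; apply/funext => z.
  by rewrite E (@derive_val _ _ _ _ _ _ _ (dA _)).
- exists A', B1, C'; split => //; apply/funext => z.
  by rewrite E (@derive_val _ _ _ _ _ _ _ (dB _)).
- exists A', B', C1; split => //; apply/funext => z.
  by rewrite E (@derive_val _ _ _ _ _ _ _ (dC _)).
Qed.

Lemma test_function_prod3 A B C (a b : R) : smooth1 A -> smooth1 B -> smooth1 C ->
  (forall t, t \notin `[a, b] -> A t = 0) -> (forall t, t \notin `[a, b] -> B t = 0) ->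
  (forall t, t \notin `[a, b] -> C t = 0) -> test_function (prod3 A B C).
Proof.
move=> sA sB sC A0 B0 C0; split; first exact: smooth_prod3.
pose I : set R := `[a, b]%classic.
have cK : compact (I `*` I `*` I).
  by apply: compact_setX; [apply: compact_setX|]; exact: segment_compact.
have clK : closed (I `*` I `*` I).
  by apply: compact_closed => //; exact: norm_hausdorff.
apply: (subclosed_compact _ cK); first exact: closed_closure.
rewrite [X in _ `<=` X]((closure_id _).1 clK); apply: closure_subset.
move=> [[x y] z] /=; rewrite /prod3 /= !mulf_eq0 !negb_or => /andP[/andP[Ax By] Cz].
split; [split|]; rewrite /I /=; apply: contraT.
- by move/A0 => /eqP; rewrite (negbTE Ax).
- by move/B0 => /eqP; rewrite (negbTE By).
- by move/C0 => /eqP; rewrite (negbTE Cz).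
Qed.

End product_test_functions.

(** * Smooth truncations of the Gaussian *)

Section bump.
Context {R : realType}.
Notation mu := (@lebesgue_measure R).
Implicit Types (t s x N : R).

Definition bump_poly N : {poly R} := (N ^+ 2)^-1 *: (N%:P - 'X ^+ 2).

(** A smooth function with support in t^2 <= N which increases to the Gaussian
    exp(-t^2) when N grows; the explicit form is in [bumpE]. *)
Definition bump N t : R := expR N * flat 0 (bump_poly N).[t].

Lemma bump_polyE N t : (bump_poly N).[t] = (N ^+ 2)^-1 * (N - t ^+ 2).
Proof. by rewrite hornerZ hornerD hornerN hornerXn hornerC. Qed.

Lemma bumpE N t : 0 < N -> t ^+ 2 < N ->
  bump N t = expR (- t ^+ 2 * (1 - t ^+ 2 / N)^-1).
Proof.
move=> N0 tN; rewrite /bump /flat bump_polyE.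
have d0 : 0 < N - t ^+ 2 by rewrite subr_gt0.
rewrite mulr_gt0 ?invr_gt0 ?exprn_gt0// expr0 mul1r -expRD; congr expR.
by field; rewrite ?gt_eqF.
Qed.

Lemma bump_out N t : 0 < N -> N <= t ^+ 2 -> bump N t = 0.
Proof.
move=> N0 tN; rewrite /bump /flat bump_polyE pmulr_rgt0 ?invr_gt0 ?exprn_gt0//.
by rewrite subr_gt0 ltNge tN /= mulr0.
Qed.

Lemma bump_ge0 N t : 0 <= bump N t.
Proof. by rewrite mulr_ge0 ?expR_ge0 ?flat_ge0. Qed.

Lemma bump_le_gauss N t : 0 < N -> bump N t <= expR (- t ^+ 2).
Proof.
move=> N0; have [tN|tN] := ltP (t ^+ 2) N; last by rewrite bump_out ?expR_ge0.
rewrite bumpE// ler_expR mulNr lerN2.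
have d0 : 0 < 1 - t ^+ 2 / N by rewrite subr_gt0 ltr_pdivrMr ?mul1r.
rewrite ler_peMr ?sqr_ge0// invf_ge1//.
by rewrite gerBl divr_ge0 ?sqr_ge0 ?ltW.
Qed.

Lemma smooth1_bump_affine (N s x : R) (Q : {poly R}) :
  smooth1 (fun t => Q.[s * (x - t)] * bump N (s * (x - t))).
Proof.
pose l : {poly R} := s *: (x%:P - 'X).
have lE t : l.[t] = s * (x - t) by rewrite hornerZ hornerD hornerN hornerX hornerC.
have := smooth1_bump 0 (expR N *: (Q \Po l)) (bump_poly N \Po l).
congr smooth1; apply/funext => t.
by rewrite /bump hornerZ !horner_comp lE; ring.
Qed.

Lemma smooth1_bumpQ (N : R) (Q : {poly R}) : smooth1 (fun t => Q.[t] * bump N t).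
Proof.
have := smooth1_bump_affine N (-1) 0 Q.
by congr smooth1; apply/funext => t; rewrite sub0r mulN1r opprK.
Qed.

Lemma smooth1_continuous (f : R -> R) : smooth1 f -> continuous f.
Proof.
move=> /smooth1_derive[f' _ df] t; have [d _] := df t.
by apply/differentiable_continuous/derivable1_diffP.
Qed.

Lemma continuous_bump N : continuous (bump N).
Proof.
apply: smooth1_continuous; have := smooth1_bumpQ N 1.
by congr smooth1; apply/funext => t; rewrite hornerC mul1r.
Qed.

Lemma measurable_bump N : measurable_fun [set: measurableTypeR R] (bump N).
Proof. by apply: continuous_measurable_fun; exact: continuous_bump. Qed.

Lemma cvg_bump t : bump n.+1%:R t @[n --> \oo] --> expR (- t ^+ 2).
Proof.
have H : expR (- t ^+ 2 * (1 - t ^+ 2 / n.+1%:R)^-1) @[n --> \oo] --> expR (- t ^+ 2).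
  apply: continuous_cvg; first exact: continuous_expR.
  rewrite -[X in _ --> X]mulr1; apply: cvgM; first exact: cvg_cst.
  rewrite -[X in _ --> X]invr1; apply: cvgV; first exact: oner_neq0.
  rewrite -[X in _ --> X]subr0; apply: cvgB; first exact: cvg_cst.
  rewrite -[X in _ --> X](mulr0 (t ^+ 2)); apply: cvgM; first exact: cvg_cst.
  exact: cvg_harmonic.
apply: cvg_trans H; apply: near_eq_cvg; near=> n; rewrite bumpE// ltNge.
near: n; exists (Num.truncn (t ^+ 2)).+1 => // n /= hn; rewrite -ltNge.
apply: (lt_le_trans (truncnS_gt _)); rewrite ler_nat.
by rewrite (leq_trans hn).
Unshelve. all: by end_near. Qed.

(** Dominated convergence, with the Gaussian itself as majorant. *)
Lemma cvg_integral_bump :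
  ((\int[mu]_t (bump n.+1%:R t)%:E) @[n --> \oo] --> (Num.sqrt pi)%:E)%E.
Proof.
rewrite -(@integralT_gauss R).
have [| | | | |_ _] := @dominated_convergence _ _ _ mu setT measurableT
  (fun n t => (bump n.+1%:R t)%:E) (fun t => (gauss_fun t)%:E)
  (fun t => (gauss_fun t)%:E).
- by move=> n; apply/measurable_EFinP; exact: measurable_bump.
- by apply/measurable_EFinP; exact: measurable_gauss_fun.
- by apply/aeW => t _; apply: cvg_EFin; [exact: nearW|exact: cvg_bump].
- exact: integrableT_gauss.
- apply/aeW => t n _ /=.
  by rewrite lee_fin ger0_norm ?bump_ge0// bump_le_gauss.
- exact.
Qed.

(** All that the mollification argument uses of the profile b, of derivative
    b'. The Gaussian bound gives the constants, the compact support makes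
    products of b admissible as test functions, and the mass M close to that
    of the Gaussian keeps the final constant below one. *)
Record good_bump (b b' : R -> R) (L c M : R) : Prop := GoodBump {
  gb_ge0 : forall t, 0 <= b t ;
  gb_le : forall t, b t <= expR (- t ^+ 2) ;
  gb_out : forall t, L <= `|t| -> b t = 0 ;
  gb_derive : forall t, is_derive t 1 b (b' t) ;
  gb_cont : continuous b' ;
  gb_derive_le : forall t, `|b t + t * b' t| <= c * expR (- t ^+ 2) ;
  gb_smooth : forall s x, smooth1 (fun t => b (s * (x - t))) ;
  gb_smoothX : forall s x, smooth1 (fun t => s * (x - t) * b (s * (x - t))) ;
  gb_L : 0 < L ;
  gb_mass : (\int[mu]_t (b t)%:E = M%:E)%E ;
  gb_mass_ge : 49 / 50 * Num.sqrt pi <= M }.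

Lemma good_bump_continuous b b' L c M : good_bump b b' L c M -> continuous b.
Proof.
move=> gb t; have [d _] := gb_derive gb t.
by apply/differentiable_continuous/derivable1_diffP.
Qed.

Lemma measurable_good_bump b b' L c M : good_bump b b' L c M ->
  measurable_fun [set: measurableTypeR R] b.
Proof. by move=> gb; apply: continuous_measurable_fun; exact: (good_bump_continuous gb). Qed.

Lemma good_bump_mass_gt0 b b' L c M : good_bump b b' L c M -> 0 < M.
Proof.
move=> gb; apply: lt_le_trans (gb_mass_ge gb).
by rewrite mulr_gt0 ?sqrtr_gt0 ?pi_gt0//; lra.
Qed.

Lemma integral_bump_near : exists N M : R, [/\ 0 < N,
  (\int[mu]_t (bump N t)%:E = M%:E)%E & 49 / 50 * Num.sqrt pi <= M].
Proof.
have g0 : 0 < Num.sqrt pi :> R by rewrite sqrtr_gt0 pi_gt0.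
have lt : ((49 / 50 * Num.sqrt pi)%:E < (Num.sqrt pi)%:E :> \bar R)%E.
  by rewrite lte_fin gtr_pMl//; lra.
have H := @cvg_integral_bump.
have [n _ Hn] : \forall n \near \oo,
    ((49 / 50 * Num.sqrt pi)%:E < \int[mu]_t (bump n.+1%:R t)%:E)%E.
  exact: (H _ (open_ereal_gt' lt)).
have {Hn} := Hn n (leqnn _) => /= Hn.
have le : (\int[mu]_t (bump n.+1%:R t)%:E <= (Num.sqrt pi)%:E)%E.
  rewrite -(@integralT_gauss R); apply: le_integral_ge0.
    by move=> t _; rewrite lee_fin bump_ge0.
  by move=> t _; rewrite lee_fin bump_le_gauss.
exists n.+1%:R, (fine (\int[mu]_t (bump n.+1%:R t)%:E)).
have f : (\int[mu]_t (bump n.+1%:R t)%:E)%E \is a fin_num.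
  rewrite ge0_fin_numE ?(le_lt_trans le) ?ltry//.
  by apply: integral_ge0 => t _; rewrite lee_fin bump_ge0.
by split; [|rewrite fineK|rewrite -lee_fin fineK// ltW].
Qed.

(** The bound on (t b(t))' by a multiple of the Gaussian holds because the
    quotient is continuous with compact support, hence bounded. *)
Lemma exists_good_bump : exists b b' L c M, good_bump b b' L c M.
Proof.
have [N [M [N0 NM MN]]] := integral_bump_near.
have sb : smooth1 (bump N).
  have := smooth1_bumpQ N 1.
  by congr smooth1; apply/funext => t; rewrite hornerC mul1r.
have [b' sb' db'] := smooth1_derive sb.
have cb' := smooth1_continuous sb'.
(* With |t| >= N + 1 one has t^2 > N for all N > 0, also below 1. *)
pose L := N + 1.
have L0 : 0 < L by rewrite addr_gt0.
have LN (t : R) : L <= `|t| -> N < t ^+ 2.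
  move=> Lt; rewrite -real_normK ?num_real//.
  apply: (@lt_le_trans _ _ (L ^+ 2)); last by rewrite lerXn2r ?nnegrE// ltW.
  by rewrite /L; nra.
have b'0 (t : R) : L <= `|t| -> b' t = 0.
  move=> /LN Nt; rewrite -(@derive_val _ _ _ _ _ _ _ (db' t)).
  rewrite (@near_eq_derive _ _ _ _ (cst 0)) ?derive_cst//.
  have HN : \forall u \near t, N < u ^+ 2.
    have /cvgr_gt := @exprn_continuous R 2 t.
    by apply.
  by apply: filterS HN => u /ltW; exact: bump_out.
pose g (t : R) := `|bump N t + t * b' t| * expR (t ^+ 2).
have cg : continuous g.
  move=> t; apply: cvgM.
    apply: cvg_norm; apply: cvgD; first exact: continuous_bump.
    by apply: cvgM; [exact: cvg_id|exact: cb'].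
  apply: continuous_comp; [exact: sqr_continuous|exact: continuous_expR].
have LL : - L <= L by rewrite ge0_cp// ltW.
have [c _ gc] := @EVT_max R g _ _ LL (continuous_subspaceT cg).
exists (bump N), b', L, (g c), M; split => //.
- by move=> t; exact: bump_ge0.
- by move=> t; exact: bump_le_gauss.
- by move=> t /LN /ltW; exact: bump_out.
- move=> t; have [Lt|tL] := leP L `|t|.
    rewrite b'0// mulr0 addr0 (bump_out N0 (ltW (LN _ Lt))) normr0.
    by rewrite mulr_ge0 ?expR_ge0// mulr_ge0 ?expR_ge0.
  rewrite expRN ler_pdivlMr ?expR_gt0//.
  by apply: gc; rewrite in_itv /= -ler_norml ltW.
- move=> s x; have := smooth1_bump_affine N s x 1.
  by congr smooth1; apply/funext => t; rewrite hornerC mul1r.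
- move=> s x; have := smooth1_bump_affine N s x 'X.
  by congr smooth1; apply/funext => t; rewrite hornerX.
Qed.

End bump.

(** * Mollification represented by the gradient *)

Section integral_tools.
Local Open Scope ereal_scope.
Context d (T : measurableType d) {R : realType} (m : {measure set T -> \bar R}).

(** The integral is the difference of those of the positive and negative
    parts, each between 0 and int g. *)
Lemma abse_integral_le (D : set T) (f g : T -> \bar R) :
  (forall x, D x -> `|f x| <= g x) ->
  `|\int[m]_(x in D) f x| <= \int[m]_(x in D) g x.
Proof.
move=> fg; rewrite integralE.
have hp : \int[m]_(x in D) f^\+ x <= \int[m]_(x in D) g x.
  apply: le_integral_ge0 => // x Dx; apply: le_trans (fg x Dx).
  by rewrite funeposE ge_max abse_ge0 lee_abs.
have hn : \int[m]_(x in D) f^\- x <= \int[m]_(x in D) g x.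
  apply: le_integral_ge0 => // x Dx; apply: le_trans (fg x Dx).
  by rewrite funenegE ge_max abse_ge0 -abseN lee_abs.
have p0 : 0 <= \int[m]_(x in D) f^\+ x by exact: integral_ge0.
have n0 : 0 <= \int[m]_(x in D) f^\- x by exact: integral_ge0.
move: (\int[m]_(x in D) f^\+ x) (\int[m]_(x in D) f^\- x) (\int[m]_(x in D) g x) hp hn p0 n0.
move=> [a||] [e||] [i||] //; rewrite ?leey// !lee_fin /= => ha he a0 e0.
by rewrite ?lee_fin ler_norml; apply/andP; split; lra.
Qed.

End integral_tools.

Section fubini_on.
Local Open Scope ereal_scope.
Context d1 d2 (T1 : measurableType d1) (T2 : measurableType d2) {R : realType}.
Variables (m1 : {sigma_finite_measure set T1 -> \bar R})
          (m2 : {sigma_finite_measure set T2 -> \bar R}).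

(** As for [tonelli_on], the set D enters as an indicator. *)
Lemma fubini_on (D : set T2) (f : T1 -> T2 -> R) : measurable D ->
  measurable_fun setT (fun w => f w.1 w.2) ->
  \int[m1]_x \int[m2]_(y in D) (`|f x y|)%:E < +oo ->
  \int[m1]_x \int[m2]_(y in D) (f x y)%:E = \int[m2]_(y in D) \int[m1]_x (f x y)%:E.
Proof.
move=> mD mf foo.
pose g (w : T1 * T2) := (f w.1 w.2 * \1_D w.2)%:E.
have mg : measurable_fun setT g.
  apply/measurable_EFinP; apply: measurable_funM => //.
  by apply: measurableT_comp => //; exact: measurable_indic.
have gE x y : g (x, y) = ((fun y => (f x y)%:E) \_ D) y.
  rewrite /g /= patchE indicE; case: ifPn => yD; first by rewrite mulr1.
  by rewrite mulr0.
have ig : (m1 \x m2).-integrable setT g.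
  apply/integrable12ltyP => //; apply: le_lt_trans foo.
  apply: le_integral_ge0 => [x _|x _]; first exact: integral_ge0.
  rewrite [leRHS]integral_mkcond; apply: le_integral_ge0 => // y _.
  by rewrite gE !patchE; case: ifPn => //; rewrite abse0.
transitivity (\int[m1]_x \int[m2]_y g (x, y)).
  apply: eq_integral => x _; rewrite integral_mkcond.
  by apply: eq_integral => y _; rewrite gE.
rewrite (Fubini ig) [RHS]integral_mkcond.
apply: eq_integral => y _; rewrite patchE; case: ifPn => yD.
  by apply: eq_integral => x _; rewrite gE patchE yD.
by rewrite integral0_eq// => x _; rewrite gE patchE (negbTE yD).
Qed.

End fubini_on.

Section gaussian_domination.
Context {R : realType}.
Implicit Types (v phi : R3 R -> R).

(** The product is at most v^2 plus the square of the Gaussian. *)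
Lemma gauss_dominated v phi (C s : R) x : measurable_fun setT v ->
  measurable_fun setT phi ->
  integrable3 (fun z => v z ^+ 2) -> 0 < s ->
  (forall z, `|phi z| <= C * expR (- (s * dsq x z))) ->
  integrable3 (fun z => v z * phi z).
Proof.
move=> mv mphi iv s0 hphi.
have ig : vol3.-integrable setT (fun z => (C ^+ 2)%:E * (expR (- (2 * s * dsq x z)))%:E)%E.
  apply: integrableZl => //; apply/integrableP; split; first by meas.
  under eq_integral do rewrite gee0_abs ?lee_fin ?expR_ge0//.
  by rewrite integral_gauss3 ?mulr_gt0// ltry.
apply: (le_integrable measurableT _ _ (integrableD measurableT iv ig)).
  by apply/measurable_EFinP; exact: measurable_funM.
move=> z _; rewrite /= lee_fin.
rewrite [leRHS]ger0_norm; last by rewrite addr_ge0 ?sqr_ge0// mulr_ge0 ?sqr_ge0 ?expR_ge0.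
have -> : expR (- (2 * s * dsq x z)) = expR (- (s * dsq x z)) ^+ 2.
  by rewrite -expRM_natl; congr expR; ring.
rewrite normrM -exprMn -[v z ^+ 2]real_normK ?num_real//.
move: (hphi z); move: (`|v z|) (normr_ge0 (v z)) (`|phi z|) (normr_ge0 (phi z)).
move=> a a0 p p0; move: (C * _) => q pq.
have : 0 <= a * q by rewrite mulr_ge0// (le_trans p0).
by move: (sqr_ge0 (a - q)) (ler_wpM2l a0 pq); nra.
Qed.

End gaussian_domination.

Section representation.
Context {R : realType}.
Notation mu := (@lebesgue_measure R).
Variables (b b' : R -> R) (L c M : R).
Hypothesis gb : good_bump b b' L c M.
Variables (u : R3 R -> R) (G : 'I_3 -> R3 R -> R).
Hypothesis mu_ : measurable_fun setT u.
Hypothesis iu : integrable3 (fun z => u z ^+ 2).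
Hypothesis mG : forall i, measurable_fun setT (G i).
Hypothesis iG : forall i, integrable3 (fun z => G i z ^+ 2).
Hypothesis wp : forall i, weak_partial i u (G i).
Implicit Types (s t : R) (x z : R3 R).

Let b0 t : 0 <= b t. Proof. exact: (gb_ge0 gb). Qed.

Let cb : continuous b. Proof. exact: (good_bump_continuous gb). Qed.

Let mb : measurable_fun [set: measurableTypeR R] b.
Proof. exact: (measurable_good_bump gb). Qed.

Let mb' : measurable_fun [set: measurableTypeR R] b'.
Proof. by apply: continuous_measurable_fun; exact: (gb_cont gb). Qed.

Definition bump3 s x z : R :=
  b (s * (x.1.1 - z.1.1)) * b (s * (x.1.2 - z.1.2)) * b (s * (x.2 - z.2)).

Lemma bump3_ge0 s x z : 0 <= bump3 s x z.
Proof. by rewrite !mulr_ge0. Qed.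

Lemma gauss_split s x z : expR (- (s ^+ 2 * dsq x z)) =
  expR (- (s * (x.1.1 - z.1.1)) ^+ 2) * expR (- (s * (x.1.2 - z.1.2)) ^+ 2)
  * expR (- (s * (x.2 - z.2)) ^+ 2).
Proof. by rewrite -!expRD; congr expR; rewrite /dsq; ring. Qed.

Lemma bump3_le s x z : bump3 s x z <= expR (- (s ^+ 2 * dsq x z)).
Proof.
rewrite gauss_split; apply: ler_pM => //; first by rewrite mulr_ge0.
  by apply: ler_pM => //; exact: (gb_le gb).
exact: (gb_le gb).
Qed.

Lemma measurable_bump3 s x : measurable_fun setT (bump3 s x).
Proof.
by rewrite /bump3; apply: measurable_funM; [apply: measurable_funM|];
  apply: measurableT_comp => //; meas.
Qed.

(** Mollification at scale 1/s; the kernel has mass M^3, so the limit for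
    large s is M^3 u. *)
Definition moll s x : R := \int[vol3]_z (u z * (s ^+ 3 * bump3 s x z)).

Lemma moll_integrable s x : 0 < s ->
  integrable3 (fun z => u z * (s ^+ 3 * bump3 s x z)).
Proof.
move=> s0; apply: (@gauss_dominated _ _ _ (s ^+ 3) (s ^+ 2) x) => //.
- by apply: measurable_funM => //; exact: measurable_bump3.
- by rewrite exprn_gt0.
- move=> z; rewrite normrM ger0_norm ?exprn_ge0 ?(ltW s0)//.
  by rewrite ler_wpM2l ?exprn_ge0 ?(ltW s0)// ger0_norm ?bump3_ge0// bump3_le.
Qed.

Let beta t := b t + t * b' t.

Let coord (i : 'I_3) (x : R3 R) : R :=
  match val i with 0%N => x.1.1 | 1%N => x.1.2 | _ => x.2 end.

(** The product kernel with its i-th factor replaced by g. For g(t) = t b(t)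
    this is the i-th component of y times the kernel at y = s (x - z); for g =
    (t b)' it is a partial derivative of that component. *)
Let factor_at (g : R -> R) (i : 'I_3) s x z : R :=
  let h j := if i == j :> nat then g else b in
  h 0%N (s * (x.1.1 - z.1.1)) * h 1%N (s * (x.1.2 - z.1.2)) * h 2%N (s * (x.2 - z.2)).

Let xb t := t * b t.

Lemma is_derive_xb s r t :
  is_derive t 1 (fun t => s * (r - t) * b (s * (r - t))) (- s * beta (s * (r - t))).
Proof.
have da : is_derive t 1 (fun t => s * (r - t)) (- s).
  apply: is_derive_eq; rewrite /GRing.scale /=; ring.
have db := gb_derive gb (s * (r - t)).
have := is_deriveM da (@is_derive1_comp _ b (fun t => s * (r - t)) t _ _ db da).
move/is_derive_eq; apply; rewrite /GRing.scale /= /beta; ring.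
Qed.

Lemma is_derive_sb s r t :
  is_derive t 1 (fun t => b (s * (r - t))) (- s * b' (s * (r - t))).
Proof.
have da : is_derive t 1 (fun t => s * (r - t)) (- s).
  apply: is_derive_eq; rewrite /GRing.scale /=; ring.
have db := gb_derive gb (s * (r - t)).
have := @is_derive1_comp _ b (fun t => s * (r - t)) t _ _ db da.
by rewrite mulrC.
Qed.

Let der_xb s r t : derivable (fun t => s * (r - t) * b (s * (r - t))) t 1.
Proof. by have [] := is_derive_xb s r t. Qed.
Let der_sb s r t : derivable (fun t => b (s * (r - t))) t 1.
Proof. by have [] := is_derive_sb s r t. Qed.
Let derE_xb s r t : 'D_1 (fun t => s * (r - t) * b (s * (r - t))) t = - s * beta (s * (r - t)).
Proof. by have [] := is_derive_xb s r t. Qed.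

(** The components of y times the product kernel are admissible test
    functions, since t b(t) is smooth with compact support. *)
Lemma factor_at_test (i : 'I_3) s x : 0 < s -> test_function (factor_at xb i s x) /\
  forall z, partial i (factor_at xb i s x) z = - s * factor_at beta i s x z.
Proof.
move=> s0.
pose h r j := if i == j :> nat then fun t => s * (r - t) * b (s * (r - t))
              else fun t => b (s * (r - t)).
have E : factor_at xb i s x = prod3 (h x.1.1 0%N) (h x.1.2 1%N) (h x.2 2%N).
  by apply/funext => z; rewrite /factor_at /prod3 /h /xb; do 3 case: ifP => _.
have sh r j : smooth1 (h r j).
  by rewrite /h; case: ifP => _; [exact: (gb_smoothX gb)|exact: (gb_smooth gb)].
pose K := `|x.1.1| + `|x.1.2| + `|x.2| + L / s.
have out r j t : `|r| <= `|x.1.1| + `|x.1.2| + `|x.2| -> t \notin `[- K, K] -> h r j t = 0.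
  move=> rK; rewrite in_itv /= -ler_norml -ltNge => Kt.
  have Lt : L <= `|s * (r - t)|.
    rewrite normrM gtr0_norm// -ler_pdivrMl// mulrC.
    have := lerB_dist t r; rewrite distrC.
    by move: Kt; rewrite /K; lra.
  by rewrite /h; case: ifP => _; rewrite (gb_out gb)// mulr0.
rewrite E; split.
  apply: (@test_function_prod3 _ _ _ _ (- K) K) => // t; apply: out.
  - by rewrite -addrA lerDl addr_ge0.
  - by rewrite addrAC lerDr addr_ge0.
  - by rewrite lerDr addr_ge0.
have dh r j t : derivable (h r j) t 1 by rewrite /h; case: ifP.
move=> z; rewrite partial_prod3// /h /factor_at.
by case: i @h {E sh out dh} => -[|[|[|//]]] ilt h /=; rewrite derE_xb; ring.
Qed.

Lemma factor_atE g i s x z :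
  factor_at g i s x z = match val i with
  | 0%N => g (s * (x.1.1 - z.1.1)) * b (s * (x.1.2 - z.1.2)) * b (s * (x.2 - z.2))
  | 1%N => b (s * (x.1.1 - z.1.1)) * g (s * (x.1.2 - z.1.2)) * b (s * (x.2 - z.2))
  | _ => b (s * (x.1.1 - z.1.1)) * b (s * (x.1.2 - z.1.2)) * g (s * (x.2 - z.2))
  end.
Proof. by case: i => -[|[|[|//]]] ilt. Qed.

Lemma factor_at_xbE i s x z :
  factor_at xb i s x z = s * (coord i x - coord i z) * bump3 s x z.
Proof.
by rewrite factor_atE /bump3 /coord /xb; case: i => -[|[|[|//]]] ilt /=; ring.
Qed.

Lemma measurable_factor_at (g : R -> R) i s x :
  measurable_fun [set: measurableTypeR R] g ->
  measurable_fun setT (factor_at g i s x).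
Proof.
move=> mg; rewrite /factor_at; case: i => -[|[|[|//]]] ilt /=;
  (apply: measurable_funM; [apply: measurable_funM|]);
  by apply: measurableT_comp => //; meas.
Qed.

Let mbeta : measurable_fun [set: measurableTypeR R] beta.
Proof. by apply: measurable_funD => //; exact: measurable_funM. Qed.

Let mxb : measurable_fun [set: measurableTypeR R] xb.
Proof. exact: measurable_funM. Qed.

Let c0 : 0 <= c.
Proof.
have := gb_derive_le gb 0; rewrite expr0n oppr0 expR0 mulr1; exact: le_trans.
Qed.

Lemma factor_at_beta_le i s x z :
  `|factor_at beta i s x z| <= c * expR (- (s ^+ 2 * dsq x z)).
Proof.
have hb t : `|b t| <= expR (- t ^+ 2) by rewrite ger0_norm ?b0 ?(gb_le gb).
have hbeta t : `|beta t| <= c * expR (- t ^+ 2) := gb_derive_le gb t.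
have prod_le (a1 a2 a3 p1 p2 p3 : R) : 0 <= a1 -> 0 <= a2 -> 0 <= a3 ->
    a1 <= p1 -> a2 <= p2 -> a3 <= p3 -> a1 * a2 * a3 <= p1 * p2 * p3.
  move=> *; apply: ler_pM => //; first by rewrite mulr_ge0.
  exact: ler_pM.
rewrite factor_atE gauss_split.
case: i => -[|[|[|//]]] ilt /=; rewrite !normrM.
- by rewrite !mulrA; apply: prod_le.
- rewrite [leRHS](_ : _ = expR (- (s * (x.1.1 - z.1.1)) ^+ 2)
    * (c * expR (- (s * (x.1.2 - z.1.2)) ^+ 2)) * expR (- (s * (x.2 - z.2)) ^+ 2));
    last by ring.
  exact: prod_le.
- rewrite [leRHS]mulrCA; exact: prod_le.
Qed.

Lemma coord_le i x z : (coord i x - coord i z) ^+ 2 <= dsq x z.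
Proof.
rewrite /coord /dsq; case: i => -[|[|[|//]]] ilt /=.
- by rewrite -addrA lerDl addr_ge0 ?sqr_ge0.
- by rewrite addrAC lerDr addr_ge0 ?sqr_ge0.
- by rewrite lerDr addr_ge0 ?sqr_ge0.
Qed.

(** Square both sides and use 1 + y <= e^y at y = t^2 - 1. *)
Lemma norm_le_expR t : `|t| <= expR (- 2^-1) * expR (t ^+ 2 / 2).
Proof.
have t0 : 0 <= `|t| by [].
rewrite -expRD.
rewrite -(@ler_pXn2r _ 2) ?nnegrE ?expR_ge0// real_normK ?num_real//.
rewrite -expRM_natl; apply: le_trans (expR_ge1Dx _).
by rewrite le_eqVlt; apply/orP; left; apply/eqP; field.
Qed.

(** The supremum of |t| exp(-t^2/2) is exp(-1/2); half of the Gaussian is kept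
    for the integration over scales. *)
Lemma norm_gauss_le t : `|t| * expR (- t ^+ 2) <= expR (- 2^-1) * expR (- (t ^+ 2 / 2)).
Proof.
apply: (le_trans (ler_wpM2r (expR_ge0 _) (norm_le_expR t))).
by rewrite -mulrA ler_wpM2l ?expR_ge0// -expRD ler_expR; lra.
Qed.

Lemma expR_half_le1 : expR (- 2^-1) <= 1 :> R.
Proof. by rewrite -[leRHS]expR0 ler_expR; lra. Qed.

Lemma factor_at_xb_le i s x z :
  `|factor_at xb i s x z| <= 1 * expR (- (s ^+ 2 / 2 * dsq x z)).
Proof.
rewrite factor_at_xbE normrM [`|bump3 _ _ _|]ger0_norm ?bump3_ge0// mul1r.
apply: (le_trans (ler_wpM2l (normr_ge0 _) (bump3_le _ _ _))).
apply: (le_trans (ler_wpM2r (expR_ge0 _) (norm_le_expR _))).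
apply: (@le_trans _ _ (1 * expR ((s * (coord i x - coord i z)) ^+ 2 / 2)
    * expR (- (s ^+ 2 * dsq x z)))).
  by rewrite ler_wpM2r ?expR_ge0// ler_wpM2r ?expR_ge0// expR_half_le1.
rewrite mul1r -expRD ler_expR exprMn.
have := ler_wpM2l (sqr_ge0 s) (coord_le i x z); lra.
Qed.

(** The definition of the weak derivative for the test function of
    [factor_at_test]. *)
Lemma weak_factor_at i s x : 0 < s ->
  \int[vol3]_z (u z * (s ^+ 2 * factor_at beta i s x z))
  = \int[vol3]_z (s * (G i z * factor_at xb i s x z)).
Proof.
move=> s0; have [tf pE] := factor_at_test i x s0.
have := wp i tf.
have i1 : integrable3 (fun z => u z * factor_at beta i s x z).
  apply: (@gauss_dominated _ _ _ c (s ^+ 2) x) => //.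
  - exact: measurable_factor_at.
  - by rewrite exprn_gt0.
  - exact: factor_at_beta_le.
have i2 : integrable3 (fun z => G i z * factor_at xb i s x z).
  apply: (@gauss_dominated _ _ _ 1 (s ^+ 2 / 2) x) => //.
  - exact: measurable_factor_at.
  - by rewrite divr_gt0// exprn_gt0.
  - exact: factor_at_xb_le.
have -> : \int[lebesgue3 R]_z (u z * partial i (factor_at xb i s x) z)
    = - s * \int[vol3]_z (u z * factor_at beta i s x z).
  rewrite -(RintegralZl _ measurableT i1).
  by apply: eq_Rintegral => z _; rewrite pE mulrCA.
rewrite mulNr => /oppr_inj E.
rewrite (RintegralZl s measurableT i2).
rewrite -[X in s * X]E mulrA -expr2 -(RintegralZl _ measurableT i1).
by apply: eq_Rintegral => z _; rewrite mulrCA.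
Qed.

Let i0 : 'I_3 := Ordinal (isT : (0 < 3)%N).
Let i1 : 'I_3 := Ordinal (isT : (1 < 3)%N).
Let i2 : 'I_3 := Ordinal (isT : (2 < 3)%N).

(** Equal to s^2 times the divergence of y times the kernel at y = s (x - z),
    so that a derivative in the scale becomes a weak derivative of u. *)
Let dbump3 s x z : R :=
  s ^+ 2 * factor_at beta i0 s x z + s ^+ 2 * factor_at beta i1 s x z + s ^+ 2 * factor_at beta i2 s x z.

Lemma is_derive_bump3 x z s :
  is_derive s 1 (fun s => s ^+ 3 * bump3 s x z) (dbump3 s x z).
Proof.
have dl a : is_derive s 1 (fun s => b (s * a)) (b' (s * a) * a).
  have da : is_derive s 1 (fun s : R => s * a) a.
    by apply: is_derive_eq; rewrite /GRing.scale /=; ring.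
  exact: (@is_derive1_comp _ b (fun s => s * a) s _ _ (gb_derive gb (s * a)) da).
have d3 : is_derive s 1 (fun s : R => s ^+ 3) (3 * s ^+ 2).
  by apply: is_derive_eq; rewrite /GRing.scale /=; ring.
have := is_deriveM d3 (is_deriveM (is_deriveM (dl (x.1.1 - z.1.1)) (dl (x.1.2 - z.1.2)))
   (dl (x.2 - z.2))).
move/is_derive_eq; apply; rewrite !fctE /GRing.scale /= /dbump3 !factor_atE /beta /=; ring.
Qed.

Let cbeta : continuous beta.
Proof.
move=> t; apply: cvgD; first exact: cb.
by apply: cvgM; [exact: cvg_id|exact: (gb_cont gb)].
Qed.

Lemma continuous_dbump3 x z : continuous (fun s => dbump3 s x z).
Proof.
move=> s.
have cl (g : R -> R) a : continuous g -> {for s, continuous (fun s => g (s * a))}.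
  move=> cg; apply: continuous_comp; last exact: cg.
  by apply: cvgM; [exact: cvg_id|exact: cvg_cst].
have ce i : {for s, continuous (fun s => factor_at beta i s x z)}.
  rewrite /factor_at; case: i => -[|[|[|//]]] ilt /=;
   by apply: cvgM; [apply: cvgM|]; apply: cl; try exact: cb; exact: cbeta.
by apply: cvgD; [apply: cvgD|]; apply: cvgM; try exact: exprn_continuous; exact: ce.
Qed.

Lemma integral_dbump3 r x z (sg S : R) : sg < S ->
  (\int[mu]_(s in `[sg, S]) (r * dbump3 s x z)%:E =
   (r * (S ^+ 3 * bump3 S x z) - r * (sg ^+ 3 * bump3 sg x z))%:E)%E.
Proof.
move=> sS.
have dF s : is_derive s 1 (fun s => r * (s ^+ 3 * bump3 s x z)) (r * dbump3 s x z).
  have := is_deriveZ r (is_derive_bump3 x z s); exact.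
have dF' s : derivable (fun s => r * (s ^+ 3 * bump3 s x z)) s 1 by have [] := dF s.
rewrite (@continuous_FTC2 _ (fun s => r * dbump3 s x z) (fun s => r * (s ^+ 3 * bump3 s x z)))//.
- apply: continuous_subspaceT => s; apply: cvgM; first exact: cvg_cst.
  exact: continuous_dbump3.
- have cF s : {for s, continuous (fun s => r * (s ^+ 3 * bump3 s x z))}.
    by apply/differentiable_continuous/derivable1_diffP.
  by split => [s _||]; [exact: dF'|apply: cvg_at_right_filter; exact: cF|
    apply: cvg_at_left_filter; exact: cF].
- by move=> s _; rewrite derive1E; have [_ ->] := dF s.
Qed.

Definition grad_norm z : R := Num.sqrt (G i0 z ^+ 2 + G i1 z ^+ 2 + G i2 z ^+ 2).

(** A majorant of the derivative of the mollification in s, whose integral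
    over all scales is the kernel of [potential]. *)
Let Hker x s z : R := grad_norm z * (expR (- 2^-1) * (`|s| * expR (- (s ^+ 2 * (dsq x z / 2))))).

Lemma grad_norm_ge0 z : 0 <= grad_norm z. Proof. exact: sqrtr_ge0. Qed.

Let hG_ge0 := grad_norm_ge0.

Let Hker_ge0 x s z : 0 <= Hker x s z.
Proof. by rewrite /Hker; pos. Qed.

Lemma measurable_grad_norm : measurable_fun setT grad_norm.
Proof.
apply: measurable_fun_sqrt; apply: measurable_funD; first apply: measurable_funD;
  by apply: measurable_funX; exact: mG.
Qed.

Let mhG := measurable_grad_norm.

(** Lagrange's identity. *)
Lemma cauchy_schwarz3 (a1 a2 a3 d1 d2 d3 : R) :
  `|a1 * d1 + a2 * d2 + a3 * d3| <=
  Num.sqrt (a1 ^+ 2 + a2 ^+ 2 + a3 ^+ 2) * Num.sqrt (d1 ^+ 2 + d2 ^+ 2 + d3 ^+ 2).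
Proof.
have A0 : 0 <= a1 ^+ 2 + a2 ^+ 2 + a3 ^+ 2 by pos.
rewrite -sqrtrM// -sqrtr_sqr ler_wsqrtr// -subr_ge0.
rewrite [leRHS](_ : _ = (a1 * d2 - a2 * d1) ^+ 2 + (a1 * d3 - a3 * d1) ^+ 2 +
  (a2 * d3 - a3 * d2) ^+ 2); first by pos.
by ring.
Qed.

Let gsum s x z : R := s * (G i0 z * factor_at xb i0 s x z) + s * (G i1 z * factor_at xb i1 s x z)
  + s * (G i2 z * factor_at xb i2 s x z).

Lemma gsum_le s x z : 0 < s -> `|gsum s x z| <= Hker x s z.
Proof.
move=> s0; rewrite /gsum !factor_at_xbE /coord /=.
have -> : s * (G i0 z * (s * (x.1.1 - z.1.1) * bump3 s x z)) +
    s * (G i1 z * (s * (x.1.2 - z.1.2) * bump3 s x z)) +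
    s * (G i2 z * (s * (x.2 - z.2) * bump3 s x z)) =
   (G i0 z * (x.1.1 - z.1.1) + G i1 z * (x.1.2 - z.1.2) + G i2 z * (x.2 - z.2))
   * (s * (s * bump3 s x z)) by ring.
rewrite normrM [`|s * _|]ger0_norm; last first.
  by rewrite !mulr_ge0 ?bump3_ge0 ?(ltW s0).
apply: (@le_trans _ _ ((grad_norm z * Num.sqrt (dsq x z)) * (s * (s * expR (- (s ^+ 2 * dsq x z)))))).
  apply: ler_pM => //.
  - by rewrite !mulr_ge0 ?bump3_ge0 ?(ltW s0).
  - exact: cauchy_schwarz3.
  - by rewrite !ler_wpM2l ?(ltW s0)// bump3_le.
rewrite /Hker (gtr0_norm s0).
have := norm_gauss_le (s * Num.sqrt (dsq x z)).
rewrite exprMn sqr_sqrtr ?dsq_ge0// ger0_norm ?mulr_ge0 ?sqrtr_ge0 ?(ltW s0)//.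
move=> H.
rewrite [leLHS](_ : _ = grad_norm z * (s * (s * Num.sqrt (dsq x z) * expR (- (s ^+ 2 * dsq x z)))));
  last by ring.
rewrite ler_wpM2l// [leRHS]mulrCA ler_wpM2l ?(ltW s0)//.
by apply: (le_trans H); rewrite mulrA.
Qed.

Lemma integrable_u_factor_at i s x : 0 < s ->
  integrable3 (fun z => u z * (s ^+ 2 * factor_at beta i s x z)).
Proof.
move=> s0; apply: (@gauss_dominated _ _ _ (s ^+ 2 * c) (s ^+ 2) x) => //.
- by apply: measurable_funM => //; exact: measurable_factor_at.
- by rewrite exprn_gt0.
- move=> z; rewrite normrM ger0_norm ?sqr_ge0// -mulrA ler_wpM2l ?sqr_ge0//.
  exact: factor_at_beta_le.
Qed.

Lemma integrable_G_factor_at i s x : 0 < s ->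
  integrable3 (fun z => s * (G i z * factor_at xb i s x z)).
Proof.
move=> s0.
have h : integrable3 (fun z => G i z * factor_at xb i s x z).
  apply: (@gauss_dominated _ _ _ 1 (s ^+ 2 / 2) x) => //.
  - exact: measurable_factor_at.
  - by rewrite divr_gt0// exprn_gt0.
  - exact: factor_at_xb_le.
exact: (integrableZl measurableT s h).
Qed.

Lemma integral3 (f g k f' g' k' : R3 R -> R) :
  integrable3 f -> integrable3 g ->
  integrable3 k ->
  integrable3 f' -> integrable3 g' ->
  integrable3 k' ->
  \int[vol3]_z f z = \int[vol3]_z f' z -> \int[vol3]_z g z = \int[vol3]_z g' z ->
  \int[vol3]_z k z = \int[vol3]_z k' z ->
  (\int[vol3]_z (f z + g z + k z)%:E = \int[vol3]_z (f' z + g' z + k' z)%:E)%E.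
Proof.
move=> If Ig Ik If' Ig' Ik' E1 E2 E3.
have RE (h : R3 R -> R) : integrable3 h ->
    (\int[vol3]_z (h z)%:E = (\int[vol3]_z h z)%:E)%E.
  by move=> ih; rewrite /Rintegral fineK//; exact: (integrable_fin_num measurableT ih).
have sum3 (h1 h2 h3 : R3 R -> R) : integrable3 h1 ->
    integrable3 h2 -> integrable3 h3 ->
   (\int[vol3]_z (h1 z + h2 z + h3 z)%:E = \int[vol3]_z (h1 z)%:E + \int[vol3]_z (h2 z)%:E
     + \int[vol3]_z (h3 z)%:E)%E.
  move=> j1 j2 j3.
  rewrite (@integralD _ _ _ vol3 setT measurableT (fun z => (h1 z + h2 z)%:E)
     (fun z => (h3 z)%:E))//; last exact: (integrableD measurableT j1 j2).
  by rewrite (@integralD _ _ _ vol3 setT measurableT (fun z => (h1 z)%:E)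
     (fun z => (h2 z)%:E)).
by rewrite !sum3// !RE// E1 E2 E3.
Qed.

Lemma weak_dbump3 s x : 0 < s ->
  (\int[vol3]_z (u z * dbump3 s x z)%:E = \int[vol3]_z (gsum s x z)%:E)%E.
Proof.
move=> s0; rewrite /dbump3 /gsum.
under eq_integral do rewrite !mulrDr.
apply: integral3; try exact: integrable_u_factor_at; try exact: integrable_G_factor_at;
  exact: weak_factor_at.
Qed.

Lemma dbump3_le (sg S s : R) x z : 0 < sg -> sg <= s -> s <= S ->
  `|dbump3 s x z| <= 3 * S ^+ 2 * c * expR (- (sg ^+ 2 * dsq x z)).
Proof.
move=> sg0 sgs sS; have s0 : 0 < s := lt_le_trans sg0 sgs.
have one i : `|s ^+ 2 * factor_at beta i s x z| <= S ^+ 2 * (c * expR (- (sg ^+ 2 * dsq x z))).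
  rewrite normrM ger0_norm ?sqr_ge0//; apply: ler_pM => //; first exact: sqr_ge0.
    by rewrite lerXn2r ?nnegrE ?(ltW s0)// (le_trans (ltW s0)).
  apply: (le_trans (factor_at_beta_le _ _ _ _)); rewrite ler_wpM2l// ler_expR lerN2.
  by rewrite ler_wpM2r ?dsq_ge0// lerXn2r ?nnegrE ?(ltW s0) ?(ltW sg0).
rewrite /dbump3; apply: (le_trans (ler_normD _ _)).
apply: (le_trans (lerD (ler_normD _ _) (lexx _))).
have := one i0; have := one i1; have := one i2.
move: (`|_ * factor_at beta i0 s x z|) (`|_ * factor_at beta i1 s x z|) (`|_ * factor_at beta i2 s x z|).
by move=> n0 n1 n2; rewrite -!mulrA; lra.
Qed.

Let A : \bar R := (\int[vol3]_z (u z ^+ 2)%:E)%E.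

Let A_fin : (A < +oo)%E.
Proof.
have /integrableP[_] := iu.
by under eq_integral do rewrite /= ger0_norm ?sqr_ge0//.
Qed.

Lemma measurable_u_dbump3 x :
  measurable_fun setT (fun w : R3 R * measurableTypeR R => u w.1 * dbump3 w.2 x w.1).
Proof.
have me i : measurable_fun setT
    (fun w : R3 R * measurableTypeR R => factor_at beta i w.2 x w.1).
  rewrite /factor_at; case: i => -[|[|[|//]]] ilt /=;
  (apply: measurable_funM; [apply: measurable_funM|]);
  by apply: measurableT_comp => //; meas.
apply: measurable_funM; first by apply: measurableT_comp => //; exact: measurable_fst.
by rewrite /dbump3; apply: measurable_funD; [apply: measurable_funD|];
  apply: measurable_funM => //; apply: measurable_funX; exact: measurable_snd.
Qed.

(** Integrate the derivative in the scale, and exchange the integrals. *)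
Lemma moll_diff (sg S : R) x : 0 < sg -> sg < S ->
  ((moll S x - moll sg x)%:E =
   \int[mu]_(s in `[sg, S]) \int[vol3]_z (u z * dbump3 s x z)%:E)%E.
Proof.
move=> sg0 sS; have S0 := lt_trans sg0 sS.
rewrite -fubini_on //; last 2 first.
- exact: measurable_u_dbump3.
- have [C CE] : exists C : R, C = 3 * S ^+ 2 * c by exists (3 * S ^+ 2 * c).
  pose g z := u z ^+ 2 + C ^+ 2 * expR (- (2 * sg ^+ 2 * dsq x z)).
  have g0 z : 0 <= g z by rewrite addr_ge0 ?sqr_ge0// mulr_ge0 ?sqr_ge0 ?expR_ge0.
  have ig : integrable3 g.
    have ie : integrable3 (fun z => expR (- (2 * sg ^+ 2 * dsq x z))).
      apply/integrableP; split; first by apply/measurable_EFinP; meas.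
      under eq_integral do rewrite /= ger0_norm ?expR_ge0//.
      by rewrite integral_gauss3 ?ltry// mulr_gt0// exprn_gt0.
    exact: (integrableD measurableT iu (integrableZl measurableT (C ^+ 2) ie)).
  apply: (@le_lt_trans _ _ (\int[vol3]_z \int[mu]_(s in `[sg, S]) (g z)%:E)%E).
    apply: le_integral_ge0; first by move=> z _; exact: integral_ge0.
    move=> z _; apply: le_integral_ge0 => // s; rewrite /= in_itv /= => /andP[sgs sS'].
    rewrite lee_fin normrM.
    have := dbump3_le x z sg0 sgs sS'; rewrite -CE => dl.
    have -> : g z = `|u z| ^+ 2 + (C * expR (- (sg ^+ 2 * dsq x z))) ^+ 2.
      have eE : expR (- (2 * sg ^+ 2 * dsq x z)) = expR (- (sg ^+ 2 * dsq x z)) ^+ 2.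
        by rewrite -expRM_natl; congr expR; ring.
      by rewrite /g eE real_normK ?num_real// exprMn.
    move: (`|u z|) (normr_ge0 (u z)) (`|dbump3 s x z|) (normr_ge0 (dbump3 s x z)) dl => a a0 p p0.
    move: (C * _) => q pq.
    have : 0 <= a * q by rewrite mulr_ge0// (le_trans p0).
    by move: (sqr_ge0 (a - q)) (ler_wpM2l a0 pq); nra.
  under eq_integral => z _.
    rewrite integral_cst//= lebesgue_measure_itv /= lte_fin sS -EFinB.
    over.
  rewrite /= ge0_integralZr//; last 3 first.
  + by rewrite /g; meas.
  + by move=> z _; rewrite lee_fin.
  + by rewrite lee_fin subr_ge0 ltW.
  rewrite lte_mul_pinfty ?ltry//.
  + by apply: integral_ge0 => z _; rewrite lee_fin.
  + exact: (integrable_fin_num measurableT ig).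
have is1 := moll_integrable x S0; have is2 := moll_integrable x sg0.
rewrite /moll EFinB.
rewrite [in LHS]/Rintegral !fineK; last 2 first.
- exact: (integrable_fin_num measurableT is2).
- exact: (integrable_fin_num measurableT is1).
rewrite -(@integralB _ _ _ vol3 setT measurableT _ _ is1 is2).
by apply: eq_integral => z _; rewrite integral_dbump3.
Qed.

(** The potential of |grad u| with kernel |x - z|^(-2); the factor comes from
    [norm_gauss_le]. *)
Definition potential x : \bar R := (\int[vol3]_z (grad_norm z * expR (- 2^-1) / dsq x z)%:E)%E.

Lemma potential_ge0 x : (0 <= potential x)%E.
Proof.
apply: integral_ge0 => z _.
by rewrite lee_fin !mulr_ge0 ?invr_ge0 ?dsq_ge0 ?grad_norm_ge0 ?expR_ge0.
Qed.

Lemma measurable_potential : measurable_fun setT potential.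
Proof.
apply: (@measurable_integral_on _ _ _ _ _ vol3 setT
  (fun x z => (grad_norm z * expR (- 2^-1) / dsq x z)%:E)) => //.
  apply/measurable_EFinP; apply: measurable_funM; first apply: measurable_funM.
  - exact: (measurableT_comp mhG measurable_snd).
  - exact: measurable_cst.
  - by apply: measurable_funV; apply: measurable_fun_dsq;
      [exact: measurable_fst|exact: measurable_snd].
by move=> x z; rewrite lee_fin !mulr_ge0 ?invr_ge0 ?dsq_ge0 ?grad_norm_ge0 ?expR_ge0.
Qed.

(** After the weak derivative has been used, the integral over the scales can
    be done for fixed z: int s exp(-s^2 r^2 / 2) ds = r^(-2). *)
Lemma potential_bound (sg S : R) x : 0 < sg -> sg < S ->
  (`|(moll S x - moll sg x)%:E| <= potential x)%E.
Proof.
move=> sg0 sS; rewrite moll_diff//.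
apply: (@le_trans _ _ (\int[mu]_(s in `[sg, S]) \int[vol3]_z (Hker x s z)%:E)%E).
  apply: abse_integral_le => s; rewrite /= in_itv /= => /andP[sgs _].
  have s0 := lt_le_trans sg0 sgs.
  rewrite weak_dbump3//; apply: abse_integral_le => z _.
  by rewrite lee_fin gsum_le.
rewrite -(@tonelli_on _ _ _ _ _ vol3 mu _ (fun z s => (Hker x s z)%:E))//; last 2 first.
- by rewrite /Hker; meas.
- by move=> z s; rewrite lee_fin.
apply: ae_ge0_le_integral => //.
- by move=> z _; apply: integral_ge0 => s _; rewrite lee_fin.
- apply: measurable_integral_on => //.
    by rewrite /Hker; meas.
  by move=> z s; rewrite lee_fin.
- by move=> z _; rewrite lee_fin; pos.
- by meas.
apply: filterS (ae_neq x) => z xz _; have d0 := dsq_gt0 xz.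
have hz := hG_ge0 z.
under eq_integral do rewrite /Hker EFinM.
rewrite ge0_integralZl; [|side..].
rewrite -mulrA EFinM lee_wpmul2l ?lee_fin//.
under eq_integral do rewrite EFinM.
rewrite ge0_integralZl; [|side..].
rewrite EFinM lee_wpmul2l ?lee_fin ?expR_ge0//.
apply: (@le_trans _ _ (\int[mu]_(s in `[0%R, +oo[) (2^-1 *
   (2 * s * expR (- (s ^+ 2 * (dsq x z / 2)))))%:E)%E).
  rewrite [leRHS](_ : _ = \int[mu]_(s in `[0%R, +oo[) ((`|s| * expR (- (s ^+ 2 * (dsq x z / 2)))))%:E)%E;
    last first.
    apply: eq_integral => s; rewrite inE /= in_itv /= andbT => s0.
    by rewrite ger0_norm//; congr (_%:E); field.
  apply: ge0_subset_integral => //.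
  - by apply: measurable_funTS; meas.
  - move=> s; rewrite /= !in_itv /= andbT => /andP[+ _].
    exact: (le_trans (ltW sg0)).
under eq_integral do rewrite EFinM.
rewrite ge0_integralZl//; last 2 first.
- by apply: measurable_funTS; meas.
- by move=> s; rewrite /= in_itv /= andbT => s0; pos.
rewrite integral_half_sqrexp ?divr_gt0// -EFinM lee_fin.
by rewrite le_eqVlt; apply/orP; left; apply/eqP; field; rewrite gt_eqF.
Qed.

Let a2 : R := fine A.

Let A_E : A = a2%:E.
Proof.
rewrite /a2 fineK// ge0_fin_numE//.
by apply: integral_ge0 => z _; rewrite lee_fin sqr_ge0.
Qed.

Let gauss3K (s : R) x : 0 < s ->
  (\int[vol3]_z (s ^+ 3 * expR (- (s ^+ 2 * dsq x z)))%:E = (Num.sqrt pi ^+ 3)%:E)%E.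
Proof.
move=> s0; under eq_integral do rewrite EFinM.
rewrite ge0_integralZl; [|side..].
rewrite integral_gauss3 ?exprn_gt0// -EFinM sqrtr_sqr gtr0_norm//; congr (_%:E).
by field; rewrite gt_eqF.
Qed.

(** Young's inequality with weight s: as s tends to 0 both terms vanish. *)
Lemma moll_small (s : R) x : 0 < s ->
  `|moll s x| <= s * a2 + s ^+ 2 * (Num.sqrt pi / Num.sqrt 2) ^+ 3.
Proof.
move=> s0.
have is1 := moll_integrable x s0.
rewrite -lee_fin.
have -> : (`|moll s x|%:E = `|\int[vol3]_z (u z * (s ^+ 3 * bump3 s x z))%:E|)%E.
  by rewrite -[in RHS](fineK (integrable_fin_num measurableT is1)).
apply: (@le_trans _ _ (\int[vol3]_z (s%:E * (u z ^+ 2)%:E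
    + (s ^+ 5)%:E * (expR (- (2 * s ^+ 2 * dsq x z)))%:E))%E).
  apply: abse_integral_le => z _; rewrite -!EFinM -EFinD abse_EFin lee_fin.
  rewrite normrM [`|s ^+ 3 * _|]ger0_norm; last first.
    by apply: mulr_ge0; [pos|exact: bump3_ge0].
  have -> : expR (- (2 * s ^+ 2 * dsq x z)) = expR (- (s ^+ 2 * dsq x z)) ^+ 2.
    by rewrite -expRM_natl; congr expR; ring.
  have := bump3_le s x z; have := bump3_ge0 s x z.
  rewrite -[u z ^+ 2]real_normK ?num_real//.
  move: (`|u z|) (normr_ge0 (u z)) (bump3 s x z) (expR _) => a aa0 p q p0 pq.
  apply: (@le_trans _ _ (a * (s ^+ 3 * q))).
    by rewrite ler_wpM2l// ler_wpM2l//; pos.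
  have q0 := le_trans p0 pq.
  have h1 : 0 <= s * (a - s ^+ 2 * q) ^+ 2 by rewrite mulr_ge0 ?sqr_ge0// ltW.
  have h2 : 0 <= a * (s ^+ 3 * q) by pos.
  rewrite -subr_ge0.
  rewrite [leRHS](_ : _ = s * (a - s ^+ 2 * q) ^+ 2 + a * (s ^+ 3 * q)); last by ring.
  exact: addr_ge0.
rewrite ge0_integralD; last 5 first.
- exact: measurableT.
- by move=> z _; rewrite -EFinM; pos.
- by meas.
- by move=> z _; rewrite -EFinM; pos.
- by meas.
rewrite ge0_integralZl; [|side..].
rewrite ge0_integralZl; [|side..].
rewrite -/A A_E integral_gauss3 ?mulr_gt0 ?exprn_gt0// -!EFinM -EFinD lee_fin.
rewrite lerD2l le_eqVlt; apply/orP; left; apply/eqP.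
have s2 : Num.sqrt 2 != 0 :> R by rewrite gt_eqF// sqrtr_gt0.
rewrite sqrtrM// sqrtr_sqr gtr0_norm//; field; rewrite s2 gt_eqF//.
Qed.

(** Let the smaller scale in [potential_bound] tend to 0: mollifications at
    large scale vanish by [moll_small]. *)
Lemma moll_le (S : R) x : 0 < S -> (`|moll S x|%:E <= potential x)%E.
Proof.
move=> S0.
have [->|Pfin] := eqVneq (potential x) +oo%E; first by rewrite leey.
have P0 : (0 <= potential x)%E.
  by apply: integral_ge0 => z _; have := hG_ge0 z => hz; pos.
have Pf : potential x \is a fin_num by rewrite ge0_fin_numE// ltey.
rewrite -(fineK Pf) lee_fin; apply/ler_addgt0Pr => e e0.
pose k : R := (Num.sqrt pi / Num.sqrt 2) ^+ 3.
have k0 : 0 <= k by rewrite /k; apply: exprn_ge0; apply: divr_ge0; apply: sqrtr_ge0.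
have a20 : 0 <= a2.
  by apply: fine_ge0; apply: integral_ge0 => z _; rewrite lee_fin sqr_ge0.
pose D := a2 + k + 1.
have D0 : 0 < D by rewrite /D; lra.
pose sg := Num.min (S / 2) (Num.min 1 (e / D)).
have sg0 : 0 < sg by rewrite !lt_min divr_gt0// ltr01 divr_gt0.
have sgS : sg < S.
  apply: (@le_lt_trans _ _ (S / 2)); first by rewrite ge_min lexx.
  by rewrite ltr_pdivrMr// ltr_pMr// ltr1n.
have sg1 : sg <= 1 by rewrite ge_min ge_min lexx orbT.
have sge : sg * D <= e.
  by rewrite -ler_pdivlMr// /sg !ge_min lexx !orbT.
have h1 := potential_bound x sg0 sgS.
rewrite -(fineK Pf) abse_EFin lee_fin in h1.
have h2 := moll_small x sg0.
have h3 : `|moll S x| <= `|moll S x - moll sg x| + `|moll sg x|.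
  by have := ler_normD (moll S x - moll sg x) (moll sg x); rewrite subrK.
apply: (le_trans h3); apply: lerD => //.
apply: (le_trans h2); apply: le_trans sge; rewrite /D -/k.
have : sg ^+ 2 * k <= sg * k.
  by rewrite ler_wpM2r// expr2 ger_pMr.
rewrite !mulrDr mulr1; move: (ltW sg0); lra.
Qed.

Lemma measurable_moll (S : R) : 0 < S -> measurable_fun setT (moll S).
Proof.
move=> S0.
have mf : measurable_fun setT
   (fun w : R3 R * R3 R => (u w.2 * (S ^+ 3 * bump3 S w.1 w.2))%:E).
  apply/measurable_EFinP; apply: measurable_funM.
    by meas.
  apply: measurable_funM => //; rewrite /bump3.
  apply: measurable_funM; [apply: measurable_funM|];
  by apply: measurableT_comp => //; meas.
pose f x z : \bar R := (u z * (S ^+ 3 * bump3 S x z))%:E.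
have mp : measurable_fun setT (fun x => \int[vol3]_z (f x)^\+ z)%E.
  apply: (@measurable_integral_on _ _ _ _ _ vol3 setT (fun x z => (f x)^\+ z)%E).
  - exact: measurableT.
  - apply: (@eq_measurable_fun _ _ _ _ setT (fun w : R3 R * R3 R => f w.1 w.2)^\+%E).
      by move=> w _; rewrite !funeposE.
    exact: (measurable_funepos mf).
  - by move=> x z; exact: funepos_ge0.
have mn : measurable_fun setT (fun x => \int[vol3]_z (f x)^\- z)%E.
  apply: (@measurable_integral_on _ _ _ _ _ vol3 setT (fun x z => (f x)^\- z)%E).
  - exact: measurableT.
  - apply: (@eq_measurable_fun _ _ _ _ setT (fun w : R3 R * R3 R => f w.1 w.2)^\-%E).
      by move=> w _; rewrite !funenegE.
    exact: (measurable_funeneg mf).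
  - by move=> x z; exact: funeneg_ge0.
have -> : moll S = (fun x => fine (\int[vol3]_z (f x)^\+ z - \int[vol3]_z (f x)^\- z))%E.
  by apply/funext => x; rewrite /moll /Rintegral integralE.
by apply: measurableT_comp => //; exact: emeasurable_funB.
Qed.

(** Jensen's inequality for the mollifier: integrate 2 t u <= u^2 + t^2
    against the Gaussian, with the best t. *)
Lemma moll_sqr_le (S : R) x : 0 < S ->
  ((moll S x ^+ 2)%:E <= (Num.sqrt pi ^+ 3)%:E *
     \int[vol3]_z (u z ^+ 2 * (S ^+ 3 * expR (- (S ^+ 2 * dsq x z))))%:E)%E.
Proof.
move=> S0.
have g0 : 0 < Num.sqrt pi :> R by rewrite sqrtr_gt0 pi_gt0.
pose K : R := Num.sqrt pi ^+ 3.
have K0 : 0 < K by rewrite exprn_gt0.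
set m := moll S x; pose t := m / K.
have is1 := moll_integrable x S0.
pose w z : R := S ^+ 3 * expR (- (S ^+ 2 * dsq x z)).
have w0 z : 0 <= w z by rewrite /w; pos.
have ew z : S ^+ 3 * bump3 S x z <= w z by rewrite /w ler_wpM2l ?bump3_le//; pos.
have e0 z : 0 <= S ^+ 3 * bump3 S x z by apply: mulr_ge0; [pos|exact: bump3_ge0].
have mE : m%:E = (\int[vol3]_z (u z * (S ^+ 3 * bump3 S x z))%:E)%E.
  by rewrite /m -(fineK (integrable_fin_num measurableT is1)).
have key : ((2 * t * m)%:E <= \int[vol3]_z (u z ^+ 2 * w z)%:E + (t ^+ 2 * K)%:E)%E.
  have -> : ((2 * t * m)%:E = \int[vol3]_z ((2 * t)%:E * (u z * (S ^+ 3 * bump3 S x z))%:E))%E.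
    by rewrite (@integralZl _ _ _ vol3 setT measurableT _ is1) EFinM mE.
  apply: (le_trans (lee_abs _)).
  apply: (@le_trans _ _ (\int[vol3]_z ((u z ^+ 2 * w z)%:E + (t ^+ 2)%:E * (w z)%:E))%E).
    apply: abse_integral_le => z _; rewrite -!EFinM -EFinD abse_EFin lee_fin.
    rewrite [2 * t * _]mulrA normrM [`|S ^+ 3 * bump3 S x z|]ger0_norm//.
    apply: (@le_trans _ _ (`|2 * t * u z| * w z)); first by rewrite ler_wpM2l.
    rewrite -mulrDl ler_wpM2r// ler_norml; apply/andP.
    by move: (sqr_ge0 (u z - t)) (sqr_ge0 (u z + t)); split; nra.
  rewrite ge0_integralD; last 5 first.
  - exact: measurableT.
  - by move=> z _; rewrite lee_fin mulr_ge0 ?sqr_ge0.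
  - by rewrite /w; meas.
  - by move=> z _; rewrite -EFinM lee_fin mulr_ge0 ?sqr_ge0.
  - by rewrite /w; meas.
  rewrite leeD2l// ge0_integralZl; last 4 first.
  - exact: measurableT.
  - by rewrite /w; meas.
  - by move=> z _; rewrite lee_fin.
  - by rewrite lee_fin sqr_ge0.
  by rewrite gauss3K// EFinM.
have tK : t ^+ 2 * K = m ^+ 2 / K by rewrite /t; field; rewrite gt_eqF.
have tm : 2 * t * m = m ^+ 2 / K + m ^+ 2 / K by rewrite /t; field; rewrite gt_eqF.
move: key; rewrite tK tm EFinD leeD2rE// => key.
have -> : m ^+ 2 = K * (m ^+ 2 / K) by rewrite mulrCA divff ?mulr1// gt_eqF.
by rewrite EFinM lee_wpmul2l// lee_fin ltW.
Qed.

Lemma moll_L2 (S : R) : 0 < S ->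
  (\int[vol3]_x (moll S x ^+ 2)%:E <= ((Num.sqrt pi ^+ 3) ^+ 2 * a2)%:E)%E.
Proof.
move=> S0.
have g0 : 0 < Num.sqrt pi :> R by rewrite sqrtr_gt0 pi_gt0.
have K0 : 0 <= Num.sqrt pi ^+ 3 :> R by rewrite exprn_ge0// ltW.
have mf : measurable_fun setT (fun w : R3 R * R3 R =>
   (u w.2 ^+ 2 * (S ^+ 3 * expR (- (S ^+ 2 * dsq w.1 w.2))))%:E).
  by meas.
have f0 x z : 0 <= u z ^+ 2 * (S ^+ 3 * expR (- (S ^+ 2 * dsq x z))) by pos.
apply: (@le_trans _ _ (\int[vol3]_x ((Num.sqrt pi ^+ 3)%:E *
     \int[vol3]_z (u z ^+ 2 * (S ^+ 3 * expR (- (S ^+ 2 * dsq x z))))%:E))%E).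
  apply: le_integral_ge0; first by move=> x _; rewrite lee_fin sqr_ge0.
  by move=> x _; exact: moll_sqr_le.
rewrite ge0_integralZl; last 4 first.
- exact: measurableT.
- apply: (@measurable_integral_on _ _ _ _ _ vol3 setT
    (fun x z => (u z ^+ 2 * (S ^+ 3 * expR (- (S ^+ 2 * dsq x z))))%:E)).
  + exact: measurableT.
  + exact: mf.
  + by move=> x z; rewrite lee_fin.
- by move=> x _; apply: integral_ge0 => z _; rewrite lee_fin.
- by rewrite lee_fin.
rewrite (@tonelli_on _ _ _ _ _ vol3 vol3 setT
  (fun x z => (u z ^+ 2 * (S ^+ 3 * expR (- (S ^+ 2 * dsq x z))))%:E)); last 3 first.
- exact: measurableT.
- exact: mf.
- by move=> x z; rewrite lee_fin.
under eq_integral => z _.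
  under eq_integral do rewrite EFinM dsqC.
  rewrite ge0_integralZl; [|side..].
  rewrite gauss3K//.
  over.
rewrite ge0_integralZr; last 4 first.
- exact: measurableT.
- by meas.
- by move=> z _; rewrite lee_fin sqr_ge0.
- by rewrite lee_fin.
by rewrite -/A A_E -!EFinM lee_fin [_ * (a2 * _)]mulrCA [leRHS]mulrC -expr2.
Qed.

End representation.

(** * Weak convergence tested on boxes *)

Section weak_convergence.
Local Open Scope ereal_scope.
Context d (T : measurableType d) {R : realType} (m : {measure set T -> \bar R}).
Variables (Q : set T) (dn : nat -> T -> R) (C : R).
Hypothesis mQ : measurable Q.
Hypothesis Qfin : m Q < +oo.
Hypothesis mdn : forall n, measurable_fun setT (dn n).
Hypothesis dnC : forall n, \int[m]_(x in Q) ((dn n x ^+ 2)%R)%:E <= C%:E.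

Let C0 : (0 <= C)%R.
Proof.
rewrite -lee_fin; apply: le_trans (dnC 0); apply: integral_ge0 => x _.
by rewrite lee_fin sqr_ge0.
Qed.

(** |f| <= e f^2 + 1/e: a bound in L^2 makes the functions uniformly
    integrable. *)
Lemma integral_abs_le (n : nat) (E : set T) (e : R) : measurable E -> E `<=` Q -> (0 < e)%R ->
  \int[m]_(x in E) (`|dn n x|%R)%:E <= (e * C)%:E + e^-1%:E * m E.
Proof.
move=> mE EQ e0.
apply: (@le_trans _ _ (\int[m]_(x in E) (e%:E * (dn n x ^+ 2)%:E + e^-1%:E))).
  apply: le_integral_ge0 => [x _|x _]; first by rewrite lee_fin.
  rewrite -EFinM -EFinD lee_fin.
  have ei : (e * e^-1 = 1)%R by rewrite divff// gt_eqF.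
  have ei0 : (0 < e^-1)%R by rewrite invr_gt0.
  rewrite -[(dn n x ^+ 2)%R]real_normK ?num_real//.
  move: (`|dn n x|%R) (normr_ge0 (dn n x)) => a a0.
  have : (0 <= e * (a - e^-1) ^+ 2)%R by rewrite mulr_ge0 ?sqr_ge0// ltW.
  have -> : (e * (a - e^-1) ^+ 2 = e * a ^+ 2 - 2 * (e * e^-1) * a + (e * e^-1) * e^-1)%R by ring.
  rewrite ei; lra.
rewrite ge0_integralD; last 5 first.
- by [].
- by move=> x _; rewrite -EFinM lee_fin mulr_ge0 ?sqr_ge0// ltW.
- apply: measurable_funTS; apply: measurable_fun_mule => //.
  by apply/measurable_EFinP; apply: measurable_funX.
- by move=> x _; rewrite lee_fin invr_ge0 ltW.
- exact: measurable_cst.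
rewrite integral_cst//; apply: leeD => //.
rewrite ge0_integralZl; last 4 first.
- by [].
- by apply: measurable_funTS; apply/measurable_EFinP; apply: measurable_funX.
- by move=> x _; rewrite lee_fin sqr_ge0.
- by rewrite lee_fin ltW.
rewrite EFinM lee_wpmul2l ?lee_fin ?(ltW e0)//; apply: le_trans (dnC n).
apply: ge0_subset_integral => //.
  by apply: measurable_funTS; apply/measurable_EFinP; apply: measurable_funX.
by move=> x _; rewrite lee_fin sqr_ge0.
Qed.

Lemma integrable_on (n : nat) (E : set T) : measurable E -> E `<=` Q ->
  m.-integrable E (EFin \o dn n).
Proof.
move=> mE EQ; apply/integrableP; split.
  by apply/measurable_EFinP; exact: measurable_funTS.
apply: (@le_lt_trans _ _ ((1 * C)%:E + 1^-1%:E * m E)).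
  exact: integral_abs_le.
rewrite lte_add_pinfty ?ltry// invr1 mul1e; apply: le_lt_trans Qfin.
by apply: le_measure => //; rewrite inE.
Qed.

Definition cvg0_on (A : set T) : Prop := forall e : R, (0 < e)%R ->
  \forall n \near \oo, `|\int[m]_(x in A `&` Q) (dn n x)%:E| <= e%:E.

(** Increasing unions are handled by uniform integrability: the part of the
    union outside F i has small measure, hence contributes little for all n at
    once. *)
Lemma cvg0_on_lambda : cvg0_on setT ->
  lambda_system setT [set A | measurable A /\ cvg0_on A].
Proof.
move=> HT; split => //.
- move=> A B BA [mA HA] [mB HB]; split; first exact: measurableD.
  move=> e e0; have e20 : (0 < e / 2)%R by rewrite divr_gt0.
  apply: filterS2 (HA _ e20) (HB _ e20) => n.
  have mBQ : measurable (B `&` Q) by exact: measurableI.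
  have mDQ : measurable ((A `\` B) `&` Q) by apply: measurableI => //; exact: measurableD.
  have iB : m.-integrable (B `&` Q) (EFin \o dn n) by apply: integrable_on => // x [].
  have iD : m.-integrable ((A `\` B) `&` Q) (EFin \o dn n) by apply: integrable_on => // x [].
  have iA : m.-integrable (A `&` Q) (EFin \o dn n).
    by apply: integrable_on => [|x []//]; exact: measurableI.
  have E : A `&` Q = (B `&` Q) `|` ((A `\` B) `&` Q).
    apply/seteqP; split => [x [Ax Qx]|x [[Bx Qx]|[[Ax _] Qx]]]; last 2 first.
    - by split=> //; exact: BA.
    - by split.
    - by have [Bx|nBx] := pselect (B x); [left|right].
  have := @integral_setU _ _ _ m _ _ (EFin \o dn n) mBQ mDQ.
  rewrite -E => /(_ (measurable_int _ iA)) -> //; last first.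
    by rewrite disj_set2E; apply/eqP/seteqP; split => // x [[Bx _] [[_ nBx] _]].
  have := integrable_fin_num mBQ iB; have := integrable_fin_num mDQ iD.
  move: (integral _ _ _) (integral _ _ _) => [p||] [q||] //= _ _.
  rewrite !lee_fin => h1 h2.
  have := ler_normB (p + q)%R p; rewrite [(p + q)%R]addrC addrK [(q + p)%R]addrC.
  by move: h1 h2; lra.
- move=> F ndF HF; split.
    by apply: bigcup_measurable => i _; have [] := HF i.
  move=> e e0.
  pose E i := ((\bigcup_k F k) `\` F i) `&` Q.
  have mF i : measurable (F i) by have [] := HF i.
  have mU : measurable (\bigcup_k F k) by exact: bigcup_measurable.
  have mE i : measurable (E i) by apply: measurableI => //; exact: measurableD.
  have EQ i : E i `<=` Q by move=> x [].
  have mE0 : m (E i) @[i --> \oo] --> 0.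
    rewrite -(measure0 m).
    have <- : \bigcap_i E i = set0.
      apply/seteqP; split => // x Ex.
      have [[[k _ Fkx] _] _] := Ex 0%N I.
      by have [[_ /(_ Fkx)]] := Ex k I.
    apply: nonincreasing_cvg_mu => //.
    + apply: le_lt_trans Qfin; apply: le_measure; rewrite ?inE//.
    + exact: bigcap_measurable.
    + move=> i j ij; apply/subsetPset => x [[Ux nFx] Qx]; split => //; split => //.
      by move=> Fix; apply: nFx; move: (ndF _ _ ij) => /subsetPset; exact.
  pose dl : R := (e / (3 * (C + 1)))%R.
  have dl0 : (0 < dl)%R by rewrite divr_gt0// mulr_gt0//; move: C0; lra.
  have dlC1 : (dl * (C + 1) = e / 3)%R.
    by rewrite /dl; field; move: C0 => ?; lra.
  have dlC : (dl * C <= e / 3)%R by rewrite -dlC1 ler_wpM2l ?(ltW dl0)//; lra.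
  have e30 : (0 < e / 3)%R by rewrite divr_gt0.
  have lt0 : 0 < (dl * (e / 3))%:E by rewrite lte_fin mulr_gt0.
  have [i _ Hi] : \forall i \near \oo, m (E i) < (dl * (e / 3))%:E.
    exact: (mE0 _ (open_ereal_lt' lt0)).
  have {Hi} := Hi i (leqnn _) => /= mEi.
  have [_ HFi] := HF i.
  apply: filterS (HFi _ e30) => n HFn.
  have mFQ : measurable (F i `&` Q) by exact: measurableI.
  have iU : m.-integrable ((\bigcup_k F k) `&` Q) (EFin \o dn n).
    by apply: integrable_on => [|x []//]; exact: measurableI.
  have UE : (\bigcup_k F k) `&` Q = (F i `&` Q) `|` E i.
    apply/seteqP; split => [x [Ux Qx]|x [[Fx Qx]|[[Ux _] Qx]]]; last 2 first.
    - by split=> //; exists i.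
    - by split.
    - by have [Fx|nFx] := pselect (F i x); [left|right].
  have := @integral_setU _ _ _ m _ _ (EFin \o dn n) mFQ (mE i).
  rewrite -UE => /(_ (measurable_int _ iU)) -> //; last first.
    by rewrite disj_set2E; apply/eqP/seteqP; split => // x [[Fx _] [[_ nFx] _]].
  apply: (le_trans (lee_abs_add _ _)).
  have h2 : `|\int[m]_(x in E i) (EFin \o dn n) x| <= (dl * C)%:E + dl^-1%:E * m (E i).
    apply: le_trans (integral_abs_le n (mE i) (EQ i) dl0).
    exact: abse_integral_le.
  apply: (le_trans (leeD HFn h2)).
  have mEf : m (E i) \is a fin_num.
    by rewrite ge0_fin_numE// (lt_trans mEi)// ltry.
  move: mEi; rewrite -(fineK mEf) lte_fin => mEi.
  rewrite -EFinM -!EFinD lee_fin.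
  have h3 : (dl^-1 * fine (m (E i)) <= e / 3)%R.
    by rewrite ler_pdivrMl// ltW.
  by move: dlC h3; lra.
Qed.

End weak_convergence.

Section boxes.
Context {R : realType}.

Definition box (a c : R * R * R) : set (R3 R) :=
  (`]a.1.1, c.1.1]%classic `*` `]a.1.2, c.1.2]%classic) `*` `]a.2, c.2]%classic.

Definition boxes : set (set (R3 R)) := [set X | exists a c, X = box a c].

Lemma measurable_box a c : measurable (box a c).
Proof. by apply: measurableX => //; exact: measurableX. Qed.

(** Boxes form a pi-system, to which the theorem on lambda-systems applies. *)
Lemma setI_closed_boxes : setI_closed boxes.
Proof.
have itvI (a c a' c' : R) : `]a, c]%classic `&` `]a', c']%classic =
    `]Num.max a a', Num.min c c']%classic.
  apply/seteqP; split => x /=; rewrite !in_itv /= gt_max le_min.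
    by move=> [/andP[-> ->] /andP[-> ->]].
  by move=> /andP[/andP[-> ->] /andP[-> ->]].
move=> _ _ [a [c ->]] [a' [c' ->]].
exists ((Num.max a.1.1 a'.1.1, Num.max a.1.2 a'.1.2), Num.max a.2 a'.2),
  ((Num.min c.1.1 c'.1.1, Num.min c.1.2 c'.1.2), Num.min c.2 c'.2).
rewrite /box /= -!itvI.
by apply/seteqP; split => x [] /= => [[[h1 h2] h3] [[h4 h5] h6]|[[h1 h4] [h2 h5]] [h3 h6]]; do ?split.
Qed.

Lemma nat_itv (t : R) : exists N : nat, forall n, (N <= n)%N -> `]- n%:R, n%:R]%classic t.
Proof.
exists (Num.truncn `|t|).+1 => n Nn; rewrite /= in_itv /=.
have : `|t| < n%:R by apply: (lt_le_trans (truncnS_gt _)); rewrite ler_nat.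
by rewrite ltr_norml => /andP[-> /ltW ->].
Qed.

(** The coordinates are measurable for the sigma-algebra generated by boxes,
    since the preimage of an interval under a coordinate is a countable union
    of boxes. *)
Lemma measurable_boxes (X : set (R3 R)) : measurable X -> <<s boxes >> X.
Proof.
pose S : measurableType _ := g_sigma_algebraType boxes.
pose N (n : nat) : R := n%:R.
have mB a c : @measurable _ S (box a c) by apply: sub_sigma_algebra; exists a, c.
suff mid : measurable_fun (setT : set S) (fun x : S => (x : R3 R)).
  move=> mX; have := mid measurableT X mX.
  by rewrite setTI.
apply/measurable_fun_pairP; split; first (apply/measurable_fun_pairP; split).
- apply: (@measurability _ _ S (measurableTypeR R) setT _ (@ocitv R)) => // _ [_ [[a c] _ <-] <-].
  rewrite setTI [X in measurable X](_ : _ =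
    \bigcup_n box ((a, - N n), - N n) ((c, N n), N n)); first exact: bigcupT_measurable.
  apply/seteqP; split => [[[x y] z] /= h|[[x y] z] [n _ [[h _] _]]//].
  have [N1 h1] := nat_itv y; have [N2 h2] := nat_itv z.
  exists (maxn N1 N2) => //; split; [split => //|].
    by apply: h1; exact: leq_maxl.
  by apply: h2; exact: leq_maxr.
- apply: (@measurability _ _ S (measurableTypeR R) setT _ (@ocitv R)) => // _ [_ [[a c] _ <-] <-].
  rewrite setTI [X in measurable X](_ : _ =
    \bigcup_n box ((- N n, a), - N n) ((N n, c), N n)); first exact: bigcupT_measurable.
  apply/seteqP; split => [[[x y] z] /= h|[[x y] z] [n _ [[_ h] _]]//].
  have [N1 h1] := nat_itv x; have [N2 h2] := nat_itv z.
  exists (maxn N1 N2) => //; split; [split => //|].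
    by apply: h1; exact: leq_maxl.
  by apply: h2; exact: leq_maxr.
- apply: (@measurability _ _ S (measurableTypeR R) setT _ (@ocitv R)) => // _ [_ [[a c] _ <-] <-].
  rewrite setTI [X in measurable X](_ : _ =
    \bigcup_n box ((- N n, - N n), a) ((N n, N n), c)); first exact: bigcupT_measurable.
  apply/seteqP; split => [[[x y] z] /= h|[[x y] z] [n _ [_ h]]//].
  have [N1 h1] := nat_itv x; have [N2 h2] := nat_itv y.
  exists (maxn N1 N2) => //; split; [split => //|by []].
    by apply: h1; exact: leq_maxl.
  by apply: h2; exact: leq_maxr.
Qed.

(** The pi-lambda theorem: convergence on boxes gives convergence on all
    measurable sets. *)
Lemma weak_cvg_boxes (Q : set (R3 R)) (dn : nat -> R3 R -> R) (C : R) :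
  measurable Q -> (vol3 Q < +oo)%E -> (forall n, measurable_fun setT (dn n)) ->
  (forall n, \int[vol3]_(x in Q) ((dn n x ^+ 2)%R)%:E <= C%:E)%E ->
  cvg0_on vol3 Q dn setT ->
  (forall a c, cvg0_on vol3 Q dn (box a c)) ->
  forall A, measurable A -> cvg0_on vol3 Q dn A.
Proof.
move=> mQ Qfin mdn dnC HT HB A mA.
have lam := cvg0_on_lambda mQ Qfin mdn dnC HT.
have sub : boxes `<=` [set A | measurable A /\ cvg0_on vol3 Q dn A].
  by move=> _ [a [c ->]]; split; [exact: measurable_box|exact: HB].
have := @lambda_system_subset _ _ setI_closed_boxes setT _ lam sub.
by move=> /(_ (fun _ _ => subsetT _)) /(_ _ (measurable_boxes mA)) [].
Qed.

End boxes.

(** * Integrals of the mollifier over boxes *)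

Section bump_integral.
Context {R : realType}.
Notation mu := (@lebesgue_measure R).
Variables (b b' : R -> R) (L k M : R).
Hypothesis gb : good_bump b b' L k M.
Implicit Types (a c s z : R).

Let b0 t : 0 <= b t. Proof. exact: (gb_ge0 gb). Qed.

Let cb : continuous b. Proof. exact: (good_bump_continuous gb). Qed.

Let mb : measurable_fun [set: measurableTypeR R] b.
Proof. exact: (measurable_good_bump gb). Qed.

Lemma integral_bump_line s z : 0 < s ->
  (\int[mu]_x (s * b (s * (x - z)))%:E = M%:E)%E.
Proof.
move=> s0; rewrite -(gb_mass gb).
pose F x : R := s * (x - z).
have dF x : is_derive x (1 : R) F s.
  by apply: is_derive_eq; rewrite /GRing.scale /=; ring.
have dFE : derive1 F = cst s.
  by apply/funext => x; rewrite derive1E; have [_ ->] := dF x.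
rewrite (@increasing_ge0_integration_by_substitutionT _ F b).
- by apply: eq_integral => x _; rewrite dFE /= mulrC.
- by move=> x y xy; rewrite /F ltr_pM2l// ltrD2r.
- by rewrite dFE; apply: cst_continuous.
- by rewrite dFE; exact: is_cvg_cst.
- by rewrite dFE; exact: is_cvg_cst.
- by move=> x; have [] := dF x.
- apply/cvgrNyPle => A; near=> x; rewrite /F -ler_pdivlMl// lerBlDr; near: x.
  by apply: nbhs_ninfty_le; exact: num_real.
- apply/cvgryPge => A; near=> x; rewrite /F -ler_pdivrMl// lerBrDr; near: x.
  by apply: nbhs_pinfty_ge; exact: num_real.
- exact: cb.
- exact: b0.
Unshelve. all: end_near. Qed.

(** As a function of z, a one-dimensional mollification of the indicator of
    ]a, c], at scale 1/s. *)
Definition slab a c s z : R := \int[mu]_(x in `]a, c]) (s * b (s * (x - z))).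

Lemma measurable_slab_integrand s z :
  measurable_fun [set: measurableTypeR R] (fun x => s * b (s * (x - z))).
Proof.
apply: measurable_funM; first exact: measurable_cst.
by apply: measurableT_comp => //; meas.
Qed.

Lemma slab_le_line a c s z : 0 < s ->
  (\int[mu]_(x in `]a, c]) (s * b (s * (x - z)))%:E <= M%:E)%E.
Proof.
move=> s0; rewrite -(integral_bump_line z s0).
apply: ge0_subset_integral => //.
  by apply/measurable_EFinP; exact: measurable_slab_integrand.
by move=> x _; rewrite lee_fin mulr_ge0// ltW.
Qed.

Lemma slab_ge0e a c s z : 0 < s ->
  (0 <= \int[mu]_(x in `]a, c]) (s * b (s * (x - z)))%:E)%E.
Proof. by move=> s0; apply: integral_ge0 => x _; rewrite lee_fin mulr_ge0// ltW. Qed.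

Lemma slabE a c s z : 0 < s ->
  (\int[mu]_(x in `]a, c]) (s * b (s * (x - z)))%:E = (slab a c s z)%:E)%E.
Proof.
move=> s0; rewrite /slab /Rintegral fineK// ge0_fin_numE ?slab_ge0e//.
by apply: le_lt_trans (slab_le_line _ _ _ s0) _; exact: ltry.
Qed.

Lemma slab_ge0 a c s z : 0 < s -> 0 <= slab a c s z.
Proof. by move=> s0; rewrite -lee_fin -slabE// slab_ge0e. Qed.

Lemma slab_le a c s z : 0 < s -> slab a c s z <= M.
Proof. by move=> s0; rewrite -lee_fin -slabE// slab_le_line. Qed.

Lemma slab_out a c s z : 0 < s ->
  (forall x, a < x -> x <= c -> L <= s * `|x - z|) -> slab a c s z = 0.
Proof.
move=> s0 h; rewrite /slab /Rintegral integral0_eq// => x /=.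
rewrite in_itv /= => /andP[ax xc]; congr EFin.
by rewrite (gb_out gb) ?mulr0// normrM (gtr0_norm s0) h.
Qed.

Lemma slab_in a c s z : 0 < s -> L <= s * (z - a) -> L <= s * (c - z) -> slab a c s z = M.
Proof.
move=> s0 ha hc; apply: EFin_inj; rewrite -slabE// -(integral_bump_line z s0).
rewrite integral_mkcond; apply: eq_integral => x _; rewrite patchE.
case: ifPn => // xac; rewrite (gb_out gb) ?mulr0//.
rewrite normrM (gtr0_norm s0).
have : ~ (a < x <= c) by move=> h; move/negP: xac; apply; rewrite inE /= in_itv.
move=> nx; have [xa|ax] := leP x a.
  apply: le_trans ha _; rewrite ler_pM2l//.
  by rewrite -normrN; apply: le_trans (ler_norm _); lra.
have [xc|cx] := leP x c; first by case: nx; rewrite ax xc.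
by apply: le_trans hc _; rewrite ler_pM2l//; apply: le_trans (ler_norm _); lra.
Qed.

Lemma slab_far a c s z : 1 <= s -> ~ (a - L < z <= c + L) -> slab a c s z = 0.
Proof.
move=> s1 nz; have s0 : 0 < s by apply: lt_le_trans s1.
apply: slab_out => // x ax xc; apply: le_trans (ler_peMl (normr_ge0 _) s1).
rewrite leNgt; apply/negP; rewrite ltr_norml => /andP[h1 h2]; apply: nz.
by apply/andP; split; move: ax xc h1 h2; lra.
Qed.

(** By the compact support of the profile the value is eventually equal to its
    limit, except at the two end points. *)
Lemma slab_cvg a c z : z != a -> z != c ->
  \forall n \near \oo, slab a c n.+1%:R z = M * \1_(`]a, c]%classic) z.
Proof.
move=> za zc; have [ac|ca] := leP a c; last first.
  apply: nearW => n; rewrite slab_out//; last by move=> x ax xc; move: ca; lra.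
  rewrite indicE memNset ?mulr0//= in_itv /= => /andP[]; move: ca; lra.
have arch (e : R) : 0 < e -> \forall n \near \oo, L <= n.+1%:R * e.
  move=> e0; exists (Num.truncn (L / e)).+1 => // n /= Nn.
  rewrite -ler_pdivrMr//; apply/ltW/(lt_le_trans (truncnS_gt _)).
  by rewrite ler_nat; exact: leq_trans Nn _.
have [zlta|agtz|/esym/eqP] := ltgtP z a; last by rewrite eq_sym (negbTE za).
  have e0 : 0 < a - z by rewrite subr_gt0.
  apply: filterS (arch _ e0) => n Ln.
  rewrite slab_out//; last first.
    move=> x ax xc; apply: le_trans Ln _; rewrite ler_pM2l//.
    by apply: le_trans (ler_norm _); lra.
  rewrite indicE memNset ?mulr0//= in_itv /= => /andP[]; move: zlta; lra.
have [zltc|cltz|/esym/eqP] := ltgtP z c; last by rewrite eq_sym (negbTE zc).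
  have e0 : 0 < z - a by rewrite subr_gt0.
  have e1 : 0 < c - z by rewrite subr_gt0.
  apply: filterS2 (arch _ e0) (arch _ e1) => n La Lc.
  rewrite slab_in// indicE mem_set ?mulr1//= in_itv /= agtz; exact: ltW.
have e0 : 0 < z - c by rewrite subr_gt0.
apply: filterS (arch _ e0) => n Ln.
rewrite slab_out//; last first.
  move=> x ax xc; apply: le_trans Ln _; rewrite ler_pM2l//.
  by rewrite -normrN; apply: le_trans (ler_norm _); lra.
rewrite indicE memNset ?mulr0//= in_itv /= => /andP[]; move: cltz; lra.
Qed.

Lemma measurable_slab a c s : 0 < s -> measurable_fun [set: measurableTypeR R] (slab a c s).
Proof.
move=> s0; apply/measurable_EFinP.
have -> : EFin \o slab a c s =
    (fun z => \int[mu]_(x in `]a, c]) (s * b (s * (x - z)))%:E)%E.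
  by apply/funext => z /=; rewrite slabE.
apply: (@measurable_integral_on _ _ (measurableTypeR R) (measurableTypeR R) R mu `]a, c]%classic
   (fun z x => (s * b (s * (x - z)))%:E)) => //; last first.
  by move=> z x; rewrite lee_fin mulr_ge0// ltW.
apply/measurable_EFinP; apply: measurable_funM; first exact: measurable_cst.
by apply: measurableT_comp => //; meas.
Qed.

Definition slab3 (a c : R * R * R) s (z : R3 R) : R :=
  slab a.1.1 c.1.1 s z.1.1 * slab a.1.2 c.1.2 s z.1.2 * slab a.2 c.2 s z.2.

(** Kernel and box are both products. *)
Lemma integral_box_bump3 (a c : R * R * R) s (z : R3 R) : 0 < s ->
  (\int[vol3]_(x in box a c) (s ^+ 3 * bump3 b s x z)%:E = (slab3 a c s z)%:E)%E.
Proof.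
move=> s0; rewrite integral_mkcond.
pose f (p q r x : R) := (\1_(`]p, q]%classic) x : R) * (s * b (s * (x - r))).
transitivity (\int[vol3]_x (f a.1.1 c.1.1 z.1.1 x.1.1 * f a.1.2 c.1.2 z.1.2 x.1.2
    * f a.2 c.2 z.2 x.2)%:E)%E.
  apply: eq_integral => x _; rewrite patchE /f !indicE /box.
  case: ifPn => [/set_mem[[/= h1 h2] h3]|nx].
    by rewrite !mem_set//= /bump3; congr EFin; ring.
  have [h1|] := boolP (x.1.1 \in `]a.1.1, c.1.1]%classic); last by rewrite !mul0r.
  have [h2|] := boolP (x.1.2 \in `]a.1.2, c.1.2]%classic); last by rewrite mul0r mulr0 mul0r.
  have [h3|] := boolP (x.2 \in `]a.2, c.2]%classic); last by rewrite mul0r mulr0.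
  by case/negP: nx; apply/mem_set; split; [split|]; exact/set_mem.
have mf p q r : measurable_fun [set: measurableTypeR R] (f p q r).
  apply: measurable_funM; first exact: measurable_indic.
  exact: measurable_slab_integrand.
have f0 p q r x : 0 <= f p q r x by rewrite !mulr_ge0// ltW.
rewrite integral_prod3; [|exact: mf|exact: mf|exact: mf|exact: f0|exact: f0|exact: f0].
have fE p q r : (\int[mu]_x (f p q r x)%:E = (slab p q s r)%:E)%E.
  rewrite -slabE// [RHS]integral_mkcond; apply: eq_integral => x _.
  by rewrite patchE /f indicE; case: ifPn => _; rewrite ?mul1r ?mul0r.
by rewrite !fE.
Qed.

Let M0 : 0 <= M. Proof. exact: (ltW (good_bump_mass_gt0 gb)). Qed.

Lemma slab3_ge0 (a c : R * R * R) s (z : R3 R) : 0 < s -> 0 <= slab3 a c s z.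
Proof. by move=> s0; rewrite !mulr_ge0// slab_ge0. Qed.

(** For scales below 1 the mollifier does not reach beyond distance L, which
    gives a dominating function with bounded support. *)
Lemma slab3_le (a c : R * R * R) s (z : R3 R) : 1 <= s ->
  slab3 a c s z <= M ^+ 3 *
    \1_(box ((a.1.1 - L, a.1.2 - L), a.2 - L) ((c.1.1 + L, c.1.2 + L), c.2 + L)) z.
Proof.
move=> s1; have s0 : 0 < s by exact: lt_le_trans s1.
rewrite indicE; have [_|nz] := boolP (z \in _).
  rewrite mulr1 /slab3 !exprS expr0 mulr1 mulrA.
  by rewrite !ler_pM ?mulr_ge0 ?slab_ge0// slab_le.
rewrite mulr0 /slab3; move: nz; rewrite notin_setE /box /= => nz.
have [h1|h1] := boolP (a.1.1 - L < z.1.1 <= c.1.1 + L); last first.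
  by rewrite (slab_far s1 (negP h1)) !mul0r.
have [h2|h2] := boolP (a.1.2 - L < z.1.2 <= c.1.2 + L); last first.
  by rewrite (slab_far s1 (negP h2)) mulr0 mul0r.
have [h3|h3] := boolP (a.2 - L < z.2 <= c.2 + L); last first.
  by rewrite (slab_far s1 (negP h3)) mulr0.
by case: nz; rewrite /= !in_itv /= h1 h2 h3.
Qed.

Lemma measurable_slab3 (a c : R * R * R) s : 0 < s -> measurable_fun setT (slab3 a c s).
Proof.
move=> s0; have m p q := measurable_slab p q s0.
rewrite /slab3; apply: measurable_funM; first apply: measurable_funM.
- by apply: (measurableT_comp (m _ _)); meas.
- by apply: (measurableT_comp (m _ _)); meas.
- by apply: (measurableT_comp (m _ _)); meas.
Qed.

Lemma vol3_prod (A B C : set (measurableTypeR R)) :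
  measurable A -> measurable B -> measurable C ->
  (vol3 ((A `*` B) `*` C) = mu A * mu B * mu C)%E.
Proof.
move=> mA mB mC; transitivity (vol2 (A `*` B) * mu C)%E.
  by apply: product_measure1E => //; exact: measurableX.
by congr (_ * _)%E; apply: product_measure1E.
Qed.

Lemma vol3_box_lty (a c : R * R * R) : (vol3 (box a c) < +oo)%E.
Proof.
have bE : (vol3 (box a c) = mu `]a.1.1, c.1.1]%classic * mu `]a.1.2, c.1.2]%classic
    * mu `]a.2, c.2]%classic)%E.
  exact: vol3_prod.
have fin (p q : R) : (mu `]p, q]%classic \is a fin_num)%E.
  by rewrite lebesgue_measure_itv /=; case: ifP.
by rewrite bE -ge0_fin_numE ?mule_ge0// !fin_numM.
Qed.

Lemma ae_coord (p q r : R) :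
  {ae vol3, forall z : R3 R, [/\ z.1.1 != p, z.1.2 != q & z.2 != r]}.
Proof.
have face (A B C : set R) : measurable A -> measurable B -> measurable C ->
    (mu A * mu B * mu C = 0)%E ->
    {ae vol3, forall z : R3 R, ~ ((A `*` B) `*` C) z}.
  move=> mA mB mC m0; exists ((A `*` B) `*` C); split.
  - by apply: measurableX => //; exact: measurableX.
  - by rewrite vol3_prod.
  - by move=> z /= /contrapT.
have s0 (x : R) : mu [set x] = 0%E by exact: lebesgue_measure_set1.
have := face [set p] setT setT.
rewrite s0 !mul0e => /(_ _ _ _ erefl) H1.
have := face setT [set q] setT.
rewrite s0 mule0 mul0e => /(_ _ _ _ erefl) H2.
have := face setT setT [set r].
rewrite s0 mule0 => /(_ _ _ _ erefl) H3.
apply: filterS3 (H1 _ _ _) (H2 _ _ _) (H3 _ _ _) => // -[[x y] z] /= h1 h2 h3.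
split; apply/eqP => E; [apply: h1|apply: h2|apply: h3]; rewrite E; repeat split.
Qed.

End bump_integral.

(** * The pointwise bound by the potential of the gradient *)

Section integrable_boxes.
Context {R : realType}.

(** |u| <= u^2 + 1 on a set of finite measure. *)
Lemma integrable_norm_indic (u : R3 R -> R) (B : set (R3 R)) : measurable_fun setT u ->
  integrable3 (fun z => u z ^+ 2) ->
  measurable B -> (vol3 B < +oo)%E ->
  integrable3 (fun z => `|u z| * \1_B z).
Proof.
move=> mu_ iu mB Bfin.
have iB : integrable3 (\1_B : R3 R -> R).
  apply/integrableP; split; first by apply/measurable_EFinP; exact: measurable_indic.
  under eq_integral do rewrite /= ger0_norm ?indicE//.
  under eq_integral do rewrite -indicE.
  by rewrite integral_indic// setIT.
have mI : measurable_fun setT (\1_B : R3 R -> R) by exact: measurable_indic.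
apply: (le_integrable measurableT _ _ (integrableD measurableT iu iB)).
  by apply/measurable_EFinP; apply: measurable_funM => //; apply: measurableT_comp.
move=> z _ /=; rewrite lee_fin indicE.
rewrite [leLHS]ger0_norm ?mulr_ge0// [leRHS]ger0_norm ?addr_ge0 ?sqr_ge0//.
case: (z \in B); rewrite ?mulr0 ?addr0 ?sqr_ge0 ?mulr1//=.
rewrite -[u z ^+ 2]real_normK ?num_real//.
by have := sqr_ge0 (`|u z| - 1); have := normr_ge0 (u z); nra.
Qed.

Lemma integrable_box (f : R3 R -> R) (a c : R * R * R) : measurable_fun setT f ->
  integrable3 (fun z => f z ^+ 2) ->
  vol3.-integrable (box a c) (EFin \o f).
Proof.
move=> mf if2; apply/integrableP; split.
  by apply/measurable_EFinP; exact: measurable_funTS.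
have iN := integrable_norm_indic mf if2 (measurable_box a c) (vol3_box_lty a c).
have /integrableP[_] := iN; apply: le_lt_trans.
rewrite integral_mkcond; apply: le_integral_ge0 => x _; rewrite patchE.
  by case: ifP.
rewrite /= indicE; case: ifP => _; first by rewrite mulr1 normr_id.
by rewrite mulr0 normr0 lexx.
Qed.

End integrable_boxes.

Section averages.
Context {R : realType}.
Variables (b b' : R -> R) (L K M : R).
Hypothesis gb : good_bump b b' L K M.
Variables (u : R3 R -> R) (G : 'I_3 -> R3 R -> R).
Hypothesis mu_ : measurable_fun setT u.
Hypothesis iu : integrable3 (fun z => u z ^+ 2).
Hypothesis mG : forall i, measurable_fun setT (G i).
Hypothesis iG : forall i, integrable3 (fun z => G i z ^+ 2).
Hypothesis wp : forall i, weak_partial i u (G i).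
Implicit Types (a c : R * R * R) (s : R).

Let b0 t : 0 <= b t. Proof. exact: (gb_ge0 gb). Qed.

Let cb : continuous b. Proof. exact: (good_bump_continuous gb). Qed.

Let mb : measurable_fun [set: measurableTypeR R] b.
Proof. exact: (measurable_good_bump gb). Qed.

Let M0 : 0 <= M. Proof. exact: (ltW (good_bump_mass_gt0 gb)). Qed.

Lemma measurable_bump_kernel s : measurable_fun setT
  (fun w : R3 R * R3 R => s ^+ 3 * bump3 b s w.2 w.1).
Proof.
apply: measurable_funM; first exact: measurable_cst.
by rewrite /bump3; apply: measurable_funM; [apply: measurable_funM|];
  apply: measurableT_comp => //; meas.
Qed.

(** Fubini: the mollifier is moved from u to the indicator of the box. *)
Lemma integral_box_moll a c s : 1 <= s ->
  (\int[vol3]_(x in box a c) (moll b u s x)%:E = \int[vol3]_z (u z * slab3 b a c s z)%:E)%E.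
Proof.
move=> s1; have s0 : 0 < s by exact: lt_le_trans s1.
pose B' := box ((a.1.1 - L, a.1.2 - L), a.2 - L) ((c.1.1 + L, c.1.2 + L), c.2 + L).
have k0 z x : 0 <= s ^+ 3 * bump3 b s x z by rewrite mulr_ge0 ?exprn_ge0 ?(ltW s0)// (bump3_ge0 gb).
have mk z : measurable_fun setT (fun x => s ^+ 3 * bump3 b s x z).
  exact: (measurableT_comp (measurable_bump_kernel s) (pair1_measurable z)).
have inner (r : R) z : (\int[vol3]_(x in box a c) (r * (s ^+ 3 * bump3 b s x z))%:E =
    (r * slab3 b a c s z)%:E)%E.
  under eq_integral do rewrite EFinM.
  rewrite integralZl; [by rewrite (integral_box_bump3 gb)//|exact: measurable_box|].
  apply/integrableP; split; first by apply: measurable_funTS; apply/measurable_EFinP.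
  under eq_integral do rewrite /= ger0_norm//.
  by rewrite (integral_box_bump3 gb)// ltry.
have uE x : ((moll b u s x)%:E = \int[vol3]_z (u z * (s ^+ 3 * bump3 b s x z))%:E)%E.
  rewrite /moll /Rintegral fineK//.
  exact: (integrable_fin_num measurableT (moll_integrable gb mu_ iu x s0)).
under eq_integral do rewrite uE.
rewrite -(fubini_on (m1 := vol3) (m2 := vol3) (f := fun z x => u z * (s ^+ 3 * bump3 b s x z))).
- by apply: eq_integral => z _; exact: inner.
- exact: measurable_box.
- by apply: measurable_funM; [apply: measurableT_comp => //|exact: measurable_bump_kernel].
apply: (@le_lt_trans _ _ (\int[vol3]_z ((M ^+ 3)%:E * (`|u z| * \1_B' z)%:E))%E).
  apply: le_integral_ge0 => z _; first exact: integral_ge0.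
  under eq_integral do rewrite normrM (ger0_norm (k0 _ _)).
  rewrite inner -EFinM lee_fin [leRHS]mulrCA.
  by apply: ler_wpM2l => //; exact: (slab3_le gb).
have iN := integrable_norm_indic mu_ iu (measurable_box _ _) (vol3_box_lty _ _)
  : integrable3 (fun z => `|u z| * \1_B' z).
rewrite integralZl//.
have := integrable_fin_num measurableT iN => /fineK <-; rewrite -EFinM; exact: ltry.
Qed.

(** Dominated convergence; the faces of the box, where the mollified indicator
    may fail to converge, are null sets. *)
Lemma cvg_box_moll a c :
  ((\int[vol3]_(x in box a c) (moll b u n.+1%:R x)%:E) @[n --> \oo] -->
   \int[vol3]_(x in box a c) (M ^+ 3 * u x)%:E)%E.
Proof.
have s1 n : 1 <= n.+1%:R :> R by rewrite ler1n.
have -> : (fun n => \int[vol3]_(x in box a c) (moll b u n.+1%:R x)%:E)%E =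
   (fun n => \int[vol3]_z (u z * slab3 b a c n.+1%:R z)%:E)%E.
  by apply/funext => n; exact: integral_box_moll.
have -> : (\int[vol3]_(x in box a c) (M ^+ 3 * u x)%:E =
    \int[vol3]_x (u x * (M ^+ 3 * \1_(box a c) x))%:E)%E.
  rewrite integral_mkcond; apply: eq_integral => x _; rewrite patchE indicE.
  by case: ifPn => _; rewrite ?mulr1 ?mulr0// mulrC.
pose B' := box ((a.1.1 - L, a.1.2 - L), a.2 - L) ((c.1.1 + L, c.1.2 + L), c.2 + L).
have iN := integrable_norm_indic mu_ iu (measurable_box _ _) (vol3_box_lty _ _)
  : integrable3 (fun z => `|u z| * \1_B' z).
have [| | | | |_ _] := @dominated_convergence _ _ _ vol3 setT measurableT
  (fun n z => (u z * slab3 b a c n.+1%:R z)%:E)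
  (fun x => (u x * (M ^+ 3 * \1_(box a c) x))%:E)
  (fun z => ((M ^+ 3)%:E * (`|u z| * \1_B' z)%:E)%E).
- move=> n; apply/measurable_EFinP; apply: measurable_funM => //.
  by apply: (measurable_slab3 gb).
- apply/measurable_EFinP; apply: measurable_funM => //; apply: measurable_funM => //.
  by apply: measurable_indic; exact: measurable_box.
- apply: filterS2 (ae_coord a.1.1 a.1.2 a.2) (ae_coord c.1.1 c.1.2 c.2) => z [a1 a2 a3] [c1 c2 c3] _.
  apply: cvg_near_cst.
  apply: filterS3 (slab_cvg gb a1 c1) (slab_cvg gb a2 c2) (slab_cvg gb a3 c3) => n e1 e2 e3.
  rewrite /slab3 e1 e2 e3 !indicE; congr (u z * _)%:E.
  have -> : (z \in box a c) = [&& z.1.1 \in `]a.1.1, c.1.1]%classic,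
     z.1.2 \in `]a.1.2, c.1.2]%classic & z.2 \in `]a.2, c.2]%classic].
    apply/idP/and3P => [/set_mem[[h1 h2] h3]|[/set_mem h1 /set_mem h2 /set_mem h3]].
      by split; exact/mem_set.
    by apply/mem_set.
  by case: (_ \in _); case: (_ \in _); case: (_ \in _) => /=; ring.
- by apply: (integrableZl measurableT).
- apply: aeW => z n _; rewrite -EFinM lee_fin normrM.
  rewrite (ger0_norm (slab3_ge0 gb _ _ _ _)) ?(lt_le_trans ltr01 (s1 n))//.
  rewrite [leRHS]mulrCA.
  by apply: ler_wpM2l => //; exact: (slab3_le gb).
- exact.
Qed.

(** By [moll_le] the mollifications are bounded by the potential, and they
    converge weakly to M^3 u. On the set where s M^3 u exceeds the potential,
    s = 1 or -1, the integral of the excess is bounded by an integral of the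
    difference M^3 u - moll, which tends to 0; so this set is null. *)
Lemma moll_ae_bound : {ae vol3, forall x, ((M ^+ 3 * `|u x|)%:E <= potential G x)%E}.
Proof.
pose Q (k : nat) : set (R3 R) := box ((- k%:R, - k%:R), - k%:R) ((k%:R, k%:R), k%:R).
pose dn n x := moll b u n.+1%:R x - M ^+ 3 * u x.
have mP := measurable_potential mG.
have s0 n : 0 < n.+1%:R :> R by rewrite ltr0n.
have mmoll n : measurable_fun setT (moll b u n.+1%:R) := measurable_moll gb mu_ (s0 n).
have mdn n : measurable_fun setT (dn n).
  by apply: measurable_funB => //; apply: measurable_funM.
have a2E : (\int[vol3]_z (u z ^+ 2)%:E = (fine (\int[vol3]_z (u z ^+ 2)%:E))%:E)%E.
  by rewrite fineK//; exact: (integrable_fin_num measurableT iu).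
set a2 := fine _ in a2E.
have mollL2 n := moll_L2 gb mu_ iu (s0 n).
pose C := 2 * ((Num.sqrt pi ^+ 3) ^+ 2 * a2) + 2 * (M ^+ 3) ^+ 2 * a2.
have dnC k n : (\int[vol3]_(x in Q k) (dn n x ^+ 2)%:E <= C%:E)%E.
  have msq (f : R3 R -> R) : measurable_fun setT f -> measurable_fun setT (fun x => (f x ^+ 2)%:E).
    by move=> mf; apply/measurable_EFinP; exact: measurable_funX.
  apply: (@le_trans _ _ (\int[vol3]_x (dn n x ^+ 2)%:E)%E).
    apply: ge0_subset_integral => //; [exact: measurable_box|exact: msq|].
    by move=> x _; rewrite lee_fin sqr_ge0.
  apply: (@le_trans _ _ (\int[vol3]_x (2%:E * (moll b u n.+1%:R x ^+ 2)%:E +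
      (2 * (M ^+ 3) ^+ 2)%:E * (u x ^+ 2)%:E))%E).
    apply: le_integral_ge0 => x _; first by rewrite lee_fin sqr_ge0.
    rewrite -!EFinM -EFinD lee_fin /dn.
    by have := sqr_ge0 (moll b u n.+1%:R x + M ^+ 3 * u x); lra.
  have c0 : 0 <= 2 * (M ^+ 3) ^+ 2 by rewrite mulr_ge0 ?sqr_ge0.
  rewrite ge0_integralD; last 5 first.
  - exact: measurableT.
  - by move=> x _; rewrite -EFinM lee_fin mulr_ge0 ?sqr_ge0.
  - by apply: measurable_fun_mule; [exact: measurable_cst|exact: msq].
  - by move=> x _; rewrite -EFinM lee_fin mulr_ge0 ?sqr_ge0.
  - by apply: measurable_fun_mule; [exact: measurable_cst|exact: msq].
  rewrite ge0_integralZl; last 4 first.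
  - exact: measurableT.
  - exact: msq.
  - by move=> x _; rewrite lee_fin sqr_ge0.
  - by rewrite lee_fin.
  rewrite ge0_integralZl; last 4 first.
  - exact: measurableT.
  - exact: msq.
  - by move=> x _; rewrite lee_fin sqr_ge0.
  - by rewrite lee_fin.
  have -> : C%:E = (2%:E * ((Num.sqrt pi ^+ 3) ^+ 2 * a2)%:E + (2 * (M ^+ 3) ^+ 2)%:E * a2%:E)%E.
    by rewrite -!EFinM -EFinD.
  rewrite a2E.
  by apply: leeD => //; apply: lee_wpmul2l; rewrite ?lee_fin//; exact: mollL2.
have imoll n a c : vol3.-integrable (box a c) (EFin \o moll b u n.+1%:R).
  apply: integrable_box => //; apply/integrableP; split.
    by apply/measurable_EFinP; exact: measurable_funX.
  under eq_integral do rewrite /= ger0_norm ?sqr_ge0//.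
  by apply: le_lt_trans (mollL2 n) _; exact: ltry.
have iMu a c : vol3.-integrable (box a c) (EFin \o (fun x => M ^+ 3 * u x)).
  have := integrableZl (measurable_box a c) (M ^+ 3) (integrable_box a c mu_ iu).
  exact.
have cvg0 a c (e : R) : 0 < e -> \forall n \near \oo,
    (`|\int[vol3]_(x in box a c) (dn n x)%:E| <= e%:E)%E.
  move=> e0; have := @cvg_box_moll a c.
  have lf : (\int[vol3]_(x in box a c) (M ^+ 3 * u x)%:E)%E \is a fin_num.
    exact: (integrable_fin_num (measurable_box _ _) (iMu a c)).
  move=> /(sube_cvg0 _ lf) H0; have H := iffRL (cvg_abse0P _) H0.
  have e0' : (0 < e%:E)%E by rewrite lte_fin.
  have Hn : \forall n \near \oo, (`|\int[vol3]_(x in box a c) (moll b u n.+1%:R x)%:E -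
      \int[vol3]_(x in box a c) (M ^+ 3 * u x)%:E| < e%:E)%E.
    exact: (H _ _ (open_ereal_lt' e0')).
  apply: filterS Hn => n /ltW; congr (_ <= _)%E; congr (`|_|)%E.
  rewrite -integralB_EFin; [|exact: measurable_box|exact: imoll|exact: iMu].
  by apply: eq_integral => x _; rewrite EFinB.
have cvgQ k a c : cvg0_on vol3 (Q k) dn (box a c).
  move=> e e0.
  have [a' [c' E]] : boxes (box a c `&` Q k).
    by apply: setI_closed_boxes; [exists a, c|exists ((- k%:R, - k%:R), - k%:R), ((k%:R, k%:R), k%:R)].
  by rewrite E; exact: cvg0.
have cvgT k : cvg0_on vol3 (Q k) dn setT by move=> e e0; rewrite setTI; exact: cvg0.
have cvgA k A : measurable A -> cvg0_on vol3 (Q k) dn A.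
  exact: (weak_cvg_boxes (measurable_box _ _) (vol3_box_lty _ _) mdn (dnC k) (cvgT k) (@cvgQ k)).
have null k (sg : R) : `|sg| = 1 ->
    {ae vol3, forall x, ~ (Q k x /\ potential G x < (sg * (M ^+ 3 * u x))%:E)%E}.
  move=> sg1; pose A := [set x | potential G x < (sg * (M ^+ 3 * u x))%:E]%E.
  have mMu : measurable_fun setT (fun x => sg * (M ^+ 3 * u x)).
    by apply: measurable_funM => //; apply: measurable_funM.
  have mA : measurable A.
    rewrite -[X in measurable X]setTI; apply: measurable_lte => //.
    exact/measurable_EFinP.
  pose f x := sg * (M ^+ 3 * u x) - fine (potential G x).
  have mAQ : measurable (A `&` Q k) by apply: measurableI => //; exact: measurable_box.
  have mf : measurable_fun (A `&` Q k) (fun x => (f x)%:E).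
    apply: measurable_funTS; apply/measurable_EFinP; apply: measurable_funB => //.
    exact: measurableT_comp.
  have P0 x := potential_ge0 G x.
  have PE x : A x -> potential G x = (fine (potential G x))%:E.
    by move=> Ax; rewrite fineK// ge0_fin_numE//; apply: lt_trans Ax _; exact: ltry.
  have f0 x : A x -> 0 < f x.
    by move=> Ax; rewrite subr_gt0 -lte_fin -PE.
  have idn n : vol3.-integrable (A `&` Q k) (EFin \o dn n).
    apply: (@integrableS _ _ _ vol3 (Q k)) => //; first exact: measurable_box.
    have := integrableB (measurable_box _ _) (imoll n _ _) (iMu _ _).
    move=> /(_ (- k%:R, - k%:R, - k%:R) (k%:R, k%:R, k%:R)).
    by apply: eq_integrable => [|x _]; [exact: measurable_box|rewrite /= EFinB].
  have If0 : (\int[vol3]_(x in A `&` Q k) `|(f x)%:E| = 0)%E.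
    apply/eqP; rewrite eq_le integral_ge0 ?andbT//.
    apply/lee_addgt0Pr => e e0; rewrite add0e.
    have [n _ /(_ n (leqnn _)) /= Hn] := cvgA k _ mA e e0.
    apply: le_trans Hn.
    apply: (@le_trans _ _ (\int[vol3]_(x in A `&` Q k) ((- sg)%:E * (dn n x)%:E))%E).
      apply: le_integral_ge0 => x [Ax _] //.
      rewrite /= gtr0_norm ?f0// -EFinM lee_fin /f /dn mulNr mulrBr opprB.
      rewrite lerD2l lerN2 -lee_fin -PE//.
      apply: le_trans (moll_le gb mu_ iu mG iG wp x (s0 n)); rewrite lee_fin.
      by apply: le_trans (ler_norm _) _; rewrite normrM sg1 mul1r.
    rewrite (integralZl mAQ (idn n)); apply: (le_trans (lee_abs _)).
    by rewrite abseM /= normrN sg1 mul1e.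
  have /(ae_eq_integral_abs _ mAQ mf) := If0.
  by apply: filterS => x H [Qx Ax]; have := f0 x Ax; move: H => /(_ (conj Ax Qx)) [->]; rewrite ltxx.
have null1 k := null k 1 (normr1 _).
have nullN k := null k (-1) (normrN1 _).
apply: filterS2 (ae_foralln null1) (ae_foralln nullN) => x h1 h2.
have [N1 H1] := nat_itv x.1.1; have [N2 H2] := nat_itv x.1.2; have [N3 H3] := nat_itv x.2.
pose k := maxn N1 (maxn N2 N3).
have Qx : Q k x.
  split; [split|].
  - by apply: H1; exact: leq_maxl.
  - by apply: H2; apply: leq_trans (leq_maxr _ _); exact: leq_maxl.
  - by apply: H3; apply: leq_trans (leq_maxr _ _); exact: leq_maxr.
rewrite leNgt; apply/negP.
have M30 : 0 <= M ^+ 3 by rewrite exprn_ge0.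
have [u0|u0] := ger0P (u x) => hP.
  by apply: (h1 k); split=> //; rewrite mul1r.
by apply: (h2 k); split=> //; rewrite mulN1r -mulrN.
Qed.

End averages.

(** * The cubic interpolation inequality *)

Section cube_energy.
Context {R : realType}.

(** From e^(1/4) >= 5/4. *)
Lemma expR1_ge : 61 / 25 <= expR 1 :> R.
Proof.
have h : 5 / 4 <= expR 4^-1 :> R by apply: le_trans (expR_ge1Dx _); lra.
have -> : expR 1 = expR 4^-1 ^+ 4 :> R by rewrite -expRM_natl; congr expR; lra.
apply: (@le_trans _ _ ((5 / 4) ^+ 4)); first by rewrite !exprS expr0; lra.
by rewrite lerXn2r ?nnegrE ?expR_ge0//; lra.
Qed.

(** For M = sqrt(pi) the left-hand side is 4 / (e pi), about 0.47; the loss of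
    two percent on M costs a factor 0.98^6. *)
Lemma bump_constant_le (M : R) : 49 / 50 * Num.sqrt pi <= M ->
  (expR (- 2^-1) / M ^+ 3) ^+ 2 * (4 * pi ^+ 2) <= 1.
Proof.
move=> hM; have g0 : 0 < Num.sqrt pi :> R by rewrite sqrtr_gt0 pi_gt0.
have M0 : 0 < M by apply: lt_le_trans hM; rewrite mulr_gt0//; lra.
have gE : Num.sqrt pi ^+ 2 = pi :> R by rewrite sqr_sqrtr// pi_ge0.
have h2 : (49 / 50) ^+ 2 * pi <= M ^+ 2.
  have a0 : 0 <= 49 / 50 * Num.sqrt pi :> R by rewrite mulr_ge0 ?(ltW g0)//; lra.
  by rewrite -gE -exprMn lerXn2r ?nnegrE ?(ltW M0).
have h6 : ((49 / 50) ^+ 2 * pi) ^+ 3 <= (M ^+ 2) ^+ 3.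
  by rewrite lerXn2r ?nnegrE ?sqr_ge0// mulr_ge0 ?pi_ge0// sqr_ge0.
have e2 : expR (- 2^-1) ^+ 2 = (expR 1)^-1 :> R.
  by rewrite -expRM_natl -expRN; congr expR; lra.
have -> : (expR (- 2^-1) / M ^+ 3) ^+ 2 * (4 * pi ^+ 2) =
    4 * pi ^+ 2 / (expR 1 * (M ^+ 2) ^+ 3).
  by rewrite expr_div_n e2; field; rewrite !gt_eqF ?expR_gt0.
rewrite ler_pdivrMr ?mul1r ?mulr_gt0 ?expR_gt0 ?exprn_gt0//.
have p2 : 2 <= pi :> R := pi_ge2 R.
apply: (le_trans _ (ler_pM _ _ expR1_ge h6)); last 2 first.
- by lra.
- by rewrite exprn_ge0// mulr_ge0 ?pi_ge0// sqr_ge0.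
rewrite exprMn.
have -> : (pi : R) ^+ 3 = pi ^+ 2 * pi by ring.
have pi20 : 0 <= (pi : R) ^+ 2 by exact: sqr_ge0.
have : (pi : R) ^+ 2 * 2 <= pi ^+ 2 * pi by rewrite ler_wpM2l.
set q := pi ^+ 2 * pi; have -> : ((49 / 50) ^+ 2) ^+ 3 = (49 ^+ 6 / 50 ^+ 6 : R).
  by rewrite -exprM -expr_div_n.
have : (442 / 500 : R) <= 49 ^+ 6 / 50 ^+ 6.
  by rewrite ler_pdivlMr ?exprn_gt0//; rewrite !exprS expr0; lra.
move: (49 ^+ 6 / 50 ^+ 6) => r; nra.
Qed.

Variables (u : R3 R -> R) (G : 'I_3 -> R3 R -> R).
Hypothesis mu_ : measurable_fun setT u.
Hypothesis iu : integrable3 (fun z => u z ^+ 2).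
Hypothesis mG : forall i, measurable_fun setT (G i).
Hypothesis iG : forall i, integrable3 (fun z => G i z ^+ 2).
Hypothesis wp : forall i, weak_partial i u (G i).

(** Tonelli: the kernel |x - z|^(-2) is moved from |grad u| to w^2. *)
Lemma integral_sqr_potential (w : R3 R -> R) : measurable_fun setT w -> (forall x, 0 <= w x) ->
  (\int[vol3]_x ((w x ^+ 2)%:E * potential G x) =
   \int[vol3]_z ((grad_norm G z * expR (- 2^-1))%:E * \int[vol3]_x (w x ^+ 2 / dsq x z)%:E))%E.
Proof.
move=> mw w0; have mg := measurable_grad_norm mG.
have md : measurable_fun setT (fun p : R3 R * R3 R => dsq p.1 p.2).
  by apply: measurable_fun_dsq; [exact: measurable_fst|exact: measurable_snd].
have md1 x : measurable_fun setT (fun z => dsq x z).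
  by apply: measurable_fun_dsq; [exact: measurable_cst|exact: measurable_id].
have md2 z : measurable_fun setT (fun x => dsq x z).
  by apply: measurable_fun_dsq; [exact: measurable_id|exact: measurable_cst].
transitivity (\int[vol3]_x \int[vol3]_z (w x ^+ 2 * (grad_norm G z * expR (- 2^-1) / dsq x z))%:E)%E.
  apply: eq_integral => x _; rewrite /potential.
  under [in RHS]eq_integral do rewrite EFinM.
  rewrite ge0_integralZl//; last 3 first.
  - apply/measurable_EFinP; apply: measurable_funM; [apply: measurable_funM => //|].
    exact: measurable_funV.
  - by move=> z _; rewrite lee_fin !mulr_ge0 ?invr_ge0 ?dsq_ge0 ?grad_norm_ge0 ?expR_ge0.
  - by rewrite lee_fin sqr_ge0.
rewrite (@tonelli_on _ _ _ _ _ vol3 vol3 setT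
  (fun x z => (w x ^+ 2 * (grad_norm G z * expR (- 2^-1) / dsq x z))%:E)) //; last first.
- by move=> x z; rewrite lee_fin !mulr_ge0 ?sqr_ge0 ?invr_ge0 ?dsq_ge0 ?grad_norm_ge0 ?expR_ge0.
- apply/measurable_EFinP; apply: measurable_funM.
    apply: measurable_funX; exact: (measurableT_comp mw measurable_fst).
  apply: measurable_funM; last exact: measurable_funV.
  apply: measurable_funM; last exact: measurable_cst.
  exact: (measurableT_comp mg measurable_snd).
apply: eq_integral => z _.
transitivity (\int[vol3]_x ((grad_norm G z * expR (- 2^-1))%:E * (w x ^+ 2 / dsq x z)%:E))%E.
  by apply: eq_integral => x _; rewrite -EFinM; congr EFin; ring.
rewrite ge0_integralZl//.
- apply/measurable_EFinP; apply: measurable_funM; first exact: measurable_funX.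
  exact: measurable_funV.
- by move=> x _; rewrite lee_fin !mulr_ge0 ?sqr_ge0 ?invr_ge0 ?dsq_ge0.
- by rewrite lee_fin mulr_ge0 ?grad_norm_ge0 ?expR_ge0.
Qed.

(** Since w <= |u|, w^3 is at most w^2 times the potential of the gradient, up
    to a constant. After [integral_sqr_potential], the arithmetic-geometric
    mean inequality separates |grad u| from the convolution of w^2 with
    |x|^(-2), and [riesz_square] bounds the square of the latter. *)
Lemma cube_le_energy (tau : R) (w : R3 R -> R) : 0 < tau -> measurable_fun setT w ->
  (forall x, 0 <= w x) -> (forall x, w x <= `|u x|) ->
  ((2 * tau)%:E * \int[vol3]_x (w x ^+ 3)%:E <=
   \int[vol3]_z (grad_norm G z ^+ 2)%:E +
   (tau ^+ 2)%:E * energy (fun x => w x ^+ 2)%R (fun x => w x ^+ 2)%R)%E.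
Proof.
move=> tau0 mw w0 wu; have mg := measurable_grad_norm mG.
have [b [b' [L [c [M gb]]]]] := @exists_good_bump R.
have g0 : 0 < Num.sqrt pi :> R by rewrite sqrtr_gt0 pi_gt0.
have hM := gb_mass_ge gb.
have M0 : 0 < M := good_bump_mass_gt0 gb.
have M30 : 0 < M ^+ 3 by rewrite exprn_gt0.
pose be := expR (- 2^-1) / M ^+ 3.
have be0 : 0 <= be by rewrite divr_ge0 ?expR_ge0// ltW.
have hbe : be ^+ 2 * (4 * pi ^+ 2) <= 1 := bump_constant_le hM.
pose F z := (\int[vol3]_x (w x ^+ 2 / dsq x z)%:E)%E.
have F0 z : (0 <= F z)%E.
  by apply: integral_ge0 => x _; rewrite lee_fin mulr_ge0 ?sqr_ge0 ?invr_ge0 ?dsq_ge0.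
have mF : measurable_fun setT F.
  apply: (@measurable_integral_on _ _ _ _ _ vol3 setT (fun z x => (w x ^+ 2 / dsq x z)%:E)) => //.
    apply/measurable_EFinP; apply: measurable_funM.
      apply: measurable_funX; exact: (measurableT_comp mw measurable_snd).
    by apply: measurable_funV; apply: measurable_fun_dsq; [exact: measurable_snd|exact: measurable_fst].
  by move=> z x; rewrite lee_fin mulr_ge0 ?sqr_ge0 ?invr_ge0 ?dsq_ge0.
have P0 x := potential_ge0 G x.
have mP := measurable_potential mG.
have mw3 : measurable_fun setT (fun x => (w x ^+ 3)%:E).
  by apply/measurable_EFinP; exact: measurable_funX.
have mw2 : measurable_fun setT (fun x => (w x ^+ 2)%:E).
  by apply/measurable_EFinP; exact: measurable_funX.
have step1 : ((M ^+ 3)%:E * \int[vol3]_x (w x ^+ 3)%:E <=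
    \int[vol3]_z ((grad_norm G z * expR (- 2^-1))%:E * F z))%E.
  rewrite -integral_sqr_potential// -ge0_integralZl//; last 2 first.
  - by move=> x _; rewrite lee_fin exprn_ge0.
  - by rewrite lee_fin ltW.
  apply: ae_ge0_le_integral => //.
  - by move=> x _; rewrite -EFinM lee_fin mulr_ge0 ?exprn_ge0// ltW.
  - by apply: measurable_fun_mule.
  - by move=> x _; rewrite mule_ge0// lee_fin sqr_ge0.
  - exact: measurable_fun_mule.
  apply: filterS (moll_ae_bound gb mu_ iu mG iG wp) => x hx _.
  apply: (@le_trans _ _ ((w x ^+ 2)%:E * (M ^+ 3 * `|u x|)%:E)%E).
    rewrite -!EFinM lee_fin [leRHS]mulrCA; apply: ler_wpM2l; first exact: ltW.
    by rewrite [w x ^+ 3]exprSr; apply: ler_wpM2l; rewrite ?sqr_ge0.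
  by apply: lee_wpmul2l; rewrite ?lee_fin ?sqr_ge0.
have mgE : measurable_fun setT (fun z => (grad_norm G z)%:E) by exact/measurable_EFinP.
have mFF : measurable_fun setT (fun z => F z * F z)%E by exact: measurable_fun_mule.
apply: (@le_trans _ _ ((2 * tau / M ^+ 3)%:E *
    \int[vol3]_z ((grad_norm G z * expR (- 2^-1))%:E * F z))%E).
  have -> : ((2 * tau)%:E = (2 * tau / M ^+ 3)%:E * (M ^+ 3)%:E)%E.
    by rewrite -EFinM divfK ?gt_eqF.
  rewrite -muleA; apply: lee_wpmul2l => //.
  by rewrite lee_fin divr_ge0 ?mulr_ge0// ltW.
rewrite -ge0_integralZl//; last 3 first.
- apply: measurable_fun_mule => //; apply/measurable_EFinP; exact: measurable_funM.
- by move=> z _; rewrite mule_ge0// lee_fin mulr_ge0 ?grad_norm_ge0 ?expR_ge0.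
- by rewrite lee_fin divr_ge0 ?mulr_ge0// ltW.
apply: (@le_trans _ _ (\int[vol3]_z ((grad_norm G z ^+ 2)%:E +
   ((tau * be) ^+ 2)%:E * (F z * F z)))%E).
  apply: le_integral_ge0 => z _.
    apply: mule_ge0; first by rewrite lee_fin divr_ge0 ?mulr_ge0// ltW.
    by rewrite mule_ge0// lee_fin mulr_ge0 ?grad_norm_ge0 ?expR_ge0.
  have tb0 : 0 <= tau * be by rewrite mulr_ge0// ltW.
  have := @amgm_ereal R 1 (grad_norm G z)%:E ((tau * be)%:E * F z) ltr01.
  rewrite lee_fin grad_norm_ge0 mule_ge0 ?lee_fin// => /(_ isT isT).
  rewrite invr1 !mul1e muleACA -!EFinM -!expr2; apply: le_trans.
  rewrite !muleA -!EFinM le_eqVlt; apply/orP; left; apply/eqP; congr (_%:E * _)%E.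
  by rewrite /be; field; rewrite gt_eqF.
rewrite ge0_integralD; last 5 first.
- exact: measurableT.
- by move=> z _; rewrite lee_fin sqr_ge0.
- by apply/measurable_EFinP; exact: measurable_funX.
- by move=> z _; rewrite mule_ge0 ?mule_ge0// lee_fin sqr_ge0.
- exact: measurable_fun_mule.
apply: leeD => //.
rewrite ge0_integralZl//; last 2 first.
- by move=> z _; rewrite mule_ge0.
- by rewrite lee_fin sqr_ge0.
have w20 x : 0 <= w x ^+ 2 by exact: sqr_ge0.
have mw2' : measurable_fun setT (fun x => w x ^+ 2) by exact: measurable_funX.
have := riesz_square mw2' w20; rewrite -/F => hR.
apply: (@le_trans _ _ (((tau * be) ^+ 2)%:E * ((4 * pi ^+ 2)%:E *
   energy (fun x => w x ^+ 2)%R (fun x => w x ^+ 2)%R))%E).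
  by apply: lee_wpmul2l => //; rewrite lee_fin sqr_ge0.
rewrite muleA -EFinM; apply: lee_wpmul2r; first exact: energy_ge0.
rewrite lee_fin exprMn -mulrA; rewrite -[leRHS]mulr1; apply: ler_wpM2l => //; exact: sqr_ge0.
Qed.

End cube_energy.

(** * Finiteness of the cubic integral and of the Coulomb energy *)

Section bootstrap.
Context {R : realType}.
Variables (u : R3 R -> R) (G : 'I_3 -> R3 R -> R).
Hypothesis mu_ : measurable_fun setT u.
Hypothesis iu : integrable3 (fun z => u z ^+ 2).
Hypothesis mG : forall i, measurable_fun setT (G i).
Hypothesis iG : forall i, integrable3 (fun z => G i z ^+ 2).
Hypothesis wp : forall i, weak_partial i u (G i).

Lemma grad_norm_sqr z : grad_norm G z ^+ 2 = \sum_(i < 3) G i z ^+ 2.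
Proof.
rewrite /grad_norm sqr_sqrtr ?addr_ge0 ?sqr_ge0//.
by rewrite !big_ord_recl big_ord0 addr0 addrA; congr (G _ z ^+ 2 + G _ z ^+ 2 + G _ z ^+ 2); exact: val_inj.
Qed.

Lemma integrable_grad_norm_sqr :
  integrable3 (fun z => grad_norm G z ^+ 2).
Proof.
have -> : EFin \o (fun z => grad_norm G z ^+ 2) =
    (fun z => \sum_(i < 3) (EFin \o (fun z => (G i z ^+ 2)%R)) z)%E.
  by apply/funext => z; rewrite /= grad_norm_sqr sumEFin.
exact: integrable_sum.
Qed.

Lemma integral_sqrE : (\int[vol3]_z (u z ^+ 2)%:E = (\int[vol3]_z (u z ^+ 2))%:E)%E.
Proof. by rewrite /Rintegral fineK//; exact: (integrable_fin_num measurableT iu). Qed.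

Let A := \int[vol3]_z (u z ^+ 2).
Let H := \int[vol3]_z (grad_norm G z ^+ 2).
Let C := 2 * (A + expR 1 ^+ 2 * (2 * Num.sqrt pi ^+ 3 / Num.sqrt 2)).

(** The cubic integral I of w = min(|u|, n) is finite because w^3 <= n w^2.
    With tau = 1/C the two inequalities give 2 I / C <= H + (A^2 + C I) / C^2,
    so half of the left-hand side absorbs I on the right, and the bound does
    not depend on n. *)
Lemma integral_truncated_cube (n : nat) :
  (\int[vol3]_x (Num.min `|u x| n%:R ^+ 3)%:E <= (C * H + A ^+ 2 / C)%:E)%E.
Proof.
pose w x := Num.min `|u x| n%:R.
have mw : measurable_fun setT w.
  by apply: measurable_minr => //; exact: measurableT_comp.
have w0 x : 0 <= w x by rewrite /w le_min normr_ge0 ler0n.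
have wu x : w x <= `|u x| by rewrite /w ge_min lexx.
have wn x : w x <= n%:R by rewrite /w ge_min lexx orbT.
have w2u x : w x ^+ 2 <= u x ^+ 2.
  by rewrite -[u x ^+ 2]real_normK ?num_real// lerXn2r ?nnegrE.
have A0 : 0 <= A by apply: Rintegral_ge0 => x _; exact: sqr_ge0.
have C0 : 0 < C.
  rewrite mulr_gt0// ltr_wpDl// mulr_gt0 ?exprn_gt0 ?expR_gt0// divr_gt0 ?sqrtr_gt0//.
  by rewrite mulr_gt0// exprn_gt0// sqrtr_gt0 pi_gt0.
have w2A : (\int[vol3]_x (w x ^+ 2)%:E <= A%:E)%E.
  rewrite -integral_sqrE; apply: le_integral_ge0 => x _; first by rewrite lee_fin sqr_ge0.
  by rewrite lee_fin.
have HE : (\int[vol3]_z (grad_norm G z ^+ 2)%:E = H%:E)%E.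
  rewrite /H /Rintegral fineK//.
  exact: (integrable_fin_num measurableT integrable_grad_norm_sqr).
have Ifin : (\int[vol3]_x (w x ^+ 3)%:E < +oo)%E.
  apply: (@le_lt_trans _ _ (\int[vol3]_x (n%:R%:E * (w x ^+ 2)%:E))%E).
    apply: le_integral_ge0 => x _; first by rewrite lee_fin exprn_ge0.
    by rewrite -EFinM lee_fin exprS ler_wpM2r ?sqr_ge0.
  rewrite ge0_integralZl//; last 2 first.
  - by apply/measurable_EFinP; exact: measurable_funX.
  - by move=> x _; rewrite lee_fin sqr_ge0.
  apply: (@le_lt_trans _ _ (n%:R%:E * A%:E)%E).
    by apply: lee_wpmul2l => //; rewrite lee_fin.
  by rewrite -EFinM ltry.
have I0 : (0 <= \int[vol3]_x (w x ^+ 3)%:E)%E.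
  by apply: integral_ge0 => x _; rewrite lee_fin exprn_ge0.
have Ci0 : 0 < C^-1 by rewrite invr_gt0.
have h1 := cube_le_energy mu_ iu mG iG wp Ci0 mw w0 wu.
have h2 := energy_sqr_le mw w0 w2A.
have Ci2 : (0 <= (C^-1 ^+ 2)%:E)%E by rewrite lee_fin sqr_ge0.
have := le_trans h1 (leeD (lexx _) (lee_wpmul2l Ci2 h2)).
rewrite HE -/C.
move: I0 Ifin; rewrite -/w; case: (\int[vol3]_x (w x ^+ 3)%:E)%E => // I I0 _.
rewrite -!EFinM -?EFinD -?EFinM -?EFinD !lee_fin.
have -> : H + C^-1 ^+ 2 * (A ^+ 2 + C * I) = (H + C^-1 ^+ 2 * A ^+ 2) + C^-1 * I.
  by field; rewrite gt_eqF.
move=> h; have {}h : C^-1 * I <= H + C^-1 ^+ 2 * A ^+ 2 by move: h; lra.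
have -> : C * H + A ^+ 2 / C = C * (H + C^-1 ^+ 2 * A ^+ 2).
  by field; rewrite gt_eqF.
by rewrite -ler_pdivrMl.
Qed.

(** Monotone convergence of the truncations. *)
Lemma cube_integrable : integrable3 (fun z => `|u z| ^+ 3).
Proof.
have mu3 : measurable_fun setT (fun z => `|u z| ^+ 3).
  by apply: measurable_funX; exact: measurableT_comp.
apply/integrableP; split; first exact/measurable_EFinP.
under eq_integral do rewrite /= normrX normr_id.
pose g (n : nat) x := (Num.min `|u x| n%:R ^+ 3)%:E.
have mg n : measurable_fun setT (g n).
  apply/measurable_EFinP; apply: measurable_funX.
  by apply: measurable_minr => //; exact: measurableT_comp.
have g0 n x : setT x -> (0 <= g n x)%E.
  by move=> _; rewrite lee_fin exprn_ge0// le_min normr_ge0 ler0n.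
have ndg x : setT x -> nondecreasing_seq (g ^~ x).
  move=> _ n m nm; rewrite lee_fin; apply: lerXn2r; rewrite ?nnegrE ?le_min ?normr_ge0 ?ler0n//.
  by rewrite !ge_min lexx /= ler_nat nm orbT.
have := @cvg_monotone_convergence _ _ _ vol3 setT measurableT g mg g0 ndg.
have -> : (fun x => limn (g ^~ x)) = (fun x => (`|u x| ^+ 3)%:E).
  apply/funext => x; apply/cvg_lim => //; apply: cvg_near_cst.
  exists (Num.truncn `|u x|).+1 => // n /= Nn; rewrite /g; congr ((_ ^+ 3)%:E).
  apply/min_idPl/ltW/(lt_le_trans (truncnS_gt _)); by rewrite ler_nat.
move=> cv; have cvn : cvgn (fun n => \int[vol3]_x g n x)%E by apply/cvg_ex; eexists; exact: cv.
rewrite -(cvg_lim _ cv)//; apply: (@le_lt_trans _ _ _ _ _ _ (ltry _)); last first.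
  apply: lime_le => //; apply: nearW => n; exact: integral_truncated_cube.
Qed.

Lemma energy_sqr_lty : (energy (fun x => u x ^+ 2)%R (fun x => u x ^+ 2)%R < +oo)%E.
Proof.
have mn : measurable_fun setT (fun z => `|u z|) by exact: measurableT_comp.
have nE : (fun x => `|u x| ^+ 2) = (fun x => u x ^+ 2).
  by apply/funext => x; rewrite real_normK// num_real.
have hA : (\int[vol3]_x (`|u x| ^+ 2)%:E <= (\int[vol3]_z (u z ^+ 2))%:E)%E.
  by under eq_integral do rewrite real_normK ?num_real//; rewrite integral_sqrE.
have := energy_sqr_le mn (fun x => normr_ge0 (u x)) hA.
rewrite nE => /le_lt_trans; apply.
have := integrable_fin_num measurableT cube_integrable => /fineK <-.
by rewrite -EFinM -EFinD ltry.
Qed.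

(** [cube_le_energy] for w = |u|, now between real numbers. *)
Lemma cube_le_self_energy (tau : R) : 0 < tau ->
  2 * tau * (\int[vol3]_x (`|u x| ^+ 3)) <= (\int[vol3]_z (grad_norm G z ^+ 2))
   + tau ^+ 2 * fine (energy (fun x => u x ^+ 2)%R (fun x => u x ^+ 2)%R).
Proof.
move=> tau0; have mn : measurable_fun setT (fun z => `|u z|) by exact: measurableT_comp.
have nE : (fun x => `|u x| ^+ 2) = (fun x => u x ^+ 2).
  by apply/funext => x; rewrite real_normK// num_real.
have := cube_le_energy mu_ iu mG iG wp tau0 mn (fun x => normr_ge0 (u x)) (fun x => lexx _).
rewrite nE.
have := integrable_fin_num measurableT cube_integrable => /fineK <-.
have := integrable_fin_num measurableT integrable_grad_norm_sqr => /fineK <-.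
have Ef : energy (fun x => u x ^+ 2)%R (fun x => u x ^+ 2)%R \is a fin_num.
  by rewrite ge0_fin_numE ?energy_sqr_lty//; apply: energy_ge0 => x; exact: sqr_ge0.
by rewrite -(fineK Ef) -!EFinM -EFinD lee_fin.
Qed.

End bootstrap.

(** * Pointwise estimates of the nonlinearity *)

Section pointwise.
Context {R : realType}.
Implicit Types (p lambda s a b t : R).

Lemma powRV (a r : R) : 0 <= a -> a^-1 `^ r = (a `^ r)^-1.
Proof. by move=> a0; rewrite -powR_inv1// -powRrM mulN1r powRN. Qed.

Lemma threshold_ge0 p lambda : 0 <= threshold p lambda.
Proof. by rewrite /threshold; case: ifP => // _; rewrite mulr_ge0 ?powR_ge0// divr_ge0 ?sqr_ge0. Qed.

(** The coefficient of the cubic terms in the growth bound [powR_cubic_le],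
    recovered from the threshold. *)
Definition cubic_coef p lambda : R := 2 * Num.sqrt (threshold p lambda).

Lemma cubic_coef_sqr p lambda : (cubic_coef p lambda / 2) ^+ 2 = threshold p lambda.
Proof. by rewrite /cubic_coef [2 * _]mulrC mulfK// sqr_sqrtr ?threshold_ge0. Qed.

Lemma cubic_coef_gt0 p lambda : 1 < p <= 2 -> 0 < lambda -> 0 < cubic_coef p lambda.
Proof.
move=> /andP[p1 p2] l0; rewrite mulr_gt0// sqrtr_gt0 /threshold; case: ifP => // plt2.
rewrite mulr_gt0 ?divr_gt0 ?exprn_gt0 ?powR_gt0//; first by rewrite subr_gt0.
by rewrite divr_gt0 ?powR_gt0// mulr_gt0 ?powR_gt0// subr_gt0.
Qed.

(** For p < 2 and th = p - 1, the weighted arithmetic-geometric mean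
    inequality X^(1-th) Y^th <= (1-th) X + th Y, with X and Y chosen such that
    the right-hand side is the affine function and the left-hand side is s^th.
    This choice is the origin of the formula for the threshold. For p = 2 the
    coefficient is 4 and the inequality is s <= lambda/2 + s. *)
Lemma powR_affine_le p lambda s : 1 < p <= 2 -> 0 < lambda -> 0 <= s ->
  s `^ (p - 1) <= lambda / 2 + cubic_coef p lambda / 4 * s.
Proof.
move=> /andP[p1 p2] l0 s0; rewrite /cubic_coef /threshold.
have [plt2|] := ltP p 2; last first.
  move=> p2'; have -> : p = 2 by apply/eqP; rewrite eq_le p2 p2'.
  have -> : Num.sqrt 4 = 2 :> R.
    by have -> : 4 = 2 ^+ 2 :> R; [ring|rewrite sqrtr_sqr ger0_norm].
  have -> : 2 - 1 = 1 :> R by ring.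
  by rewrite powRr1//; lra.
set B := _ / _ `^ _.
pose th := p - 1; have th0 : 0 < th by rewrite subr_gt0.
have c0 : 0 < 2 - p by rewrite subr_gt0.
have thE : 2 - p = 1 - th by rewrite /th; ring.
have B0 : 0 < B by rewrite divr_gt0 ?powR_gt0// mulr_gt0 ?powR_gt0.
have -> : Num.sqrt ((p - 1) ^+ 2 / 4 * B `^ (2 / (p - 1))) = th / 2 * B `^ th^-1.
  have -> : (p - 1) ^+ 2 / 4 * B `^ (2 / (p - 1)) = (th / 2 * B `^ th^-1) ^+ 2.
    rewrite exprMn -[(B `^ _) ^+ 2]powR_mulrn ?powR_ge0// -powRrM [th^-1 * _]mulrC.
    by congr (_ * _); rewrite /th; field.
  by rewrite sqrtr_sqr ger0_norm// mulr_ge0 ?powR_ge0// divr_ge0// ltW.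
pose X := lambda / 2 / (2 - p); pose Y := B `^ th^-1 * s / 4.
have X0 : 0 <= X by rewrite !divr_ge0// ltW.
have Y0 : 0 <= Y by rewrite divr_ge0// mulr_ge0 ?powR_ge0.
have c'0 : 0 < (2 - p)^-1 by rewrite invr_gt0.
have th'0 : 0 < th^-1 by rewrite invr_gt0.
have conj : (2 - p)^-1^-1 + th^-1^-1 = 1 by rewrite !invrK thE; ring.
have := conjugate_powR (powR_ge0 X (2 - p)) (powR_ge0 Y th) c'0 th'0 conj.
rewrite -!powRrM !divff ?gt_eqF// !powRr1// !invrK.
have -> : X * (2 - p) + Y * th = lambda / 2 + 2 * (th / 2 * B `^ th^-1) / 4 * s.
  by rewrite /X /Y; field; rewrite gt_eqF.
apply: le_trans; rewrite le_eqVlt; apply/orP; left; apply/eqP.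
have l2 : 0 <= lambda / 2 by rewrite divr_ge0// ltW.
rewrite /X /Y powRM ?invr_ge0 ?(ltW c0)// [(lambda / 2) `^ _]powRM ?(ltW l0) ?invr_ge0//.
rewrite powRM ?invr_ge0 ?mulr_ge0 ?powR_ge0// powRM ?powR_ge0//.
rewrite -powRrM mulVf ?gt_eqF// powRr1 ?(ltW B0)// !powRV ?(ltW c0)// -/th.
have -> : 4 `^ th = 2 `^ (2 * th) :> R.
  by rewrite powRrM powR_mulrn//; congr (_ `^ _); ring.
rewrite /B; have -> : 2 `^ p = 2 `^ (2 - p) * 2 `^ (2 * th) :> R.
  rewrite -powRD; last by apply/implyP => _; rewrite pnatr_eq0.
  by congr (_ `^ _); rewrite /th; ring.
by field; rewrite !gt_eqF ?powR_gt0.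
Qed.

(** With s = a + b one has a^2 + b^2 >= s^2/2 and a^3 + b^3 >= s^3/4, so the
    claim reduces to [powR_affine_le] multiplied by s^2. *)
Lemma powR_cubic_le p lambda a b : 1 < p <= 2 -> 0 < lambda -> 0 <= a -> 0 <= b ->
  (a + b) * (a + b) `^ p <=
  lambda * (a ^+ 2 + b ^+ 2) + cubic_coef p lambda * (a ^+ 3 + b ^+ 3).
Proof.
move=> hp l0 a0 b0; set s := a + b.
have s0 : 0 <= s by rewrite addr_ge0.
have p0 : 0 < p by case/andP: hp => p1 _; apply: lt_trans p1.
have A0 := ltW (cubic_coef_gt0 hp l0).
rewrite -mulr_powRB1// mulrA -expr2.
apply: (@le_trans _ _ (s ^+ 2 * (lambda / 2 + cubic_coef p lambda / 4 * s))).
  by apply: ler_wpM2l; [exact: sqr_ge0|exact: powR_affine_le].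
have h2 : s ^+ 2 / 2 <= a ^+ 2 + b ^+ 2.
  by rewrite /s; have := sqr_ge0 (a - b); lra.
have h3 : s ^+ 3 / 4 <= a ^+ 3 + b ^+ 3.
  rewrite -subr_ge0.
  have -> : a ^+ 3 + b ^+ 3 - s ^+ 3 / 4 = 3 / 4 * (s * (a - b) ^+ 2) by rewrite /s; field.
  by rewrite mulr_ge0// mulr_ge0 ?sqr_ge0.
have -> : s ^+ 2 * (lambda / 2 + cubic_coef p lambda / 4 * s) =
  lambda * (s ^+ 2 / 2) + cubic_coef p lambda * (s ^+ 3 / 4) by field.
by apply: lerD; apply: ler_wpM2l => //; exact: ltW.
Qed.

Lemma cnorm_add_le a b t : cnorm (a%:C + expi t * b%:C)%C <= `|a| + `|b|.
Proof.
rewrite /cnorm normc_def /=.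
rewrite -[leRHS]ger0_norm ?addr_ge0// -sqrtr_sqr ler_wsqrtr//.
have -> : (a + (cos t * b - sin t * 0)) ^+ 2 + (0 + (cos t * 0 + sin t * b)) ^+ 2 =
  a ^+ 2 + 2 * (a * b * cos t) + (cos t ^+ 2 + sin t ^+ 2) * b ^+ 2 by ring.
rewrite cos2Dsin2 mul1r sqrrD !real_normK ?num_real// lerD2r lerD2l -[leRHS]mulr_natl.
rewrite ler_wpM2l// -normrM; apply: le_trans (ler_norm _) _.
rewrite [leLHS]normrM; apply: ler_piMr => //.
by rewrite ler_norml cos_geN1 cos_le1.
Qed.

Lemma Re_phase_average_le p a b : 1 < p ->
  `|complex.Re (phase_average p a b)| <= (`|a| + `|b|) `^ p.
Proof.
move=> p1; set s := `|a| + `|b|; have s0 : 0 <= s by rewrite addr_ge0.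
have p0 : 0 < p by apply: lt_trans p1.
have pi0 : 0 < 2 * pi :> R by rewrite mulr_gt0 ?pi_gt0.
pose f t : R := complex.Re ((cnorm (a%:C + expi t * b%:C) `^ (p - 1))%:C
              * (a%:C + expi t * b%:C))%C.
have fs t : `|f t| <= s `^ p.
  rewrite /f /= mul0r subr0 normrM ger0_norm ?powR_ge0//.
  rewrite -(mulr_powRB1 s0 p0) [leRHS]mulrC; apply: ler_pM => //; first exact: powR_ge0.
    apply: ge0_ler_powR; rewrite ?nnegrE//.
    - by rewrite subr_ge0 ltW.
    - by rewrite /cnorm normc_def /= sqrtr_ge0.
    - exact: cnorm_add_le.
  rewrite mulr0 subr0; apply: le_trans (ler_normD _ _) _; rewrite lerD2l normrM.
  by apply: ler_piMl => //; rewrite ler_norml cos_geN1 cos_le1.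
have -> : complex.Re (phase_average p a b) =
    (2 * pi)^-1 * \int[@lebesgue_measure R]_(t in `[0, 2 * pi]) f t.
  by rewrite /phase_average /Cintegral /= mul0r subr0.
have I := @abse_integral_le _ _ _ (@lebesgue_measure R) `[0, 2 * pi]%classic
   (fun t => (f t)%:E) (fun=> (s `^ p)%:E).
have {I} : (`|\int[@lebesgue_measure R]_(t in `[0%R, (2 * pi)%R]) (f t)%:E| <=
    (s `^ p * (2 * pi) : R)%R%:E)%E.
  apply: le_trans (I _) _; first by move=> t _; rewrite lee_fin.
  rewrite integral_cst//= lebesgue_measure_itv /= lte_fin pi0.
  by rewrite -EFinB subr0 -EFinM.
rewrite /Rintegral normrM gtr0_norm ?invr_gt0//.
case: (\int[_]_(_ in _) _)%E => [r| |] //=; rewrite ?lee_fin.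
by move=> h; rewrite ler_pdivrMl// mulrC.
Qed.

End pointwise.

(** * Testing the equation with its solution *)

Section sobolev.
Context {R : realType}.
Implicit Types (u v w : R3 R -> R) (G : 'I_3 -> R3 R -> R).

Lemma Lfun2P u : u \in Lfun (@lebesgue3 R) 2%:E ->
  measurable_fun setT u /\ integrable3 (fun z => u z ^+ 2).
Proof.
move=> hu; split; last exact: (@Lfun2_integrable_sqr _ _ _ (@vol3 R) u hu).
by move: hu; rewrite inE => /andP[+ _]; rewrite inE /=.
Qed.

Lemma H1_gradP u G : H1_grad u G ->
  [/\ measurable_fun setT u,
      integrable3 (fun z => u z ^+ 2),
      forall i, measurable_fun setT (G i),
      forall i, integrable3 (fun z => G i z ^+ 2) &
      forall i, weak_partial i u (G i)].
Proof.
move=> [/Lfun2P[mu_ iu] hG]; split => // i; have [hGi wGi] := hG i => //;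
  by have [] := Lfun2P hGi.
Qed.

Lemma H1_grad0 : @H1_grad R (fun=> 0) (fun _ _ => 0).
Proof.
have L0 : (fun=> 0) \in Lfun (@lebesgue3 R) 2%:E.
  rewrite inE; apply/andP; split; rewrite inE /=; first exact: measurable_cst.
  by rewrite /finite_norm Lnorm0.
split => // i; split => // f _.
by rewrite /Rintegral !integral0_eq ?oppr0 => // x _; rewrite mul0r.
Qed.

Definition self_energy w : R := fine (energy (fun x => w x ^+ 2)%R (fun x => w x ^+ 2)%R).
Definition mutual_energy v w : R := fine (energy (fun x => v x ^+ 2)%R (fun x => w x ^+ 2)%R).

(** The potential of w^2 may be infinite at some points, where [coulomb] takes
    the value 0. Finiteness of the energy confines this to a null set, apart
    from the zeros of v, where both integrands vanish. *)
Lemma coulomb_energy v w : measurable_fun setT v -> measurable_fun setT w ->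
  (energy (fun x => v x ^+ 2)%R (fun x => w x ^+ 2)%R < +oo)%E ->
  integrable3 (fun x => coulomb w x * v x ^+ 2) /\
  \int[vol3]_x (coulomb w x * v x ^+ 2) = mutual_energy v w.
Proof.
move=> mv mw Efin.
pose P x := (\int[vol3]_y (w y ^+ 2 / dist3 x y)%:E)%E.
have P0 x : (0 <= P x)%E.
  by apply: integral_ge0 => y _; rewrite lee_fin mulr_ge0 ?sqr_ge0 ?invr_ge0 ?dist3_ge0.
have md x : measurable_fun setT (fun y => dist3 x y).
  by apply: measurable_fun_dist3; [exact: measurable_cst|exact: measurable_id].
have mk x : measurable_fun setT (fun y => (w y ^+ 2 / dist3 x y)%:E).
  apply/measurable_EFinP; apply: measurable_funM; first exact: measurable_funX.
  exact: measurable_funV.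
have mP : measurable_fun setT P.
  apply: (@measurable_integral_on _ _ _ _ _ vol3 setT (fun x y => (w y ^+ 2 / dist3 x y)%:E)) => //.
    apply/measurable_EFinP; apply: measurable_funM.
      apply: measurable_funX; exact: (measurableT_comp mw measurable_snd).
    by apply: measurable_funV; apply: measurable_fun_dist3; [exact: measurable_fst|exact: measurable_snd].
  by move=> x y; rewrite lee_fin mulr_ge0 ?sqr_ge0 ?invr_ge0 ?dist3_ge0.
have mv2 : measurable_fun setT (fun x => (v x ^+ 2)%:E).
  by apply/measurable_EFinP; exact: measurable_funX.
pose g x := ((v x ^+ 2)%:E * P x)%E.
have mg : measurable_fun setT g by exact: measurable_fun_mule.
have g0 x : (0 <= g x)%E by rewrite mule_ge0// lee_fin sqr_ge0.
have EE : energy (fun x => v x ^+ 2)%R (fun x => w x ^+ 2)%R = (\int[vol3]_x g x)%E.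
  apply: eq_integral => x _; rewrite /g /P -ge0_integralZl; last 4 first.
  - exact: measurableT.
  - exact: mk.
  - by move=> y _; rewrite lee_fin mulr_ge0 ?sqr_ge0 ?invr_ge0 ?dist3_ge0.
  - by rewrite lee_fin sqr_ge0.
  by apply: eq_integral => y _; rewrite -EFinM; congr EFin; ring.
have ig : vol3.-integrable setT g.
  apply/integrableP; split => //.
  by under eq_integral do rewrite gee0_abs//; rewrite -EE.
have mc : measurable_fun setT (coulomb w) by exact: (measurableT_comp _ mP).
have mcv : measurable_fun setT (fun x => coulomb w x * v x ^+ 2).
  by apply: measurable_funM => //; exact: measurable_funX.
have aeE : ae_eq vol3 setT (EFin \o (fun x => coulomb w x * v x ^+ 2)) g.
  have := integrable_ae measurableT ig; apply: filterS => x hx _ /=.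
  have {hx} := hx I; rewrite /g /coulomb /Rintegral -/(P x).
  have [->|v0] := eqVneq (v x) 0; first by rewrite expr0n /= mulr0 mul0e.
  have v20 : 0 < v x ^+ 2 by rewrite exprn_even_gt0.
  move: (P0 x); case: (P x) => [r| |] //= _; first by rewrite mulrC.
  by rewrite mulry gtr0_sg// mul1e.
have IE : (\int[vol3]_x (coulomb w x * v x ^+ 2)%:E = \int[vol3]_x g x)%E.
  by apply: ae_eq_integral => //; exact/measurable_EFinP.
have c0 x : 0 <= coulomb w x * v x ^+ 2.
  rewrite mulr_ge0 ?sqr_ge0//; apply: Rintegral_ge0 => y _.
  by rewrite mulr_ge0 ?sqr_ge0 ?invr_ge0 ?dist3_ge0.
split; last by rewrite /mutual_energy EE -IE.
apply/integrableP; split; first exact/measurable_EFinP.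
under eq_integral do rewrite /= ger0_norm//.
by rewrite IE -EE.
Qed.

Lemma mutual_energy_le u v (t : R) : 0 < t ->
  measurable_fun setT u -> measurable_fun setT v ->
  (energy (fun x => u x ^+ 2)%R (fun x => u x ^+ 2)%R < +oo)%E ->
  (energy (fun x => v x ^+ 2)%R (fun x => v x ^+ 2)%R < +oo)%E ->
  (energy (fun x => u x ^+ 2)%R (fun x => v x ^+ 2)%R < +oo)%E /\
  2 * mutual_energy u v <= t * self_energy u + t^-1 * self_energy v.
Proof.
move=> t0 mu_ mv_ Eu Ev.
have sq (w : R3 R -> R) x : 0 <= w x ^+ 2 by exact: sqr_ge0.
have m2 (w : R3 R -> R) : measurable_fun setT w -> measurable_fun setT (fun x => w x ^+ 2).
  by move=> ?; exact: measurable_funX.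
have := energy_cauchy_schwarz t0 (m2 _ mu_) (m2 _ mv_) (sq u) (sq v).
rewrite /mutual_energy /self_energy.
move: (energy_ge0 (sq u) (sq u)) (energy_ge0 (sq v) (sq v)) (energy_ge0 (sq u) (sq v)) Eu Ev.
move: (energy _ _) (energy _ _) (energy _ _) => a b c; clear.
case: a => [a||]//; case: b => [b||]//; case: c => [c||]//= _ _ _ _ _.
  by rewrite -!EFinM -EFinD lee_fin ltry.
by rewrite mulry gtr0_sg// mul1e -!EFinM -EFinD leye_eq.
Qed.

(** The real part of the weak equation, tested with the solution itself. *)
Lemma energy_identity (lambda m m' : R) u G v (N : R3 R -> R[i]) : H1_grad u G ->
  measurable_fun setT v ->
  (energy (fun x => u x ^+ 2)%R (fun x => u x ^+ 2)%R < +oo)%E ->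
  (energy (fun x => u x ^+ 2)%R (fun x => v x ^+ 2)%R < +oo)%E ->
  weak_equation lambda (fun x => m * coulomb u x - m' * coulomb v x) N u G ->
  (\int[vol3]_x (grad_norm G x ^+ 2)) + lambda * (\int[vol3]_x (u x ^+ 2))
    + m * self_energy u - m' * mutual_energy u v
  = \int[vol3]_x (complex.Re (N x) * u x).
Proof.
move=> hu mv Eu Ev weq; have [mu_ iu mG iG wp] := H1_gradP hu.
have := congr1 (@complex.Re R) (weq u G hu).
rewrite /Cintegral /=.
have [iuu uuE] := coulomb_energy mu_ mu_ Eu.
have [iuv uvE] := coulomb_energy mu_ mv Ev.
have ig := integrable_grad_norm_sqr iG.
move=> H; transitivity (\int[vol3]_x (\sum_(i < 3) G i x * G i x + lambda * u x * u x
   + (m * coulomb u x - m' * coulomb v x) * u x * u x)); last first.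
  rewrite -[LHS]/(\int[lebesgue3 R]_x (\sum_(i < 3) G i x * G i x + lambda * u x * u x
   + (m * coulomb u x - m' * coulomb v x) * u x * u x)) H.
  by apply: eq_Rintegral => x _; case: (N x) => a b /=; rewrite mulr0 subr0.
pose f1 x := grad_norm G x ^+ 2; pose f2 x := lambda * u x ^+ 2.
pose f3 x := m * (coulomb u x * u x ^+ 2); pose f4 x := m' * (coulomb v x * u x ^+ 2).
have i2 : integrable3 f2 := integrableZl measurableT lambda iu.
have i3 : integrable3 f3 := integrableZl measurableT m iuu.
have i4 : integrable3 f4 := integrableZl measurableT m' iuv.
have i12 : integrable3 (fun x => f1 x + f2 x) := integrableD measurableT ig i2.
have i123 : integrable3 (fun x => f1 x + f2 x + f3 x) := integrableD measurableT i12 i3.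
transitivity (\int[vol3]_x (f1 x + f2 x + f3 x - f4 x)).
  rewrite (RintegralB measurableT i123 i4) (RintegralD measurableT i12 i3) (RintegralD measurableT ig i2).
  by rewrite !RintegralZl// uuE uvE.
apply: eq_Rintegral => x _; rewrite /f1 grad_norm_sqr /f2 /f3 /f4.
under [X in _ = X + _ + _]eq_bigr do rewrite -expr2.
by ring.
Qed.

Lemma integral_phase_average_le (p : R) u v : 1 < p -> measurable_fun setT u -> measurable_fun setT v ->
  integrable3 (fun x => `|u x| * (`|u x| + `|v x|) `^ p) ->
  \int[vol3]_x (complex.Re (phase_average p (u x) (v x)) * u x) <=
  \int[vol3]_x (`|u x| * (`|u x| + `|v x|) `^ p).
Proof.
move=> p1 mu_ mv_ ig.
have := @abse_integral_le _ _ _ (@vol3 R) setT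
  (fun x => (complex.Re (phase_average p (u x) (v x)) * u x)%:E)
  (fun x => (`|u x| * (`|u x| + `|v x|) `^ p)%:E).
have h x : setT x -> (`|(complex.Re (phase_average p (u x) (v x)) * u x)%:E| <=
    (`|u x| * (`|u x| + `|v x|) `^ p)%:E)%E.
  move=> _; rewrite /= lee_fin normrM mulrC ler_wpM2l//.
  exact: Re_phase_average_le.
move=> /(_ h); rewrite /Rintegral; have := integrable_fin_num measurableT ig.
case: (\int[_]_x (`|u x| * _)%:E)%E => // b _.
case: (\int[_]_x _)%E => // a; rewrite /= lee_fin; exact: le_trans (ler_norm _).
Qed.

End sobolev.

(** * Nonexistence *)

Section coupling.
Context {R : realType}.
Variables mu11 mu22 mu12 : R.
Hypothesis (mu11_gt0 : 0 < mu11) (mu22_gt0 : 0 < mu22) (mu12_gt0 : 0 < mu12).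

Let kap := (mu11 * mu22 - mu12 ^+ 2) / (mu11 + mu22).
Let t := (mu11 - kap) / mu12.

Let tr0 : 0 < mu11 + mu22. Proof. by rewrite addr_gt0. Qed.

Let d0 : 0 < mu11 - kap.
Proof.
have -> : mu11 - kap = (mu11 ^+ 2 + mu12 ^+ 2) / (mu11 + mu22).
  by rewrite /kap; field; rewrite gt_eqF.
by rewrite divr_gt0// addr_gt0 ?exprn_gt0.
Qed.

Lemma coupling_weight_gt0 : 0 < t.
Proof. by rewrite divr_gt0. Qed.

(** The coupling matrix, with off-diagonal entries -mu12, has after
    subtraction of kap times the identity the determinant kap^2 and a positive
    trace, so its quadratic form is nonnegative; t is the weight in
    Cauchy-Schwarz for which this form appears. *)
Lemma coupling_form_le (a b m n : R) : 0 <= b ->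
  2 * m <= t * a + t^-1 * b -> 2 * n <= t^-1 * b + t * a ->
  mu12 * (m + n) <= (mu11 - kap) * a + (mu22 - kap) * b.
Proof.
move=> b0 hm hn.
have m1 : mu12 * t = mu11 - kap by rewrite /t mulrC divfK// gt_eqF.
have m2 : mu12 * t^-1 <= mu22 - kap.
  rewrite /t invf_div mulrA ler_pdivrMr// -expr2 -subr_ge0.
  have -> : (mu22 - kap) * (mu11 - kap) - mu12 ^+ 2 = kap ^+ 2.
    by rewrite /kap; field; rewrite gt_eqF.
  exact: sqr_ge0.
apply: (@le_trans _ _ (mu12 * (t * a + t^-1 * b))).
  apply: ler_wpM2l; first exact: ltW.
  by move: (t * a) (t^-1 * b) hm hn => x y; lra.
have -> : mu12 * (t * a + t^-1 * b) = mu12 * t * a + mu12 * t^-1 * b.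
  by rewrite mulrDr !mulrA.
by rewrite m1 lerD2l ler_wpM2r.
Qed.

End coupling.

(** The arithmetic end of the argument: hu, au, cu and du stand for the
    integrals of |grad u|^2, u^2 and |u|^3 and for the self-energy of u, muv
    for a mutual energy. The sum of the inequalities leaves only the
    self-energies. *)
Lemma energies_le0 (R : realType) (th kap lambda A mu11 mu22 mu12 : R)
    (hu hv au av cu cv du dv muv mvu : R) : th < kap ->
  (hu + lambda * au + mu11 * du - mu12 * muv)
    + (hv + lambda * av + mu22 * dv - mu12 * mvu)
    <= lambda * (au + av) + A * (cu + cv) ->
  A * cu <= hu + th * du -> A * cv <= hv + th * dv ->
  mu12 * (muv + mvu) <= (mu11 - kap) * du + (mu22 - kap) * dv ->
  du + dv <= 0.
Proof.
move=> thk rhs hcu hcv mut.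
have key : (kap - th) * (du + dv) <= 0 by clear thk; lra.
by move: key; rewrite pmulr_rle0// subr_gt0.
Qed.

Section nonexistence.
Context {R : realType}.
Implicit Types (u v : R3 R -> R) (G : 'I_3 -> R3 R -> R).

(** The two integrands add up to (|u| + |v|)^(p+1), to which [powR_cubic_le]
    applies. *)
Lemma integral_nonlinearity_le (p lambda : R) u v : 1 < p <= 2 -> 0 < lambda ->
  measurable_fun setT u -> measurable_fun setT v ->
  integrable3 (fun x => u x ^+ 2) ->
  integrable3 (fun x => v x ^+ 2) ->
  integrable3 (fun x => `|u x| ^+ 3) ->
  integrable3 (fun x => `|v x| ^+ 3) ->
  \int[vol3]_x (complex.Re (phase_average p (u x) (v x)) * u x) +
  \int[vol3]_x (complex.Re (phase_average p (v x) (u x)) * v x) <=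
  lambda * (\int[vol3]_x (u x ^+ 2) + \int[vol3]_x (v x ^+ 2)) +
  cubic_coef p lambda * (\int[vol3]_x (`|u x| ^+ 3) + \int[vol3]_x (`|v x| ^+ 3)).
Proof.
move=> hp l0 mu_ mv iu iv iu3 iv3; have /andP[p1 _] := hp.
pose s x := `|u x| + `|v x|; pose sp x := s x `^ p.
pose A := cubic_coef p lambda; have A0 : 0 < A by exact: cubic_coef_gt0.
have nu : measurable_fun setT (fun x => `|u x|) by exact: measurableT_comp.
have nv : measurable_fun setT (fun x => `|v x|) by exact: measurableT_comp.
have ms : measurable_fun setT s by exact: measurable_funD.
have msp : measurable_fun setT sp.
  by apply: (@measurableT_comp _ _ _ _ _ _ (fun y => y `^ p)) => //; exact: measurable_powR.
have s0 x : 0 <= s x by rewrite addr_ge0.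
pose bd x := lambda * (u x ^+ 2 + v x ^+ 2) + A * (`|u x| ^+ 3 + `|v x| ^+ 3).
have bdE x : s x * sp x <= bd x.
  have := powR_cubic_le hp l0 (normr_ge0 (u x)) (normr_ge0 (v x)).
  by rewrite !real_normK ?num_real.
have i2 : integrable3 (fun x => u x ^+ 2 + v x ^+ 2) := integrableD measurableT iu iv.
have i3 : integrable3 (fun x => `|u x| ^+ 3 + `|v x| ^+ 3) := integrableD measurableT iu3 iv3.
have i2l : integrable3 (fun x => lambda * (u x ^+ 2 + v x ^+ 2)) := integrableZl measurableT lambda i2.
have i3A : integrable3 (fun x => A * (`|u x| ^+ 3 + `|v x| ^+ 3)) := integrableZl measurableT A i3.
have ibd : integrable3 bd := integrableD measurableT i2l i3A.
have sub (f : R3 R -> R) : measurable_fun setT f -> (forall x, 0 <= f x) ->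
    (forall x, f x <= s x) -> integrable3 (fun x => f x * sp x).
  move=> mf f0 fs; apply: (le_integrable measurableT _ _ ibd).
    by apply/measurable_EFinP; exact: measurable_funM.
  move=> x _ /=; rewrite lee_fin ger0_norm; last by rewrite mulr_ge0 ?powR_ge0.
  apply: le_trans (ler_norm _); apply: le_trans (bdE x).
  by rewrite ler_wpM2r ?powR_ge0.
have su x : `|u x| <= s x by rewrite lerDl.
have sv x : `|v x| <= s x by rewrite lerDr.
have iu' := sub _ nu (fun x => normr_ge0 (u x)) su.
have iv' := sub _ nv (fun x => normr_ge0 (v x)) sv.
have ivu : integrable3 (fun x => `|v x| * (`|v x| + `|u x|) `^ p).
  by apply: eq_integrable iv' => // x _; rewrite /= /sp /s addrC.
apply: (le_trans (lerD (integral_phase_average_le p1 mu_ mv iu') (integral_phase_average_le p1 mv mu_ ivu))).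
have -> : \int[vol3]_x (`|v x| * (`|v x| + `|u x|) `^ p) = \int[vol3]_x (`|v x| * sp x).
  by apply: eq_Rintegral => x _; rewrite /sp /s addrC.
rewrite -(RintegralD measurableT iu' iv').
have isp : integrable3 (fun x => `|u x| * sp x + `|v x| * sp x) := integrableD measurableT iu' iv'.
apply: (@le_trans _ _ (\int[vol3]_x bd x)).
  apply: (le_Rintegral measurableT isp ibd) => x _.
  by have := bdE x; rewrite {1}/s mulrDl.
rewrite /bd (RintegralD measurableT i2l i3A) !RintegralZl//.
by rewrite (RintegralD measurableT iu iv) (RintegralD measurableT iu3 iv3).
Qed.

(** Without the energy term the interpolation inequality bounds 2 tau int
    |u|^3 uniformly in tau. *)
Lemma eq0_of_self_energy_le0 u G : H1_grad u G -> self_energy u <= 0 ->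
  {ae @lebesgue3 R, forall x, u x = 0}.
Proof.
move=> hu D0; have [mu_ iu mG iG wp] := H1_gradP hu.
have hT tau : 0 < tau -> 2 * tau * (\int[vol3]_x (`|u x| ^+ 3)) <= \int[vol3]_z (grad_norm G z ^+ 2).
  move=> t0; apply: le_trans (cube_le_self_energy mu_ iu mG iG wp t0) _.
  by rewrite gerDl mulr_ge0_le0// sqr_ge0.
set T := \int[vol3]_x (`|u x| ^+ 3) in hT; set H := Rintegral _ _ _ in hT.
have T0 : 0 <= T by apply: Rintegral_ge0 => x _; rewrite exprn_ge0.
have H0 : 0 <= H by apply: Rintegral_ge0 => x _; rewrite sqr_ge0.
have TE : T = 0.
  apply/eqP; rewrite eq_le T0 andbT leNgt; apply/negP => Tgt0.
  have t0 : 0 < (H + 1) / (2 * T) by rewrite divr_gt0 ?mulr_gt0 ?ltr_wpDl.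
  have := hT _ t0; have -> : 2 * ((H + 1) / (2 * T)) * T = H + 1 by field; rewrite gt_eqF.
  lra.
have mu3 : measurable_fun setT (fun x => (`|u x| ^+ 3)%:E).
  by apply/measurable_EFinP; apply: measurable_funX; exact: measurableT_comp.
have I0 : (\int[vol3]_x `|(`|u x| ^+ 3)%:E| = 0)%E.
  under eq_integral do rewrite gee0_abs ?lee_fin ?exprn_ge0//.
  have := integrable_fin_num measurableT (cube_integrable mu_ iu mG iG wp) => /fineK.
  by rewrite -[fine _]/T TE => <-.
have /(ae_eq_integral_abs _ measurableT mu3) := I0.
by apply: filterS => x /(_ I) [/eqP]; rewrite expf_eq0 /= normr_eq0 => /eqP.
Qed.

Lemma Cintegral_eq0 d (T : measurableType d) (m : {measure set T -> \bar R})
  (D : set T) (f : T -> R[i]) : (forall x, D x -> f x = 0) -> Cintegral m D f = 0.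
Proof.
move=> f0; rewrite /Cintegral /Rintegral.
rewrite integral0_eq; last by move=> x Dx; rewrite f0.
by rewrite integral0_eq // => x Dx; rewrite f0.
Qed.

Lemma zero_solution (p lambda mu11 mu22 mu12 : R) :
  solution_in_H p lambda mu11 mu22 mu12 (fun=> 0) (fun=> 0).
Proof.
have N0 : phase_average p 0 0 = 0 :> R[i].
  by rewrite /phase_average Cintegral_eq0 ?mulr0// => t _; rewrite mulr0 addr0 mulr0.
have W V : @weak_equation R lambda V (fun=> phase_average p 0 0) (fun=> 0) (fun _ _ => 0).
  move=> h Gh _; rewrite N0 Cintegral_eq0; last by move=> x _; rewrite mul0r.
  rewrite /Rintegral integral0_eq// => x _.
  by rewrite big1 => [|i _]; rewrite ?mul0r// !mulr0 !mul0r !addr0.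
by exists (fun _ _ => 0), (fun _ _ => 0); split; [exact: H1_grad0|exact: H1_grad0|exact: W|exact: W].
Qed.

End nonexistence.

Theorem theorem1p4 (R : realType) (p lambda mu11 mu22 mu12 : R)
    (hp : 1 < p <= 2) (hlambda : 0 < lambda)
    (hmu11 : 0 < mu11) (hmu22 : 0 < mu22) (hmu12 : 0 < mu12)
    (hthreshold : threshold p lambda
       < (mu11 * mu22 - mu12 ^+ 2) / (mu11 + mu22)) :
  solution_in_H p lambda mu11 mu22 mu12 (fun=> 0) (fun=> 0) /\
  forall u v : R3 R -> R, solution_in_H p lambda mu11 mu22 mu12 u v ->
    {ae @lebesgue3 R, forall x, u x = 0} /\
    {ae @lebesgue3 R, forall x, v x = 0}.
Proof.
split; first exact: zero_solution.
move=> u v [Gu [Gv [hu hv equ eqv]]].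
have [mu_ iu mGu iGu wpu] := H1_gradP hu.
have [mv iv mGv iGv wpv] := H1_gradP hv.
have Eu := energy_sqr_lty mu_ iu mGu iGu wpu.
have Ev := energy_sqr_lty mv iv mGv iGv wpv.
have iu3 := cube_integrable mu_ iu mGu iGu wpu.
have iv3 := cube_integrable mv iv mGv iGv wpv.
pose kap := (mu11 * mu22 - mu12 ^+ 2) / (mu11 + mu22).
pose t := (mu11 - kap) / mu12.
have t0 : 0 < t by exact: coupling_weight_gt0.
have ti0 : 0 < t^-1 by rewrite invr_gt0.
have [Euv Muv] := mutual_energy_le t0 mu_ mv Eu Ev.
have [Evu Mvu] := mutual_energy_le ti0 mv mu_ Ev Eu.
have idu := energy_identity hu mv Eu Euv equ.
have idv := energy_identity hv mu_ Ev Evu eqv.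
have rhs := integral_nonlinearity_le hp hlambda mu_ mv iu iv iu3 iv3.
pose A := cubic_coef p lambda; have A0 : 0 < A by exact: cubic_coef_gt0.
have A20 : 0 < A / 2 by rewrite divr_gt0.
have cu := cube_le_self_energy mu_ iu mGu iGu wpu A20.
have cv := cube_le_self_energy mv iv mGv iGv wpv A20.
rewrite cubic_coef_sqr [2 * _]mulrC divfK// -/(self_energy u) -/(self_energy v) in cu cv.
rewrite -idu -idv -/A in rhs.
rewrite invrK in Mvu.
have Du0 : 0 <= self_energy u by rewrite fine_ge0// energy_ge0 => // x; exact: sqr_ge0.
have Dv0 : 0 <= self_energy v by rewrite fine_ge0// energy_ge0 => // x; exact: sqr_ge0.
have mut := coupling_form_le hmu11 hmu22 hmu12 Dv0 Muv Mvu.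
have D0 := energies_le0 hthreshold rhs cu cv mut.
split; [apply: (eq0_of_self_energy_le0 hu)|apply: (eq0_of_self_energy_le0 hv)].
  by apply: le_trans D0; rewrite lerDl.
by apply: le_trans D0; rewrite lerDr.
Qed.
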